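(* Let $\phi\in\mathcal{S}(T\mathbb{S}^1)$ and let $k,\ell$ be two non-negative integers. Then $\phi$ belongs to the range of the operator $$f\in\mathcal{S}(S^k\times S^\ell)\mapsto L_{k,\ell}f\in\mathcal{S}(T\mathbb{S}^1)$$ if and only if the following two conditions are satisfied: (i) $\phi(\mathrm{i}p\zeta,-\zeta)=(-1)^{k+\ell}\phi(\mathrm{i}p\zeta,\zeta)$ for all $p\in\mathbb{R}$ and $\zeta\in\mathbb{C}$ with $|\zeta|=1$; (ii) for every integer $r\ge0$ there is a homogeneous polynomial $P_{k\ell r}$ of degree $k+\ell+r$ in $(\zeta,\bar\zeta)$ such that $\int_{\mathbb{R}}p^r\phi(\mathrm{i}p\zeta,\zeta)\,dp=P_{k\ell r}(\zeta)$ for all $\zeta\in\mathbb{C}$ with $|\zeta|=1$.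
   Context: $\mathcal{S}(S^k\times S^\ell)$ is the Schwartz space of $(k+\ell)$-tensor fields on $\mathbb{R}^2$ that are symmetric in the first $k$ indices and symmetric in the last $\ell$ indices. $T\mathbb{S}^1=\{(x,\xi)\in\mathbb{R}^2\times\mathbb{S}^1:\langle x,\xi\rangle=0\}$, and $\mathcal{S}(T\mathbb{S}^1)\subset C^\infty(T\mathbb{S}^1)$ is the Schwartz space on $T\mathbb{S}^1$, with the rapid decay (of the function and its derivatives) being with respect to the first component $x$. The mixed ray transform is $L_{k,\ell}f(x,\xi)=\int_{-\infty}^\infty f_{i_1\dots i_kj_1\dots j_\ell}(x+t\xi)\,\xi^{i_1}\cdots\xi^{i_k}\eta^{j_1}\cdots\eta^{j_\ell}\,dt$ with summation over repeated indices in $\{1,2\}$ and $\eta=\xi^\perp=(-\xi_2,\xi_1)$. $\mathbb{R}^2$ is identified with $\mathbb{C}$: a point $(x,\xi)$ is written $(z,\zeta)$ with $z=x_1+\mathrm{i}x_2$, $\zeta=\xi_1+\mathrm{i}\xi_2$, where $\mathrm{i}=\sqrt{-1}$; thus $(\mathrm{i}p\zeta,\pm\zeta)$, $p\in\mathbb{R}$, $|\zeta|=1$, are points of $T\mathbb{S}^1$. Polynomials in $(\zeta,\bar\zeta)$ have complex coefficients. *)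

(* Defs.v *)
From HB Require Import structures.
From mathcomp Require Import all_boot all_order all_algebra all_fingroup.
From mathcomp Require Import all_classical all_reals all_analysis.
From mathcomp Require Import complex.
(* The notations of mpoly clash with those of mathcomp-analysis. *)
From mathcomp Require Import -(notations) mpoly.

Set Implicit Arguments.
Unset Strict Implicit.
Unset Printing Implicit Defensive.

Import Order.TTheory GRing.Theory Num.Theory.
Import numFieldNormedType.Exports.

Local Open Scope classical_set_scope.
Local Open Scope complex_scope.
Local Open Scope ring_scope.

Section Calculus.
Context {R : realType}.

Definition coord1 (x : 'rV[R]_2) : R := x ord0 ord0.
Definition coord2 (x : 'rV[R]_2) : R := x ord0 ord_max.

(* The norm of mathcomp-analysis on 'rV[R]_2 is the sup norm, hence an explicit
   Euclidean inner product. *)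
Definition dotp (x y : 'rV[R]_2) : R := \sum_(i < 2) x ord0 i * y ord0 i.

Definition vec (a b : R) : 'rV[R]_2 := \row_(i < 2) (if i == ord0 then a else b).

Definition vec_of_complex (z : R[i]) : 'rV[R]_2 := vec (complex.Re z) (complex.Im z).

Definition perp (x : 'rV[R]_2) : 'rV[R]_2 := vec (- coord2 x) (coord1 x).

Fixpoint iter_partial (s : seq 'I_2) (f : 'rV[R]_2 -> R) : 'rV[R]_2 -> R :=
  if s is i :: s' then 'D_(delta_mx ord0 i) (iter_partial s' f) else f.

(* All iterated partial derivatives exist and are Frechet differentiable, which
   is membership in C^oo(R^2). *)
Definition smooth2 (f : 'rV[R]_2 -> R) : Prop :=
  forall (s : seq 'I_2) (x : 'rV[R]_2), differentiable (iter_partial s f) x.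

Definition schwartz_R2_real (f : 'rV[R]_2 -> R) : Prop :=
  smooth2 f /\
  forall (a b : nat) (s : seq 'I_2), exists C : R, forall x : 'rV[R]_2,
    `|coord1 x ^+ a * coord2 x ^+ b * iter_partial s f x| <= C.

Definition schwartz_R2 (f : 'rV[R]_2 -> R[i]) : Prop :=
  schwartz_R2_real (fun x => complex.Re (f x)) /\
  schwartz_R2_real (fun x => complex.Im (f x)).

Definition TS1 : set ('rV[R]_2 * 'rV[R]_2) :=
  [set u | dotp u.2 u.2 = 1 /\ dotp u.1 u.2 = 0].

(* The local diffeomorphism (p, theta) |-> (i p e^{i theta}, e^{i theta}) of
   R^2 onto TS^1.  It is the universal covering, and its restrictions to
   intervals of theta shorter than 2 pi are the charts of TS^1; on them |p| is
   the length of the first component.  So phi is smooth on TS^1 iff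
   phi \o TS1_param is smooth on R^2, and decay in x is decay in p; it is
   uniform in theta by periodicity. *)
Definition TS1_param (q : 'rV[R]_2) : 'rV[R]_2 * 'rV[R]_2 :=
  let zeta := cos (coord2 q) +i* sin (coord2 q) in
  (vec_of_complex ('i%C * (coord1 q)%:C * zeta), vec_of_complex zeta).

Definition schwartz_TS1_real (phi : 'rV[R]_2 * 'rV[R]_2 -> R) : Prop :=
  smooth2 (phi \o TS1_param) /\
  forall (m : nat) (s : seq 'I_2), exists C : R, forall q : 'rV[R]_2,
    `|coord1 q ^+ m * iter_partial s (phi \o TS1_param) q| <= C.

(* A function on TS^1 is represented by a function on R^2 * R^2 of which only
   the values on TS1 matter: TS1_param takes its values in TS1. *)
Definition schwartz_TS1 (phi : 'rV[R]_2 * 'rV[R]_2 -> R[i]) : Prop :=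
  schwartz_TS1_real (fun u => complex.Re (phi u)) /\
  schwartz_TS1_real (fun u => complex.Im (phi u)).

Definition cintegral (g : R -> R[i]) : R[i] :=
  (\int[lebesgue_measure]_(t in [set: R]) complex.Re (g t)) +i*
  (\int[lebesgue_measure]_(t in [set: R]) complex.Im (g t)).

End Calculus.

Section MixedRayTransform.
Context {R : realType}.

(* Components f_{i_1..i_k j_1..j_l}; the two functions are the multi-indices. *)
Definition tensor_field (k l : nat) : Type :=
  {ffun 'I_k -> 'I_2} -> {ffun 'I_l -> 'I_2} -> 'rV[R]_2 -> R[i].

Definition bisymmetric k l (f : tensor_field k l) : Prop :=
  forall (s : 'S_k) (t : 'S_l)
    (I : {ffun 'I_k -> 'I_2}) (J : {ffun 'I_l -> 'I_2}),
    f [ffun a => I (s a)] [ffun b => J (t b)] = f I J.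

Definition schwartz_tensor k l (f : tensor_field k l) : Prop :=
  bisymmetric f /\ forall I J, schwartz_R2 (f I J).

Definition mixed_ray_transform k l (f : tensor_field k l)
    (u : 'rV[R]_2 * 'rV[R]_2) : R[i] :=
  let x := u.1 in let xi := u.2 in let eta := perp xi in
  cintegral (fun t =>
    \sum_(I : {ffun 'I_k -> 'I_2}) \sum_(J : {ffun 'I_l -> 'I_2})
      f I J (x + t *: xi) *
      (\prod_(a < k) xi ord0 (I a))%:C * (\prod_(b < l) eta ord0 (J b))%:C).

Definition homogeneous d (P : mpoly 2 R[i]) : Prop :=
  P \is ishomog1 d (@mdeg 2).

(* The two variables of P stand for zeta and its conjugate. *)
Definition eval_zeta (P : mpoly 2 R[i]) (zeta : R[i]) : R[i] :=
  meval (fun i : 'I_2 => if i == ord0 then zeta else (zeta^*)%C) P.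

End MixedRayTransform.

Arguments tensor_field R k l : clear implicits.

(* Main.v *)
(** Real and imaginary parts are treated separately, with m = k + l.  Write
    [zeta = (cos t, sin t)] and [omega = (- sin t, cos t)], so that the line of
    [TS1_param (p, t)] is [p omega + R zeta].

    Necessity: (i) is the substitution [s -> - s] on the line.  For (ii), by
    rotation invariance of the plane integral, the moment of order r of the ray
    transform of [u] is the integral of [<y, omega>^r u(y)], a homogeneous
    polynomial of degree r in [zeta].

    Sufficiency: let [F(s, t)] be the Fourier transform of [phi] in p.  By (ii)
    its r-th radial derivative at [s = 0] is homogeneous of degree m + r in
    [zeta], and by (i) [F(- s, t + pi) = (-1)^m F(s, t)].  If m > 0 then
    [F = cos t F1 + sin t F2] with [F1], [F2] of the same kind for m - 1:
    take [F1 = cos t F - sin t H] and [F2 = sin t F + cos t H] where the jet of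
    [H] at [s = 0] is the one that Euler's identity for a function homogeneous
    of degree m + r prescribes.  If m = 0 then [F(s, t) = b(s omega)] with [b]
    Schwartz on the plane.  So [F] is a combination of the monomials of degree m
    in [(cos t, sin t)] whose coefficients are Schwartz functions of [s omega];
    the projection-slice theorem turns these into ray transforms, and every
    monomial is the contraction of a constant bisymmetric tensor with the powers
    of [zeta] and of its rotation by a right angle. *)

Require Import Defs.
From HB Require Import structures.
From mathcomp Require Import all_boot all_order all_algebra all_fingroup.
From mathcomp Require Import all_classical all_reals all_analysis.
From mathcomp Require Import complex.
From mathcomp Require Import -(notations) mpoly.
From mathcomp Require Import measurable_realfun.
From mathcomp Require Import ring lra zify.

Set Implicit Arguments.
Unset Strict Implicit.
Unset Printing Implicit Defensive.

Import Order.TTheory GRing.Theory Num.Theory.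
Import numFieldNormedType.Exports.

Local Open Scope classical_set_scope.
Local Open Scope complex_scope.
Local Open Scope ring_scope.

(** * Frechet differentiability from continuous partial derivatives *)

Section Partials.
Context {R : realType}.
Implicit Types (f g : 'rV[R]_2 -> R) (x y h : 'rV[R]_2) (i j : 'I_2).

(** All function spaces are instances of one predicate [SB w], whose weight [w] tells where decay is
    required: nowhere, in the first variable (the cylinder) or in both (the plane). Membership is
    shown by exhibiting a class stable under differentiation up to finite sums, so that no formula
    for higher derivatives is written. Real cosine and sine transforms replace the complex
    exponential, and the planar transform is two one-dimensional ones in succession, the other
    variable being a parameter.

    The delicate place is the origin of the plane, where polar coordinates degenerate: a smooth
    function of [(s, t)] descends to a smooth function of [s omega] only thanks to the homogeneity
    of its jets at [s = 0]. For each K the function is split into a planar Schwartz function and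
    [s^K H], with K chosen according to the number of derivatives under study. The splitting is
    Hadamard division, with a Gaussian factor that keeps all terms rapidly decreasing. *)

Definition partial i f : 'rV[R]_2 -> R := fun x => 'D_(delta_mx ord0 i) f x.

Definition total f := forall x, differentiable f x.

Lemma big_ord2 (T : nmodType) (F : 'I_2 -> T) :
  \sum_(i < 2) F i = F ord0 + F ord_max.
Proof. by rewrite big_ord_recl big_ord1; congr (_ + F _); apply: val_inj. Qed.

Lemma ord2P i : i = ord0 \/ i = ord_max.
Proof. by case: i => -[|[|//]] Hi; [left|right]; apply: val_inj. Qed.

Lemma row_delta h : h = h ord0 ord0 *: delta_mx ord0 ord0 +
  h ord0 ord_max *: delta_mx ord0 ord_max.
Proof.
apply/rowP => i; rewrite !mxE.
by case: (ord2P i) => ->; rewrite /= ?mulr1 ?mulr0 ?addr0 ?add0r.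
Qed.

Lemma le_coord_norm h i : `|h ord0 i| <= `|h|.
Proof.
rewrite [leRHS]/Num.Def.normr /= mx_normrE.
by apply/bigmax_geP; right => /=; exists (ord0, i).
Qed.

Lemma diff_partial f x h : differentiable f x ->
  'd f x h = h ord0 ord0 * partial ord0 f x + h ord0 ord_max * partial ord_max f x.
Proof.
by move=> df; rewrite /partial !deriveE// {1}(row_delta h) linearD !linearZ.
Qed.

(** A quadratic remainder is little-o of the increment, so the linear form with coefficients [a] is
    the Frechet differential by uniqueness. This serves for integrals with a parameter and for
    functions given in polar coordinates, at the origin. *)
Lemma differentiable_quadratic_near f x (a : 'I_2 -> R) (C d : R) : 0 < d ->
  (forall h, `|h| < d -> `|f (h + x) - f x - (h ord0 ord0 * a ord0 + h ord0 ord_max * a ord_max)|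
      <= C * `|h| ^+ 2) ->
  differentiable f x /\ forall i, partial i f x = a i.
Proof.
move=> dp hC.
pose l h : R^o := h ord0 ord0 * a ord0 + h ord0 ord_max * a ord_max.
have llin : linear l.
  by move=> k u v; rewrite /l !mxE /= /GRing.scale /=; ring.
pose lM := GRing.isLinear.Build _ _ _ _ _ llin.
pose L : {linear 'rV[R]_2 -> R^o} := HB.pack l lM.
have Lcont : continuous L.
  move=> y; apply: (@differentiable_continuous _ _ R^o).
  apply: (@differentiableD _ _ R^o (fun h => h ord0 ord0 * a ord0) (fun h => h ord0 ord_max * a ord_max));
    apply: differentiableM; by [exact: differentiable_coord|exact: differentiable_cst].
have small (r : R) : 0 < r -> \forall h \near (0 : 'rV[R]_2), `|h| <= r.
  move=> r0; apply/nbhs_ballP; exists r => //= y.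
  by rewrite -ball_normE/= sub0r normrN => /ltW.
have df : (f \o shift x : _ -> R^o) = cst (f x) + L +o_ (0 : 'rV[R]_2) id.
  apply/eqaddoP => e0 e00; have {e00} : 0 < (e0 : R) := e00.
  move: (e0 : R) => e ep.
  have Ch : \forall h \near (0 : 'rV[R]_2), `|C| * `|h| <= e.
    have [->|C0] := eqVneq C 0.
      by apply: filterS (small _ ltr01) => h _; rewrite normr0 mul0r ltW.
    have d0 : 0 < e / `|C| by rewrite divr_gt0// normr_gt0.
    by apply: filterS (small _ d0) => h; rewrite ler_pdivlMr ?normr_gt0// mulrC.
  have d2 : 0 < d / 2 by rewrite divr_gt0.
  apply: filterS2 Ch (small _ d2) => h h2 hd.
  have h1 : `|f (h + x) - f x - (h ord0 ord0 * a ord0 + h ord0 ord_max * a ord_max)| <= C * `|h| ^+ 2.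
    by apply: hC; apply: le_lt_trans hd _; rewrite ltr_pdivrMr// mulr_natr mulr2n ltrDl.
  rewrite /= !fctE opprD addrA.
  apply: (le_trans h1); rewrite expr2 mulrA ler_wpM2r//; apply: le_trans h2.
  by rewrite ler_wpM2r// ler_norm.
have dL := @diff_unique _ _ _ (f : _ -> R^o) L x Lcont df.
have dfx : differentiable f x.
  by apply/diff_locallyP; rewrite dL; split.
split=> // i; rewrite /partial deriveE//.
have -> : 'd f x (delta_mx ord0 i) = l (delta_mx ord0 i) by rewrite dL.
by rewrite /l !mxE; case: (ord2P i) => ->; rewrite /= mul1r mul0r ?addr0 ?add0r.
Qed.

Lemma differentiable_quadratic f x (a : 'I_2 -> R) (C : R) :
  (forall h, `|f (h + x) - f x - (h ord0 ord0 * a ord0 + h ord0 ord_max * a ord_max)|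
      <= C * `|h| ^+ 2) ->
  differentiable f x /\ forall i, partial i f x = a i.
Proof. by move=> hC; apply: (@differentiable_quadratic_near f x a C 1) => // h _. Qed.

(** The difference vanishes near [x], so it satisfies the quadratic criterion with constant 0. *)
Lemma differentiable_local f g x (d : R) : 0 < d ->
  (forall h, `|h| < d -> f (h + x) = g (h + x)) -> differentiable g x -> differentiable f x.
Proof.
move=> d0 fg dg; pose e y := f y - g y.
have [de _] : differentiable e x /\ forall i, partial i e x = 0.
  apply: (@differentiable_quadratic_near e x (fun=> 0) 0 d) => // h hd.
  have := fg 0; rewrite normr0 add0r => /(_ d0) fgx.
  by rewrite /e fg// fgx !subrr !mulr0 addr0 subr0 normr0 mul0r.
have -> : f = fun y => e y + g y by apply/funext => y; rewrite /e subrK.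
exact: differentiableD.
Qed.

End Partials.

Section Calculus_rules.
Context {R : realType}.
Implicit Types (f g : 'rV[R]_2 -> R) (x y h : 'rV[R]_2) (i j : 'I_2).

Lemma vecE (x : 'rV[R]_2) : vec (coord1 x) (coord2 x) = x.
Proof. by apply/rowP => i; rewrite !mxE; case: (ord2P i) => ->. Qed.

Lemma totalD f g : total f -> total g -> total (fun x => f x + g x).
Proof. by move=> df dg x; exact: differentiableD. Qed.

Lemma totalM f g : total f -> total g -> total (fun x => f x * g x).
Proof. by move=> df dg x; exact: differentiableM. Qed.

Lemma total_cst (c : R) : total (fun=> c).
Proof. by move=> x; exact: differentiable_cst. Qed.

Lemma total_coord i : total (fun x => x ord0 i).
Proof. by move=> x; exact: differentiable_coord. Qed.

Lemma partialD f g i : total f -> total g ->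
  partial i (fun x => f x + g x) = fun x => partial i f x + partial i g x.
Proof.
move=> df dg; apply/funext => x; rewrite /partial.
apply: deriveD; exact: diff_derivable.
Qed.

Lemma partialM f g i : total f -> total g ->
  partial i (fun x => f x * g x) =
  fun x => partial i f x * g x + f x * partial i g x.
Proof.
move=> df dg; apply/funext => x; rewrite /partial.
have -> := deriveM (diff_derivable (df x)) (diff_derivable (dg x)).
by rewrite addrC /GRing.scale/= mulrC.
Qed.

Lemma partial_cst (c : R) i : partial i (fun=> c) = fun=> 0.
Proof. by apply/funext => x; rewrite /partial derive_cst. Qed.

Lemma partialZ (c : R) f i : total f ->
  partial i (fun x => c * f x) = fun x => c * partial i f x.
Proof.
move=> df; rewrite (partialM _ (total_cst c) df) partial_cst.
by apply/funext => x; rewrite mul0r add0r.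
Qed.

Lemma totalN f : total f -> total (fun x => - f x).
Proof. by move=> df x; exact: differentiableN. Qed.

Lemma diff_vec (W : normedModType R) (u v : W -> R) (q : W) :
  differentiable u q -> differentiable v q ->
  differentiable (fun z => vec (u z) (v z)) q /\
  forall k : W, 'd (fun z => vec (u z) (v z)) q k = vec ('d u q k) ('d v q k).
Proof.
move=> du dv.
have E : (fun z => vec (u z) (v z)) =
   ((fun z => u z *: (delta_mx ord0 ord0 : 'rV[R]_2)) \+ (fun z => v z *: delta_mx ord0 ord_max)).
  apply/funext => z /=; rewrite [LHS]row_delta; congr (_ *: _ + _ *: _).
    by rewrite mxE.
  by rewrite mxE.
pose F1 z : 'rV[R]_2 := u z *: delta_mx ord0 ord0.
pose F2 z : 'rV[R]_2 := v z *: delta_mx ord0 ord_max.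
have d1 : differentiable F1 q by exact: differentiableZl.
have d2 : differentiable F2 q by exact: differentiableZl.
rewrite E -/F1 -/F2; split; first exact: differentiableD.
move=> k; apply: etrans (congr1 (fun F : W -> 'rV[R]_2 => F k) (diffD d1 d2)) _.
apply: etrans (congr2 +%R (congr1 (fun F : W -> 'rV[R]_2 => F k) (diffZl _ du))
  (congr1 (fun F : W -> 'rV[R]_2 => F k) (diffZl _ dv))) _.
by rewrite [RHS]row_delta !mxE.
Qed.

Lemma diff_comp_vec (W : normedModType R) (u v : W -> R) (q : W) f :
  differentiable u q -> differentiable v q -> differentiable f (vec (u q) (v q)) ->
  differentiable (fun z => f (vec (u z) (v z))) q /\
  forall k : W, 'd (fun z => f (vec (u z) (v z))) q k =
   'd u q k * partial ord0 f (vec (u q) (v q)) +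
   'd v q k * partial ord_max f (vec (u q) (v q)).
Proof.
move=> du dv df; have [dA dAE] := diff_vec du dv.
split; first exact: (@differentiable_comp _ _ _ _ (fun z => vec (u z) (v z)) f).
move=> k; rewrite (@diff_comp _ _ _ _ (fun z => vec (u z) (v z)) f)//=.
by rewrite dAE diff_partial// !mxE.
Qed.

Lemma partial_comp_vec (u v f : 'rV[R]_2 -> R) i : total u -> total v -> total f ->
  total (fun z => f (vec (u z) (v z))) /\
  partial i (fun z => f (vec (u z) (v z))) = fun q =>
   partial i u q * partial ord0 f (vec (u q) (v q)) +
   partial i v q * partial ord_max f (vec (u q) (v q)).
Proof.
move=> du dv df; split=> [q|]; first by case: (diff_comp_vec (du q) (dv q) (df _)).
apply/funext => q; have [d1 dE] := diff_comp_vec (du q) (dv q) (df _).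
by rewrite {1}/partial deriveE// dE -!deriveE.
Qed.

Lemma is_derive_comp_vec (u v : R -> R) (du dv t : R) f :
  is_derive t 1 u du -> is_derive t 1 v dv -> differentiable f (vec (u t) (v t)) ->
  is_derive t 1 (fun t => f (vec (u t) (v t)))
   (du * partial ord0 f (vec (u t) (v t)) + dv * partial ord_max f (vec (u t) (v t))).
Proof.
move=> [u1 u2] [v1 v2] df.
have du' := (derivable1_diffP u t).1 u1.
have dv' := (derivable1_diffP v t).1 v1.
have [d1 dE] := diff_comp_vec du' dv' df.
apply: DeriveDef; first exact: (derivable1_diffP _ t).2 d1.
apply: etrans (deriveE _ d1) _; apply: etrans (dE 1) _.
by rewrite -(deriveE _ du') -(deriveE _ dv') u2 v2.
Qed.

Lemma partial_comp1 (k k' : R -> R) f i : (forall t : R, is_derive t 1 k (k' t)) ->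
  total f -> total (fun x => k (f x)) /\
  partial i (fun x => k (f x)) = fun x => k' (f x) * partial i f x.
Proof.
move=> dk df.
have dk' t := (derivable1_diffP k t).1 (let: DeriveDef d _ := dk t in d).
split=> [x|]; first exact: (@differentiable_comp _ _ _ _ f k).
apply/funext => x; rewrite {1}/partial.
have dfk : differentiable (fun x => k (f x)) x by exact: (@differentiable_comp _ _ _ _ f k).
apply: etrans (deriveE _ dfk) _.
apply: etrans (congr1 (fun F => F (delta_mx ord0 i)) (diff_comp (df x) (dk' (f x)))) _.
rewrite /= -(deriveE _ (df x)) -/(partial i f x).
have [kd kE] := dk (f x).
have -> := congr1 (fun F => F (partial i f x)) (deriv1E kd).
by rewrite /GRing.scale/= derive1E kE mulrC.
Qed.

Lemma partial_coord i j : partial i (fun x => x ord0 j) = fun=> (i == j)%:R.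
Proof.
apply/funext => x; rewrite /partial.
have := @differentiable_quadratic R (fun x => x ord0 j) x (fun i => (i == j)%:R) 0.
case => [h|_ /(_ i)//]; rewrite mul0r !mxE addrK.
by case: (ord2P j) => -> /=; rewrite mulr1 mulr0 ?addr0 ?add0r subrr normr0.
Qed.

End Calculus_rules.

(** * Smooth functions with weighted bounds *)

Section Weighted_smooth.
Context {R : realType}.
Implicit Types (f g w : 'rV[R]_2 -> R) (i j : 'I_2).

Definition bounded_by w f := forall m, exists C : R, forall x, w x ^+ m * `|f x| <= C.

(* For [w = 1] these are the functions all of whose derivatives are bounded; for
   [w] going to infinity, those that are rapidly decreasing there. *)
Definition SB w f := smooth2 f /\ forall s, bounded_by w (iter_partial s f).

Lemma iter_partial_cat s t f :
  iter_partial (s ++ t) f = iter_partial s (iter_partial t f).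
Proof. by elim: s => //= i s ->. Qed.

(** The product and chain rules turn one function of a class into a sum of two, hence stability
    under differentiation is asked only up to finite sums. *)
Inductive sum_closure (X : set ('rV[R]_2 -> R)) : ('rV[R]_2 -> R) -> Prop :=
| sum_gen f : X f -> sum_closure X f
| sum_add f g : sum_closure X f -> sum_closure X g ->
    sum_closure X (fun x => f x + g x).

Lemma bounded_byD w f g : (forall x, 0 <= w x) -> bounded_by w f -> bounded_by w g ->
  bounded_by w (fun x => f x + g x).
Proof.
move=> w0 bf bg m; have [C hC] := bf m; have [D hD] := bg m.
exists (C + D) => x; apply: le_trans (lerD (hC x) (hD x)).
by rewrite -mulrDr ler_wpM2l ?exprn_ge0// ler_normD.
Qed.

(* A class of functions stable under partial derivatives, up to finite sums,
   consists of smooth functions. *)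
Lemma SB_coind w (X : set ('rV[R]_2 -> R)) : (forall x, 0 <= w x) ->
  (forall f, X f -> total f) ->
  (forall f i, X f -> sum_closure X (partial i f)) ->
  (forall f, X f -> bounded_by w f) ->
  forall f, sum_closure X f -> SB w f.
Proof.
move=> w0 Xd Xp Xb.
have Sd f : sum_closure X f -> total f.
  by elim=> [g /Xd//|g h _ dg _ dh]; exact: totalD.
have Sp f i : sum_closure X f -> sum_closure X (partial i f).
  elim=> [g /Xp//|g h Xg dg Xh dh].
  by rewrite partialD; [exact: sum_add|exact: Sd|exact: Sd].
have Sb f : sum_closure X f -> bounded_by w f.
  by elim=> [g /Xb//|g h _ bg _ bh]; exact: bounded_byD.
have Si f s : sum_closure X f -> sum_closure X (iter_partial s f).
  by move=> Xf; elim: s => //= i s; exact: Sp.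
by move=> f Xf; split=> [s x|s m]; [exact/Sd/Si|exact/Sb/Si].
Qed.

Lemma SB_total w f : SB w f -> total f.
Proof. by case=> sf _; exact: (sf [::]). Qed.

Lemma SB_bounded w f : SB w f -> bounded_by w f.
Proof. by case=> _ bf; exact: (bf [::]). Qed.

Lemma SB_partial w f i : SB w f -> SB w (partial i f).
Proof.
move=> [sf bf]; have E s : iter_partial s (partial i f) = iter_partial (s ++ [:: i]) f.
  by rewrite iter_partial_cat.
by split=> [s x|s m]; rewrite E; [exact: sf|exact: bf].
Qed.

Lemma SB_iter w f s : SB w f -> SB w (iter_partial s f).
Proof. by move=> Sf; elim: s => //= i s; exact: SB_partial. Qed.

Lemma SBD w f g : (forall x, 0 <= w x) -> SB w f -> SB w g -> SB w (fun x => f x + g x).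
Proof.
move=> w0 Sf Sg; apply: (@SB_coind w (SB w)) => //.
- by move=> h; exact: SB_total.
- by move=> h i Sh; exact/sum_gen/SB_partial.
- by move=> h; exact: SB_bounded.
- by apply: sum_add; exact: sum_gen.
Qed.

(** Derivatives of a product are sums of products of the same kind. Weights multiply: a Gaussian in
    one variable gives decay in that variable, two Gaussians give decay in the plane. *)
Lemma SBM w w' f g : (forall x, 0 <= w x) -> (forall x, 0 <= w' x) ->
  SB w f -> SB w' g -> SB (fun x => w x * w' x) (fun x => f x * g x).
Proof.
move=> w0 w0' Sf Sg.
pose X h := exists u v, [/\ SB w u, SB w' v & h = fun x => u x * v x].
apply: (@SB_coind _ X).
- by move=> x; exact: mulr_ge0.
- by move=> _ [u [v [Su Sv ->]]]; apply: totalM; apply: SB_total; eassumption.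
- move=> _ i [u [v [Su Sv ->]]]; rewrite partialM; try by apply: SB_total; eassumption.
  by apply: sum_add; apply: sum_gen; [exists (partial i u), v|exists u, (partial i v)];
    split=> //; exact: SB_partial.
- move=> _ [u [v [Su Sv ->]]] m.
  have [C hC] := SB_bounded Su m; have [D hD] := SB_bounded Sv m.
  exists (C * D) => x; rewrite exprMn normrM mulrACA.
  by apply: ler_pM; rewrite ?mulr_ge0 ?exprn_ge0.
- by apply: sum_gen; exists f, g.
Qed.

(** Every power of the weight is controlled, so polynomial domination of one weight by the other
    suffices. *)
Lemma SB_weaken w w' f (C : R) k : (forall x, 0 <= w x) -> (forall x, 0 <= w' x) ->
  (forall x, w' x <= C * w x ^+ k) -> SB w f -> SB w' f.
Proof.
move=> w0 w0' ww [sf bf]; split=> // s m.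
have [D hD] := bf s (k * m)%N; exists (`|C| ^+ m * D) => x.
have wk : w' x ^+ m <= `|C| ^+ m * `|w x ^+ (k * m)|.
  rewrite exprM normrX -exprMn -normrM; apply: lerXn2r; rewrite ?nnegrE//.
  by apply: le_trans (ww x) (ler_norm _).
apply: le_trans (ler_wpM2r (normr_ge0 _) wk) _.
rewrite -mulrA ler_wpM2l ?exprn_ge0//; apply: le_trans (hD x).
by rewrite ler_wpM2r//; rewrite ger0_norm// exprn_ge0.
Qed.

Lemma SB_cst (c : R) : SB (fun=> 1) (fun=> c).
Proof.
pose X h := exists c : R, h = fun _ : 'rV[R]_2 => c.
apply: (@SB_coind _ X) => //.
- by move=> _ [d ->]; exact: total_cst.
- by move=> _ i [d ->]; rewrite partial_cst; apply: sum_gen; exists 0.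
- by move=> _ [d ->] m; exists `|d| => x; rewrite expr1n mul1r.
- by apply: sum_gen; exists c.
Qed.

Lemma SBZ w f (c : R) : (forall x, 0 <= w x) -> SB w f -> SB w (fun x => c * f x).
Proof.
move=> w0 Sf; have := SBM (fun=> ler01) w0 (SB_cst c) Sf.
by congr SB; apply/funext => x; rewrite mul1r.
Qed.

Lemma SB_mul1 w f g : (forall x, 0 <= w x) -> SB (fun=> 1) f -> SB w g ->
  SB w (fun x => f x * g x).
Proof.
move=> w0 Sf Sg; have := SBM (fun=> ler01) w0 Sf Sg.
by congr SB; apply/funext => x; rewrite mul1r.
Qed.

(** Differentiating [x_j u] may remove the factor [x_j], whence the two kinds of members of [X]; the
    factor itself costs one power of the weight. *)
Lemma SB_coord w f j : (forall x : 'rV[R]_2, `|x ord0 j| <= w x) -> SB w f ->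
  SB w (fun x => x ord0 j * f x).
Proof.
move=> cw Sf; have w0 x : 0 <= w x by exact: le_trans (cw x).
pose X h := SB w h \/ exists2 u, SB w u & h = fun x => x ord0 j * u x.
apply: (@SB_coind _ X) => //.
- move=> h [Sh|[u Su ->]]; first exact: SB_total Sh.
  by apply: totalM; [exact: total_coord|exact: SB_total Su].
- move=> h i [Sh|[u Su ->]]; first by apply: sum_gen; left; exact: SB_partial.
  rewrite partialM; [|exact: total_coord|exact: SB_total Su].
  apply: sum_add; apply: sum_gen; last first.
    by right; exists (partial i u) => //; exact: SB_partial.
  by left; rewrite partial_coord; exact: SBZ.
- move=> h [Sh|[u Su ->]] m; first exact: SB_bounded.
  have [C hC] := SB_bounded Su m.+1; exists C => x; apply: le_trans (hC x).
  by rewrite exprS normrM mulrA ler_wpM2r// mulrC ler_wpM2r// exprn_ge0.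
- by apply: sum_gen; right; exists f.
Qed.

(** The boolean index treats sine and cosine at once: differentiation negates it and multiplies by
    the sign [dtrig]. *)
Definition trig (c : bool) (t : R) : R := if c then cos t else sin t.

Definition dtrig (c : bool) : R := if c then -1 else 1.

Lemma is_derive_trig c (t : R) : is_derive t 1 (trig c) (dtrig c * trig (~~ c) t).
Proof.
by case: c => /=; rewrite /dtrig ?mul1r ?mulN1r; [exact: is_derive_cos|exact: is_derive_sin].
Qed.

Lemma norm_trig c t : `|trig c t| <= 1.
Proof.
by case: c; rewrite /trig ler_norml ?cos_geN1 ?cos_le1 ?sin_geN1 ?sin_le1.
Qed.

Lemma norm_dtrig c : `|dtrig c| = 1.
Proof. by case: c; rewrite /dtrig ?normrN1 ?normr1. Qed.

Lemma partial_trig c i j : total (fun x : 'rV[R]_2 => trig c (x ord0 j)) /\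
  partial i (fun x : 'rV[R]_2 => trig c (x ord0 j)) =
  fun x => dtrig c * trig (~~ c) (x ord0 j) * (i == j)%:R.
Proof.
have := partial_comp1 i (fun t : R => is_derive_trig c t) (@total_coord R j).
by rewrite partial_coord.
Qed.

Lemma SB_trig c j : SB (fun=> 1) (fun x : 'rV[R]_2 => trig c (x ord0 j)).
Proof.
pose X h := exists (c : bool) (e : R), `|e| <= 1 /\
  h = fun x : 'rV[R]_2 => e * trig c (x ord0 j).
apply: (@SB_coind _ X) => //.
- by move=> _ [d [e [_ ->]]]; apply: totalM; [exact: total_cst|exact: (partial_trig d j j).1].
- move=> _ i [d [e [e1 ->]]]; apply: sum_gen.
  exists (~~ d), (e * dtrig d * (i == j)%:R); split.
    by rewrite !normrM norm_dtrig mulr1; case: (i == j); rewrite ?normr1 ?normr0 ?mulr1 ?mulr0.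
  rewrite partialZ; last exact: (partial_trig d j j).1.
  by rewrite (partial_trig d i j).2; apply/funext => x; ring.
- move=> _ [d [e [e1 ->]]] m; exists 1 => x; rewrite expr1n mul1r normrM.
  by rewrite -[leRHS]mulr1 ler_pM// norm_trig.
- by apply: sum_gen; exists c, 1; split; [rewrite normr1|apply/funext => x; rewrite mul1r].
Qed.

End Weighted_smooth.

(** * Affine substitutions and Gaussians *)

Section Affine.
Context {R : realType}.
Implicit Types (f g w : 'rV[R]_2 -> R) (x h : 'rV[R]_2).

Section Real_variable.
Context (u v : R -> R) (du dv t : R).
Context (hu : is_derive t 1 u du) (hv : is_derive t 1 v dv).

Lemma is_derive_add : is_derive t 1 (fun t => u t + v t) (du + dv).
Proof. exact: is_deriveD. Qed.

Lemma is_derive_opp : is_derive t 1 (fun t => - u t) (- du).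
Proof. exact: is_deriveN. Qed.

Lemma is_derive_mul : is_derive t 1 (fun t => u t * v t) (du * v t + u t * dv).
Proof.
apply: is_derive_eq (is_deriveM hu hv) _.
by rewrite /GRing.scale /= addrC mulrC.
Qed.

End Real_variable.

Lemma is_derive_const (c t : R) : is_derive t 1 (fun=> c) 0.
Proof. exact: is_derive_cst. Qed.

Lemma is_derive_self (t : R) : is_derive t 1 (fun t => t) 1.
Proof. exact: is_derive_id. Qed.

Lemma is_derive_line (a b t : R) : is_derive t 1 (fun t => a + t * b) b.
Proof.
have h := is_derive_mul (is_derive_self t) (is_derive_const b t).
apply: is_derive_eq (is_derive_add (is_derive_const a t) h) _.
by rewrite add0r mul1r mulr0 addr0.
Qed.

Lemma mean_value f x h : total f -> exists2 c : R, c \in `[0, 1] &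
  f (h + x) - f x = h ord0 ord0 * partial ord0 f (c *: h + x) +
                    h ord0 ord_max * partial ord_max f (c *: h + x).
Proof.
move=> df.
pose u (i : 'I_2) (t : R) := x ord0 i + t * h ord0 i.
have E t : vec (u ord0 t) (u ord_max t) = t *: h + x.
  by apply/rowP => i; rewrite !mxE; case: (ord2P i) => -> /=; rewrite /u addrC.
have D t := is_derive_comp_vec (is_derive_line (x ord0 ord0) (h ord0 ord0) t)
   (is_derive_line (x ord0 ord_max) (h ord0 ord_max) t) (df (vec (u ord0 t) (u ord_max t))).
have [|c c01 Ec] := MVT_segment (@ler01 R) (fun t _ => D t).
  by apply: derivable_within_continuous => t _; case: (D t).
exists c => //; move: Ec; rewrite subr0 mulr1 -!/(u _ _) !E.
by rewrite scale1r scale0r add0r => ->.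
Qed.

Lemma lipschitz_partial f (C : R) x h : total f ->
  (forall i y, `|partial i f y| <= C) -> `|f (h + x) - f x| <= 2 * C * `|h|.
Proof.
move=> df bf; have [c _ ->] := mean_value x h df.
have C0 : 0 <= C by apply: le_trans (bf ord0 0).
apply: le_trans (ler_normD _ _) _; rewrite !normrM (mulrC 2) mulr2n mulrDr mulr1 mulrDl.
by apply: lerD; rewrite mulrC ler_pM// le_coord_norm.
Qed.

(** The growth condition on the weights takes the place of invertibility, so that [A] may be a
    projection, as in the restriction to the axis [s = 0]. *)
Lemma SB_affine w w' f (a0 a1 a2 b0 b1 b2 C : R) k :
  let A x := vec (a0 + (a1 * x ord0 ord0 + a2 * x ord0 ord_max))
                 (b0 + (b1 * x ord0 ord0 + b2 * x ord0 ord_max)) in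
  (forall x, 0 <= w x) -> (forall x, 0 <= w' x) ->
  (forall x, w' x <= C * w (A x) ^+ k) -> SB w f -> SB w' (fun x => f (A x)).
Proof.
move=> A w0 w0' ww Sf.
pose X (h : 'rV[R]_2 -> R) := exists g, SB w g /\ h = fun x => g (A x).
have dl (c c0 c1 : R) : total (fun x : 'rV[R]_2 => c + (c0 * x ord0 ord0 + c1 * x ord0 ord_max)).
  apply: totalD; first exact: total_cst.
  by apply: totalD; apply: totalM; by [exact: total_cst|exact: total_coord].
have dp (c c0 c1 : R) i : partial i (fun x : 'rV[R]_2 => c + (c0 * x ord0 ord0 + c1 * x ord0 ord_max)) =
    fun=> c0 * (i == ord0)%:R + c1 * (i == ord_max)%:R.
  have h0 : total (fun x : 'rV[R]_2 => c0 * x ord0 ord0).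
    by apply: totalM; by [exact: total_cst|exact: total_coord].
  have h1 : total (fun x : 'rV[R]_2 => c1 * x ord0 ord_max).
    by apply: totalM; by [exact: total_cst|exact: total_coord].
  rewrite partialD; [|exact: total_cst|exact: totalD].
  rewrite partialD// !partialZ; try exact: total_coord.
  by rewrite !partial_coord partial_cst; apply/funext => x; rewrite add0r.
have dA g : total g -> total (fun x => g (A x)).
  by move=> dg; exact: (partial_comp_vec ord0 (dl _ _ _) (dl _ _ _) dg).1.
apply: (@SB_coind _ _ X) => //.
- by move=> _ [g [Sg ->]]; apply/dA/SB_total/Sg.
- move=> _ i [g [Sg ->]].
  rewrite (partial_comp_vec i (dl _ _ _) (dl _ _ _) (SB_total Sg)).2 !dp.
  apply: sum_add; apply: sum_gen.
    exists (fun x => (a1 * (i == ord0)%:R + a2 * (i == ord_max)%:R) * partial ord0 g x).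
    by split=> //; exact: SBZ w0 (SB_partial ord0 Sg).
  exists (fun x => (b1 * (i == ord0)%:R + b2 * (i == ord_max)%:R) * partial ord_max g x).
  by split=> //; exact: SBZ w0 (SB_partial ord_max Sg).
- move=> _ [g [Sg ->]] m; have [D hD] := SB_bounded Sg (k * m)%N.
  exists (`|C| ^+ m * D) => x.
  have wk : w' x ^+ m <= `|C| ^+ m * `|w (A x) ^+ (k * m)|.
    rewrite exprM normrX -exprMn -normrM; apply: lerXn2r; rewrite ?nnegrE//.
    by apply: le_trans (ww x) (ler_norm _).
  apply: le_trans (ler_wpM2r (normr_ge0 _) wk) _.
  rewrite -mulrA ler_wpM2l ?exprn_ge0//; apply: le_trans (hD (A x)).
  by rewrite ler_wpM2r//; rewrite ger0_norm// exprn_ge0.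
- by apply: sum_gen; exists f.
Qed.

Definition gauss (t : R) := expR (- (t * t)).

Lemma is_derive_gauss (t : R) : is_derive t 1 gauss (- (2 * t) * gauss t).
Proof.
have d1 : is_derive t 1 (fun t : R => - (t * t)) (- (2 * t)).
  apply: is_derive_eq (is_derive_opp (is_derive_mul (is_derive_self t) (is_derive_self t))) _.
  ring.
have := @is_derive1_comp R expR (fun t : R => - (t * t)) t _ _ (is_derive_expR _) d1.
by rewrite mulrC.
Qed.

(** From [exp y >= 1 + y] at [y = t^2 / (m + 1)] one gets
    [1 + |t| <= 2 (m + 1) exp (t^2 / (m + 1))], which is raised to the power [m + 1]. The shift from
    [m] avoids a zero denominator. *)
Lemma gauss_bound m : exists C : R, forall t : R, (1 + `|t|) ^+ m * gauss t <= C.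
Proof.
exists ((2 * m.+1%:R) ^+ m.+1) => t.
have m0 : 0 < m.+1%:R :> R by rewrite ltr0n.
have h1 : 1 + `|t| <= 2 * m.+1%:R * expR (t * t / m.+1%:R).
  have := expR_ge1Dx (t * t / m.+1%:R); rewrite -(@ler_pM2l _ m.+1%:R)// mulrDr mulrCA divff ?gt_eqF// !mulr1.
  have : 1 <= m.+1%:R :> R by rewrite ler1n.
  have : t * t = `|t| * `|t| by rewrite -normrM ger0_norm// -expr2 sqr_ge0.
  move: (expR (t * t / m.+1%:R)) m.+1%:R `|t| => E M s -> M1 ME.
  have := sqr_ge0 (s - 1); rewrite expr2; nra.
have h2 : (1 + `|t|) ^+ m <= (2 * m.+1%:R) ^+ m.+1 * expR (t * t).
  apply: (@le_trans _ _ ((1 + `|t|) ^+ m.+1)).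
    by rewrite exprS ler_peMl ?exprn_ge0 ?addr_ge0// lerDl.
  apply: (@le_trans _ _ ((2 * m.+1%:R * expR (t * t / m.+1%:R)) ^+ m.+1)).
    by rewrite lerXn2r ?nnegrE ?addr_ge0// mulr_ge0 ?expR_ge0 ?mulr_ge0.
  by rewrite exprMn -expRM_natl mulrCA divff ?gt_eqF// mulr1.
rewrite /gauss expRN ler_pdivrMr ?expR_gt0//.
Qed.

Lemma SB_gauss j : SB (fun x => 1 + `|x ord0 j|) (fun x : 'rV[R]_2 => gauss (x ord0 j)).
Proof.
pose X (h : 'rV[R]_2 -> R) := exists (c : R) n, h = fun x : 'rV[R]_2 => c * (x ord0 j ^+ n * gauss (x ord0 j)).
have dk n (t : R) : is_derive t 1 (fun t => t ^+ n * gauss t)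
    (n%:R * t ^+ n.-1 * gauss t + (- 2) * (t ^+ n.+1 * gauss t)).
  have h1 : is_derive t 1 (fun t => t ^+ n) (n%:R * t ^+ n.-1).
    have h2 := @exp_derive R n t 1.
    apply: DeriveDef; first exact: exprn_derivable.
    by rewrite h2 /GRing.scale /= mulr1 mulr_natl.
  apply: is_derive_eq (is_derive_mul h1 (is_derive_gauss t)) _.
  rewrite exprS; ring.
have dp n i := partial_comp1 i (dk n) (@total_coord R j).
apply: (@SB_coind _ _ X).
- by move=> x; rewrite addr_ge0.
- by move=> _ [c [n ->]]; apply: totalM; [exact: total_cst|exact: (dp n j).1].
- move=> _ i [c [n ->]]; rewrite partialZ; last exact: (dp n j).1.
  rewrite (dp n i).2 partial_coord.
  rewrite (_ : (fun _ => _) = fun x : 'rV[R]_2 =>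
     c * (n%:R * (i == j)%:R) * (x ord0 j ^+ n.-1 * gauss (x ord0 j)) +
     c * (-2 * (i == j)%:R) * (x ord0 j ^+ n.+1 * gauss (x ord0 j))); last first.
    by apply/funext => x; ring.
  by apply: sum_add; apply: sum_gen; eexists; eexists; reflexivity.
- move=> _ [c [n ->]] m; have [C hC] := gauss_bound (m + n).
  exists (`|c| * C) => x; rewrite normrM mulrCA ler_wpM2l//; apply: le_trans (hC (x ord0 j)).
  rewrite normrM (ger0_norm (expR_ge0 _)) mulrA ler_wpM2r ?expR_ge0// exprD.
  rewrite ler_wpM2l ?exprn_ge0 ?addr_ge0// normrX lerXn2r ?nnegrE ?addr_ge0//.
  by rewrite lerDr.
- by apply: sum_gen; exists 1, 0%N; apply/funext => x; rewrite expr0 !mul1r.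
Qed.

End Affine.

(** * Integrals over lines and over the plane *)

Section Line_integrals.
Context {R : realType}.
Implicit Types (f g : R -> R).

Local Notation mu := (@lebesgue_measure R).

Definition itg f : R := \int[mu]_(t in [set: R]) f t.

(** One explicit integrable majorant, up to a constant, gives integrability and dominated
    convergence on the line; its tensor square plays the same role for Fubini in the plane. *)
Definition decaying f := continuous f /\
  exists C : R, forall t, `|f t| <= C * (oneDsqr t)^-1.

Lemma oneDsqrV_gt0 (t : R) : 0 < (oneDsqr t)^-1.
Proof. by rewrite invr_gt0 (lt_le_trans ltr01)// oneDsqr_ge1. Qed.

Lemma integrable_oneDsqrV : mu.-integrable [set: R] (EFin \o (fun t : R => (oneDsqr t)^-1)).
Proof.
have c : continuous (fun t : R => (oneDsqr t)^-1) by exact: continuous_oneDsqrV.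
apply/integrableP; split.
  by apply/measurable_EFinP; exact: continuous_measurable_fun.
have -> : (\int[mu]_x `|(EFin \o (fun t : R => (oneDsqr t)^-1)%R) x| =
           \int[mu]_x ((oneDsqr x)^-1)%R%:E)%E.
  by apply: eq_integral => x _ /=; rewrite ger0_norm// ltW// oneDsqrV_gt0.
rewrite ge0_symfun_integralT//.
- rewrite (_ : [set x | _] = `[0, +oo[%classic); last first.
    by apply/seteqP; split => x/=; rewrite in_itv/= andbT.
  by rewrite integral0y_oneDsqr -EFinM ltry.
- by move=> x /=; rewrite /oneDsqr sqrrN.
Qed.

Lemma measurable_EFin_continuous f : continuous f -> measurable_fun [set: R] (EFin \o f).
Proof. by move=> cf; apply/measurable_EFinP; exact: continuous_measurable_fun. Qed.

Lemma decaying_integrable f : decaying f -> mu.-integrable [set: R] (EFin \o f).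
Proof.
move=> [cf [C hC]].
apply: (@le_integrable _ _ _ mu _ measurableT _ (EFin \o (fun t => C * (oneDsqr t)^-1))).
- exact: measurable_EFin_continuous.
- by move=> t _ /=; rewrite lee_fin (le_trans (hC t))// ler_norm.
- exact: (integrableZl measurableT C integrable_oneDsqrV).
Qed.

Lemma decayingD f g : decaying f -> decaying g -> decaying (fun t => f t + g t).
Proof.
move=> [cf [C hC]] [cg [D hD]]; split; first by move=> t; apply: cvgD; [exact: cf|exact: cg].
exists (C + D) => t; apply: le_trans (ler_normD _ _) _.
by rewrite mulrDl lerD.
Qed.

Lemma decayingM (k : R) f g : continuous f -> (forall t, `|f t| <= k) -> decaying g ->
  decaying (fun t => f t * g t).
Proof.
move=> cf fk [cg [D hD]]; split; first by move=> t; apply: cvgM; [exact: cf|exact: cg].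
by exists (k * D) => t; rewrite normrM -mulrA ler_pM.
Qed.

Lemma decayingZ (k : R) g : decaying g -> decaying (fun t => k * g t).
Proof. by apply: (@decayingM `|k|) => // t; exact: cvg_cst. Qed.

Lemma itgD f g : decaying f -> decaying g -> itg (fun t => f t + g t) = itg f + itg g.
Proof. by move=> df dg; apply: RintegralD => //; exact: decaying_integrable. Qed.

Lemma itgZ (k : R) f : decaying f -> itg (fun t => k * f t) = k * itg f.
Proof. by move=> df; apply: RintegralZl => //; exact: decaying_integrable. Qed.

Lemma itgN f : decaying f -> itg (fun t => - f t) = - itg f.
Proof.
by move=> df; rewrite -mulN1r -itgZ//; congr itg; apply/funext => t; rewrite mulN1r.
Qed.

Lemma itg0 : itg (fun=> 0) = 0.
Proof. by rewrite /itg /Rintegral integral0. Qed.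

Lemma itg_bound f (C : R) : decaying f -> (forall t, `|f t| <= C * (oneDsqr t)^-1) ->
  `|itg f| <= C * itg (fun t => (oneDsqr t)^-1).
Proof.
move=> df hC; have If := decaying_integrable df.
apply: le_trans (le_normr_Rintegral measurableT If) _.
rewrite /itg -RintegralZl//; last exact: integrable_oneDsqrV.
apply: le_Rintegral => //.
- exact: (integrable_norm If).
- exact: (integrableZl measurableT C integrable_oneDsqrV).
Qed.

(** Dominated convergence for truncations. It carries the fundamental theorem of calculus and the
    reflection [t -> - t] from compact intervals over to the line. *)
Lemma itg_lim f : decaying f ->
  (fun n : nat => \int[mu]_(t in `[- n%:R, n%:R]) f t) @ \oo --> itg f.
Proof.
move=> df; have If := decaying_integrable df.
have [cf [C hC]] := df.
pose fn (n : nat) : R -> R := f \_ `[- n%:R, n%:R].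
have mf : measurable_fun [set: R] f by exact: continuous_measurable_fun.
have H : (\int[mu]_x (EFin \o fn n) x)%E @[n --> \oo] --> (\int[mu]_x (EFin \o f) x)%E.
  apply: (@dominated_cvg _ _ _ mu setT measurableT (fun n => EFin \o fn n) (EFin \o f)
    (fun t => (C * (oneDsqr t)^-1)%:E)).
  - move=> n; apply/measurable_EFinP; apply/(measurable_restrictT f) => //.
    exact: measurable_funS mf.
  - move=> x _; apply: cvg_near_cst.
    apply: filterS (nbhs_infty_ger `|x : R|) => n xn; rewrite /fn /= patchE.
    rewrite ifT//; apply/mem_set; rewrite /= in_itv /=.
    by move: xn; rewrite ler_norml.
  - by [].
  - exact: (integrableZl measurableT C integrable_oneDsqrV).
  - move=> n x _ /=; rewrite lee_fin /fn patchE; case: ifPn => _; first exact: hC.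
    by rewrite normr0; apply: le_trans (hC x).
have Hf : (\int[mu]_x (EFin \o f) x)%E \is a fin_num by exact: integrable_fin_num.
have -> : (fun n : nat => \int[mu]_(t in `[- n%:R, n%:R]) f t) =
    fine \o (fun n => \int[mu]_x (EFin \o fn n) x)%E.
  by apply/funext => n; rewrite Rintegral_mkcond.
by apply: fine_cvg; rewrite fineK.
Qed.

Lemma cvg_inv_nat : (fun n : nat => (1 + n%:R)^-1 : R) @ \oo --> (0 : R).
Proof.
have -> : (fun n : nat => (1 + n%:R)^-1 : R) = harmonic; last exact: cvg_harmonic.
by apply/funext => n; rewrite /harmonic /= -natr1 addrC.
Qed.

(** The boundary terms at [n] and [- n] are together at most [2 C / (1 + n)]. Applied to a product
    [F], this is integration by parts on the line. *)
Lemma itg_derive (F : R -> R) f (C : R) : decaying f -> (forall t : R, is_derive t 1 F (f t)) ->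
  (forall t, `|F t| * (1 + `|t|) <= C) -> itg f = 0.
Proof.
move=> df dF hC; have [cf _] := df.
have cF : continuous F.
  by move=> t; apply: differentiable_continuous; apply/derivable1_diffP; case: (dF t).
suff : (fun n : nat => \int[mu]_(t in `[- n%:R, n%:R]) f t) @ \oo --> (0 : R).
  by apply: cvg_unique; [|exact: itg_lim].
apply/norm_cvg0P; apply: (@squeeze_cvgr _ _ _ _ (cst 0) (fun n : nat => 2 * C * (1 + n%:R)^-1)).
- near=> n; rewrite normr_ge0 /=.
  have n0 : 0 < n%:R :> R by rewrite ltr0n; near: n; exact: nbhs_infty_gt.
  rewrite /Rintegral (@continuous_FTC2 _ f F).
  + rewrite -EFinD /=; apply: le_trans (ler_normB _ _) _.
    have h1 := hC n%:R; have h2 := hC (- n%:R); rewrite normrN (ger0_norm (ltW n0)) in h1 h2.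
    by rewrite ler_pdivlMr ?addr_gt0// mulrDl mulr_natl mulr2n lerD.
  + by rewrite (lt_trans _ n0)// oppr_lt0.
  + exact: continuous_subspaceT.
  + split=> [x _||]; first by case: (dF x).
      by apply: cvg_at_right_filter; exact: cF.
    by apply: cvg_at_left_filter; exact: cF.
  + by move=> x _; rewrite derive1E; case: (dF x).
- exact: cvg_cst.
- rewrite -[X in _ --> X](mulr0 (2 * C)); apply: cvgM; [exact: cvg_cst|exact: cvg_inv_nat].
Unshelve. all: by end_near. Qed.

End Line_integrals.

Section Substitution.
Context {R : realType}.
Implicit Types (f g : R -> R).
Local Notation mu := (@lebesgue_measure R).

Lemma itg_opp f : decaying f -> itg (fun t => f (- t)) = itg f.
Proof.
move=> df; have [cf [C hC]] := df.
have cf' : continuous (fun t => f (- t)).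
  by move=> t; apply: (@continuous_comp _ _ _ (fun t : R => - t) f); [exact: opp_continuous|exact: cf].
have df' : decaying (fun t => f (- t)).
  by split=> //; exists C => t; apply: le_trans (hC _) _; rewrite /oneDsqr sqrrN.
suff E (n : nat) : \int[mu]_(t in `[- n%:R, n%:R]) f (- t) = \int[mu]_(t in `[- n%:R, n%:R]) f t.
  by have l1 := itg_lim df'; rewrite (funext E) in l1; exact: (cvg_unique _ l1 (itg_lim df)).
rewrite /Rintegral; congr fine.
have := @integration_by_substitution_oppr R f (- n%:R) n%:R; rewrite opprK => <-//.
- by rewrite (@le_trans _ _ 0)// oppr_le0.
- exact: continuous_subspaceT.
Qed.

(** Since [a t = (b + a t) - b], one has [a^2 t^2 <= 2 (b + a t)^2 + 2 b^2], which explains the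
    constant. *)
Lemma oneDsqr_affine (a b : R) : a != 0 ->
  exists C : R, forall t, (oneDsqr (b + a * t))^-1 <= C * (oneDsqr t)^-1.
Proof.
move=> a0; exists (2 * (1 + (b * b + 1) / (a * a))) => t.
have aa : 0 < a * a by rewrite -expr2 exprn_even_gt0.
rewrite ler_pdivlMr ?(lt_le_trans ltr01) ?oneDsqr_ge1// mulrC ler_pdivrMr ?(lt_le_trans ltr01) ?oneDsqr_ge1//.
rewrite -(@ler_pM2l _ (a * a))// /oneDsqr.
have -> : a * a * (2 * (1 + (b * b + 1) / (a * a)) * (1 + (b + a * t) ^+ 2)) =
   2 * (a * a + (b * b + 1)) * (1 + (b + a * t) ^+ 2).
  by field.
have h1 := sqr_ge0 (2 * b + a * t); have h2 := sqr_ge0 (b + a * t).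
have h3 : 0 <= (a * a + b * b) * (b + a * t) ^+ 2.
  by apply: mulr_ge0 => //; rewrite -!expr2 addr_ge0// sqr_ge0.
rewrite !expr2 in h1 h2 h3 *; lra.
Qed.

Lemma decaying_affine f (a b : R) : a != 0 -> decaying f -> decaying (fun t => f (b + a * t)).
Proof.
move=> a0 [cf [C hC]]; split.
  move=> t; apply: (@continuous_comp _ _ _ (fun t : R => b + a * t) f); last exact: cf.
  by apply: cvgD; [exact: cvg_cst|apply: cvgM; [exact: cvg_cst|exact: cvg_id]].
have C0 : 0 <= C.
  have := le_trans (normr_ge0 _) (hC 0); rewrite pmulr_lge0// oneDsqrV_gt0//.
have [D hD] := oneDsqr_affine b a0; exists (C * D) => t.
by apply: le_trans (hC _) _; rewrite -mulrA ler_wpM2l.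
Qed.

Lemma decaying_norm f : decaying f -> decaying (fun t => `|f t|).
Proof.
move=> [cf [C hC]]; split; last by exists C => t; rewrite normr_id.
by move=> t; apply: cvg_norm; exact: cf.
Qed.

Let itg_affine_pos f (a b : R) : 0 < a -> decaying f -> (forall t, 0 <= f t) ->
  itg f = a * itg (fun t => f (b + a * t)).
Proof.
move=> a0 df f0; have [cf _] := df.
pose F t := b + a * t.
have dF (t : R) : is_derive t 1 F a.
  apply: is_derive_eq (is_derive_add (is_derive_const b t) (is_derive_mul (is_derive_const a t) (is_derive_self t))) _.
  by rewrite mul0r !add0r mulr1.
have F'E : (F^`())%classic = cst a by apply/funext => t; rewrite derive1E; case: (dF t).
rewrite -itgZ; last by apply: decaying_affine; rewrite ?gt_eqF.
rewrite /itg /Rintegral (@increasing_ge0_integration_by_substitutionT _ F f).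
- by congr fine; apply: eq_integral => t _; rewrite F'E /= mulrC.
- by move=> x y xy; rewrite /F ltrD2l ltr_pM2l.
- by rewrite F'E; exact: cst_continuous.
- by rewrite F'E; exact: is_cvg_cst.
- by rewrite F'E; exact: is_cvg_cst.
- by move=> x; case: (dF x).
- apply/cvgrNyPle => A; by near=> x; rewrite /F -lerBrDl mulrC -ler_pdivlMr.
- apply/cvgryPge => A; by near=> x; rewrite /F -lerBlDl mulrC -ler_pdivrMr.
- exact: cf.
- exact: f0.
Unshelve. all: by end_near. Qed.

Lemma itg_affine f (a b : R) : a != 0 -> decaying f ->
  itg f = `|a| * itg (fun t => f (b + a * t)).
Proof.
have pos g (c : R) : 0 < c -> decaying g -> itg g = c * itg (fun t => g (b + c * t)).
  move=> c0 dg; have dn := decaying_norm dg.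
  have da (h : R -> R) : decaying h -> decaying (fun t => h (b + c * t)).
    by apply: decaying_affine; rewrite gt_eqF.
  (* [h = (h + |h|) - |h|] is a difference of nonnegative decaying functions, to which the
     increasing substitution applies. *)
  have E (h : R -> R) : decaying h -> itg h = itg (fun t => h t + `|h t|) - itg (fun t => `|h t|).
    by move=> dh; rewrite itgD ?addrK//; exact: decaying_norm.
  rewrite (E g)// (E (fun t => g (b + c * t))); last exact: da.
  rewrite (@itg_affine_pos _ c b c0 dn)//.
  rewrite (@itg_affine_pos (fun t => g t + `|g t|) c b c0); [|exact: decayingD|].
    by rewrite mulrBr.
  by move=> t; rewrite addrC -lerBlDr sub0r -normrN ler_norm.
move=> a0 df; have [ap|] := ltP 0 a; first by rewrite gtr0_norm//; exact: pos.
rewrite le_eqVlt (negbTE a0) /= => an; rewrite ltr0_norm//.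
rewrite (pos f (- a)) ?oppr_gt0//; congr (_ * _).
rewrite -itg_opp; last by apply: decaying_affine; rewrite // oppr_eq0.
by congr itg; apply/funext => t; rewrite mulrNN.
Qed.

End Substitution.

(** * Fubini's theorem in the plane *)

Section Fubini_plane.
Context {R : realType}.
Implicit Types (f : 'rV[R]_2 -> R).
Local Notation mu := (@lebesgue_measure R).

Lemma near_vec f (x y e : R) : {for vec x y, continuous f} -> 0 < e ->
  exists2 d : R, 0 < d & forall x' y', `|x' - x| < d -> `|y' - y| < d ->
    `|f (vec x' y') - f (vec x y)| < e.
Proof.
move=> cf e0; have /cvgrPdist_lt /(_ e e0) /nbhs_ballP[d /= d0 hd] := cf.
exists d => // x' y' hx hy; rewrite distrC; apply: hd.
rewrite -ball_normE /=.
apply: (@le_lt_trans _ _ (Num.max `|x - x'| `|y - y'|)); last first.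
  by rewrite gt_max distrC hx distrC hy.
rewrite [leLHS]/Num.Def.normr /= mx_normrE; apply/bigmax_leP; split=> [|[i j] _ /=].
  by rewrite le_max normr_ge0.
by rewrite !mxE le_max; case: ifP => _; rewrite lexx ?orbT.
Qed.

(** The set where [f > a] is a countable union of boxes with rational centres and half-sides
    [1 / (n + 1)], hence measurable for the product structure on pairs. *)
Lemma measurable_continuous2 f : continuous f ->
  measurable_fun [set: R * R] (fun z => f (vec z.1 z.2)).
Proof.
move=> cf; apply: (measurability _ (RGenOInfty.measurableE R)).
move=> _ [_ [a ->] <-]; rewrite setTI.
set U := (X in measurable X).
pose e (n : nat) : R := n.+1%:R^-1.
pose B (n : nat) (q1 q2 : rat) : set (R * R) :=
  `]ratr q1 - e n, ratr q1 + e n[ `*` `]ratr q2 - e n, ratr q2 + e n[.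
have -> : U = \bigcup_n \bigcup_q1 \bigcup_q2 (if `[< B n q1 q2 `<=` U >] then B n q1 q2 else set0).
  apply/seteqP; split=> [[x y] Uxy|z [n _ [q1 _ [q2 _]]]]; last first.
    by case: asboolP => // BU /BU.
  have a0 : 0 < f (vec x y) - a.
    by rewrite subr_gt0; move: Uxy; rewrite /U /= in_itv /= andbT.
  have [d d0 hd] := near_vec (cf (vec x y)) a0.
  (* Twice the half-side, since a point of the box and [(x, y)] may lie on opposite sides of the
     centre. *)
  have [n hn] : exists n, 2 * e n < d.
    have /ltr_add_invr[n] : 0 < d / 2 by rewrite divr_gt0.
    by rewrite add0r ltr_pdivlMr// mulrC => hn; exists n.
  have e0 : 0 < e n by rewrite invr_gt0 ltr0n.
  have rat_near (t : R) : exists q : rat, `|ratr q - t| < e n.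
    have /rat_in_itvoo[q] : t - e n < t + e n by rewrite ltrD2l gtrN.
    by rewrite in_itv /= => /andP[q1 q2]; exists q; rewrite ltr_distl q1.
  have [q1 hq1] := rat_near x; have [q2 hq2] := rat_near y.
  exists n => //; exists q1 => //; exists q2 => //.
  have BU : B n q1 q2 `<=` U.
    move=> [x' y'] [/=]; rewrite !in_itv /= -!ltr_distl => h1 h2.
    rewrite /U /= in_itv /= andbT.
    have : `|f (vec x' y') - f (vec x y)| < f (vec x y) - a.
      apply: hd.
        rewrite -(subrKA (ratr q1)); apply: le_lt_trans (ler_normD _ _) _.
        by apply: lt_trans hn; rewrite mulr_natl mulr2n ltrD.
      rewrite -(subrKA (ratr q2)); apply: le_lt_trans (ler_normD _ _) _.
      by apply: lt_trans hn; rewrite mulr_natl mulr2n ltrD.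
    by rewrite ltr_distl => /andP[+ _]; rewrite opprB addrCA subrr addr0.
  rewrite asboolT//.
  by split; rewrite /= in_itv /= -ltr_distl distrC.
apply: bigcup_measurable => n _; apply: bigcupT_measurable_rat => q1.
apply: bigcupT_measurable_rat => q2; case: asboolP => // _.
by apply: measurableX; exact: measurable_itv.
Qed.

Definition plane_bound f := exists C : R,
  forall x y, `|f (vec x y)| <= C * ((oneDsqr x)^-1 * (oneDsqr y)^-1).

Lemma continuous_slice1 f (y : R) : continuous f -> continuous (fun x => f (vec x y)).
Proof.
move=> cf x; apply/cvgrPdist_lt => e e0.
have [d d0 hd] := near_vec (cf (vec x y)) e0.
apply/nbhs_ballP; exists d => //= x' xx'; rewrite distrC; apply: hd.
  by rewrite distrC.
by rewrite subrr normr0.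
Qed.

Lemma continuous_slice2 f (x : R) : continuous f -> continuous (fun y => f (vec x y)).
Proof.
move=> cf y; apply/cvgrPdist_lt => e e0.
have [d d0 hd] := near_vec (cf (vec x y)) e0.
apply/nbhs_ballP; exists d => //= y' yy'; rewrite distrC; apply: hd.
  by rewrite subrr normr0.
by rewrite distrC.
Qed.

Lemma decaying_slice1 f y : continuous f -> plane_bound f -> decaying (fun x => f (vec x y)).
Proof.
move=> cf [C hC]; split; first exact: continuous_slice1.
by exists (C * (oneDsqr y)^-1) => x; rewrite -mulrA [X in _ * X]mulrC.
Qed.

Lemma decaying_slice2 f x : continuous f -> plane_bound f -> decaying (fun y => f (vec x y)).
Proof.
move=> cf [C hC]; split; first exact: continuous_slice2.
by exists (C * (oneDsqr x)^-1) => y; rewrite -mulrA.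
Qed.

Lemma integrable_plane f : continuous f -> plane_bound f ->
  (mu \x mu)%E.-integrable setT (EFin \o (fun z => f (vec z.1 z.2))).
Proof.
move=> cf [C hC].
pose u (t : R) := (oneDsqr t)^-1.
have cu : continuous u by exact: continuous_oneDsqrV.
have u0 t : 0 <= u t by exact/ltW/oneDsqrV_gt0.
have mu1 : measurable_fun [set: R * R] (fun z => u z.1).
  apply: measurableT_comp; first exact: continuous_measurable_fun.
  exact: measurable_fst.
have mu2 : measurable_fun [set: R * R] (fun z => u z.2).
  apply: measurableT_comp; first exact: continuous_measurable_fun.
  exact: measurable_snd.
apply: (@le_integrable _ _ _ (mu \x mu)%E setT measurableT _ (EFin \o (fun z => `|C| * (u z.1 * u z.2)))).
- by apply/measurable_EFinP; exact: measurable_continuous2.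
- move=> [x y] _ /=; rewrite lee_fin; apply: le_trans (hC x y) _.
  rewrite normrM normr_id (ger0_norm (mulr_ge0 _ _))//.
  by rewrite ler_wpM2r ?mulr_ge0// ler_norm.
- apply/integrable12ltyP.
    by apply/measurable_EFinP; apply: measurable_funM => //; exact: measurable_funM.
  have du c : decaying (fun t => c * u t).
    by split; [move=> t; apply: cvgM; [exact: cvg_cst|exact: cu]|exists `|c| => t; rewrite normrM (ger0_norm (u0 t))].
  have E x : (\int[mu]_y `|(EFin \o (fun z : R * R => (`|C| * (u z.1 * u z.2))%R)) (x, y)| =
      (`|C| * itg u * u x)%R%:E)%E.
    have -> : (`|C| * itg u * u x)%R = itg (fun y => `|C| * u x * u y).
      rewrite itgZ; last by have := du 1; under eq_fun do rewrite mul1r.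
      by rewrite -!mulrA [u x * _]mulrC.
    rewrite /itg /Rintegral fineK; last by apply: integrable_fin_num => //; exact: decaying_integrable.
    by apply: eq_integral => y _ /=; rewrite ger0_norm ?mulr_ge0// mulrA.
  have := integrable_fin_num measurableT (decaying_integrable (du (`|C| * itg u))).
  rewrite fin_numElt => /andP[_]; apply: le_lt_trans; rewrite le_eqVlt; apply/orP; left; apply/eqP.
  by apply: eq_integral => x _; exact: E.
Qed.

Lemma itg_swap f : continuous f -> plane_bound f ->
  itg (fun x => itg (fun y => f (vec x y))) = itg (fun y => itg (fun x => f (vec x y))).
Proof.
move=> cf hC; have := Fubini (integrable_plane cf hC); rewrite /itg /Rintegral => E.
congr fine; apply: etrans (etrans E _).
  apply: eq_integral => x _ /=; rewrite fineK//; apply: integrable_fin_num => //.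
  exact/decaying_integrable/decaying_slice2.
apply: eq_integral => y _ /=; rewrite fineK//; apply: integrable_fin_num => //.
exact/decaying_integrable/decaying_slice1.
Qed.

End Fubini_plane.

(** * Differentiation under the integral sign *)

Section Differentiation_under_integral.
Context {R : realType} d (T : measurableType d) (mu : {measure set T -> \bar R}).
Context (D : set T) (Phi : T -> 'rV[R]_2 -> R) (g : T -> R).
Context (mD : measurable D).
Context (PhiD : forall t, D t -> total (Phi t)).
Context (lip : forall t i x h, D t ->
  `|partial i (Phi t) (h + x) - partial i (Phi t) x| <= g t * `|h|).
Context (Ig : mu.-integrable D (EFin \o g)).
Context (IPhi : forall x, mu.-integrable D (EFin \o Phi^~ x)).
Context (IdPhi : forall x i, mu.-integrable D (EFin \o (fun t => partial i (Phi t) x))).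

Let F x := \int[mu]_(t in D) Phi t x.

(** By the mean value theorem, the Lipschitz bound makes the first-order remainder of [Phi t] at
    most [2 g(t) |h|^2]. Integration over [D] gives the quadratic criterion for [F]. *)
Lemma differentiation_under_integral2 : total F /\
  forall i, partial i F = fun x => \int[mu]_(t in D) partial i (Phi t) x.
Proof.
suff H x : differentiable F x /\
    forall i, partial i F x = \int[mu]_(t in D) partial i (Phi t) x.
  by split=> [x|i]; [exact: (H x).1|apply/funext => x; exact: (H x).2].
apply: (@differentiable_quadratic _ F x _ (\int[mu]_(t in D) (2 * g t))).
move=> h.
pose rem t := Phi t (h + x) - Phi t x -
  (h ord0 ord0 * partial ord0 (Phi t) x + h ord0 ord_max * partial ord_max (Phi t) x).
have remE t : D t -> `|rem t| <= `|h| ^+ 2 * (2 * g t).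
  move=> Dt; rewrite /rem; have [c] := mean_value x h (PhiD Dt).
  rewrite in_itv /= => /andP[c0 c1] ->.
  have g0 : 0 <= g t * `|h| by apply: le_trans (lip ord0 x h Dt).
  have b i : `|h ord0 i * (partial i (Phi t) (c *: h + x) - partial i (Phi t) x)|
      <= `|h| * (g t * `|h|).
    rewrite normrM ler_pM ?le_coord_norm//; apply: le_trans (lip i x (c *: h) Dt) _.
    by rewrite normrZ (ger0_norm c0) mulrCA ler_piMl.
  rewrite opprD addrACA -!mulrBr; apply: le_trans (ler_normD _ _) _.
  apply: le_trans (lerD (b ord0) (b ord_max)) _.
  by rewrite le_eqVlt; apply/orP; left; apply/eqP; ring.
have Idx i : mu.-integrable D (EFin \o (fun t => h ord0 i * partial i (Phi t) x)).
  exact: (integrableZl mD (h ord0 i) (IdPhi x i)).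
have Idd : mu.-integrable D (EFin \o (fun t => h ord0 ord0 * partial ord0 (Phi t) x +
    h ord0 ord_max * partial ord_max (Phi t) x)) by exact: (integrableD mD (Idx _) (Idx _)).
have IB : mu.-integrable D (EFin \o (fun t => Phi t (h + x) - Phi t x)).
  exact: (integrableB mD (IPhi _) (IPhi _)).
have Irem : mu.-integrable D (EFin \o rem) by exact: (integrableB mD IB Idd).
have -> : F (h + x) - F x - (h ord0 ord0 * \int[mu]_(t in D) partial ord0 (Phi t) x +
    h ord0 ord_max * \int[mu]_(t in D) partial ord_max (Phi t) x) = \int[mu]_(t in D) rem t.
  rewrite /rem RintegralB// RintegralB; [|exact: mD|exact: IPhi|exact: IPhi].
  rewrite RintegralD; [|exact: mD|exact: Idx|exact: Idx].
  by rewrite !RintegralZl//; exact: IdPhi.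
have I2g : mu.-integrable D (EFin \o (fun t => 2 * g t)) by exact: (integrableZl mD 2 Ig).
apply: le_trans (le_normr_Rintegral mD Irem) _.
rewrite mulrC -RintegralZl//; apply: le_Rintegral => //.
- exact: (integrable_norm Irem).
- exact: (integrableZl mD (`|h| ^+ 2) I2g).
Qed.

End Differentiation_under_integral.

(** * Partial Fourier transform on the cylinder *)

Section Partial_Fourier.
Context {R : realType}.
Implicit Types (u : 'rV[R]_2 -> R) (x : 'rV[R]_2) (c b : bool).

Local Notation mu := (@lebesgue_measure R).

(* [weight false] is the weight of the Schwartz space on the cylinder, where
   only the first variable goes to infinity; [weight true] the one of
   the Schwartz space on the plane. *)
Definition fiber_weight b (t : R) : R := if b then 1 + `|t| else 1.

Definition weight b x : R := (1 + `|x ord0 ord0|) * fiber_weight b (x ord0 ord_max).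

Lemma fiber_weight_ge1 b t : 1 <= fiber_weight b t.
Proof. by case: b; rewrite /fiber_weight ?lerDl. Qed.

Lemma fiber_weight_ge0 b t : 0 <= fiber_weight b t.
Proof. exact: le_trans (fiber_weight_ge1 b t). Qed.

Lemma weight_ge1 b x : 1 <= weight b x.
Proof.
by rewrite -[leLHS]mulr1; apply: ler_pM; rewrite ?lerDl ?fiber_weight_ge1.
Qed.

Lemma weight_ge0 b x : 0 <= weight b x.
Proof. exact: le_trans (weight_ge1 b x). Qed.

Lemma coord1_weight b x : `|x ord0 ord0| <= weight b x.
Proof.
rewrite -[leLHS]mulr1; apply: ler_pM => //; last exact: fiber_weight_ge1.
by rewrite lerDr.
Qed.

Lemma oneDsqr_weight b (p t : R) : oneDsqr p <= weight b (vec p t) ^+ 2.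
Proof.
apply: (@le_trans _ _ ((1 + `|p|) ^+ 2)); last first.
  rewrite lerXn2r ?nnegrE ?addr_ge0 ?weight_ge0// /weight !mxE /=.
  by rewrite ler_peMr ?addr_ge0// fiber_weight_ge1.
by rewrite /oneDsqr sqrrD expr1n mul1r real_normK ?num_real// lerD2r lerDl mulrn_wge0.
Qed.

Lemma SB_continuous w u : SB w u -> continuous u.
Proof. by move=> Su x; apply: differentiable_continuous; exact: SB_total Su x. Qed.

Lemma SB_fiber_bound b u n : SB (weight b) u ->
  exists C : R, forall p t, fiber_weight b t ^+ n * `|u (vec p t)| <= C * (oneDsqr p)^-1.
Proof.
move=> Su; have [C hC] := SB_bounded Su (n + 2)%N; exists C => p t.
rewrite ler_pdivlMr ?(lt_le_trans ltr01) ?oneDsqr_ge1//.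
apply: le_trans (hC (vec p t)); rewrite exprD mulrAC.
rewrite ler_wpM2r//; apply: ler_pM; last exact: oneDsqr_weight.
- by rewrite exprn_ge0 ?fiber_weight_ge0.
- by rewrite (le_trans ler01)// oneDsqr_ge1.
- rewrite lerXn2r ?nnegrE ?weight_ge0 ?fiber_weight_ge0// /weight !mxE /=.
  by rewrite ler_peMl ?fiber_weight_ge0// lerDl.
Qed.

Lemma SB_decaying b u t : SB (weight b) u -> decaying (fun p => u (vec p t)).
Proof.
move=> Su; split; first exact: continuous_slice1 (SB_continuous Su).
have [C hC] := SB_fiber_bound 0 Su; exists C => p.
by have := hC p t; rewrite expr0 mul1r.
Qed.

Definition kernel_term c u (p : R) x : R := u (vec p (x ord0 ord_max)) * trig c (p * x ord0 ord0).

(** Unnormalised cosine ([c = true]) or sine transform in the first variable; the second variable is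
    a parameter. *)
Definition fourier c u x : R := itg (fun p => kernel_term c u p x).

Definition mul1 u : 'rV[R]_2 -> R := fun x => x ord0 ord0 * u x.

Lemma SB_mul_coord1 b u : SB (weight b) u -> SB (weight b) (mul1 u).
Proof. by apply: SB_coord => x; exact: coord1_weight. Qed.

Lemma partial_kernel_term c u p : total u ->
  [/\ total (kernel_term c u p),
      partial ord0 (kernel_term c u p) = (fun x => dtrig c * kernel_term (~~ c) (mul1 u) p x) &
      partial ord_max (kernel_term c u p) = kernel_term c (partial ord_max u) p].
Proof.
move=> du.
have hp i := partial_comp_vec i (total_cst p) (@total_coord R ord_max) du.
have hs : total (fun x : 'rV[R]_2 => p * x ord0 ord0).
  by apply: totalM; [exact: total_cst|exact: total_coord].
have ht i := partial_comp1 i (fun t : R => is_derive_trig c t) hs.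
have d1 := (hp ord0).1; have d2 := (ht ord0).1.
rewrite /kernel_term; split; first exact: totalM.
  rewrite partialM// (hp ord0).2 (ht ord0).2 partial_cst partial_coord partialZ; last exact: total_coord.
  by rewrite partial_coord; apply/funext => x; rewrite /mul1 mxE /=; ring.
rewrite partialM// (hp ord_max).2 (ht ord_max).2 partial_cst partial_coord partialZ; last exact: total_coord.
by rewrite partial_coord; apply/funext => x /=; ring.
Qed.

Lemma kernel_term_bound b c u : SB (weight b) u ->
  exists C : R, forall p x, `|kernel_term c u p x| <= C * (oneDsqr p)^-1.
Proof.
move=> Su; have [C hC] := SB_fiber_bound 0 Su; exists C => p x.
apply: le_trans (hC p (x ord0 ord_max)); rewrite expr0 mul1r normrM ler_piMr//.
exact: norm_trig.
Qed.

Lemma continuous_trig c : continuous (@trig R c).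
Proof.
move=> t; apply: differentiable_continuous; apply/derivable1_diffP.
by case: (is_derive_trig c t).
Qed.

Lemma decaying_kernel_term b c u x : SB (weight b) u -> decaying (fun p => kernel_term c u p x).
Proof.
move=> Su; have [C hC] := kernel_term_bound c Su; split; last by exists C.
have cu := @continuous_slice1 _ _ (x ord0 ord_max) (SB_continuous Su).
move=> p; apply: cvgM; first exact: cu.
apply: (@continuous_comp _ _ _ (fun p : R => p * x ord0 ord0) (trig c)); last exact: continuous_trig.
by apply: cvgM; [exact: cvg_id|exact: cvg_cst].
Qed.

Lemma kernel_term_partial2 b c u i j : SB (weight b) u ->
  exists C : R, forall p x, `|partial j (partial i (kernel_term c u p)) x| <= C * (oneDsqr p)^-1.
Proof.
move=> Su; have S0 := SB_mul_coord1 Su; have S1 := SB_partial ord_max Su.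
have K v d k : SB (weight b) v -> exists C : R, forall p x,
    `|partial k (kernel_term d v p) x| <= C * (oneDsqr p)^-1.
  move=> Sv; case: (ord2P k) => ->.
    have [C hC] := kernel_term_bound (~~ d) (SB_mul_coord1 Sv); exists C => p x.
    have [_ -> _] := partial_kernel_term d p (SB_total Sv).
    by rewrite normrM norm_dtrig mul1r.
  have [C hC] := kernel_term_bound d (SB_partial ord_max Sv); exists C => p x.
  by have [_ _ ->] := partial_kernel_term d p (SB_total Sv).
case: (ord2P i) => ->.
  have [C hC] := K _ (~~ c) j S0; exists C => p x.
  have [_ -> _] := partial_kernel_term c p (SB_total Su).
  rewrite partialZ ?normrM ?norm_dtrig ?mul1r//.
  by have [] := partial_kernel_term (~~ c) p (SB_total S0).
have [C hC] := K _ c j S1; exists C => p x.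
by have [_ _ ->] := partial_kernel_term c p (SB_total Su).
Qed.

(** The second derivatives of the integrand are [O(1 / (1 + p^2))] uniformly in [x], so its first
    derivatives are Lipschitz with an integrable constant. *)
Lemma fourier_partial b c u : SB (weight b) u ->
  [/\ total (fourier c u),
      partial ord0 (fourier c u) = (fun x => dtrig c * fourier (~~ c) (mul1 u) x) &
      partial ord_max (fourier c u) = fourier c (partial ord_max u)].
Proof.
move=> Su; have du := SB_total Su.
have [C00 h00] := kernel_term_partial2 c ord0 ord0 Su.
have [C01 h01] := kernel_term_partial2 c ord0 ord_max Su.
have [C10 h10] := kernel_term_partial2 c ord_max ord0 Su.
have [C11 h11] := kernel_term_partial2 c ord_max ord_max Su.
pose C := `|C00| + `|C01| + `|C10| + `|C11|.
have hC p i j x : `|partial j (partial i (kernel_term c u p)) x| <= C * (oneDsqr p)^-1.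
  have aux (D : R) : D <= C -> D * (oneDsqr p)^-1 <= C * (oneDsqr p)^-1.
    by move=> DC; rewrite ler_wpM2r// ltW// oneDsqrV_gt0.
  have := (normr_ge0 C00, normr_ge0 C01, normr_ge0 C10, normr_ge0 C11).
  have := (ler_norm C00, ler_norm C01, ler_norm C10, ler_norm C11).
  move=> [[[l1 l2] l3] l4] [[[p1 p2] p3] p4].
  case: (ord2P i) (ord2P j) => -> [] ->;
    [apply: le_trans (h00 p x) _|apply: le_trans (h01 p x) _
    |apply: le_trans (h10 p x) _|apply: le_trans (h11 p x) _]; apply: aux; rewrite /C; lra.
have dI p i : total (partial i (kernel_term c u p)).
  case: (ord2P i) => ->; have [_ E0 E1] := partial_kernel_term c p du.
    rewrite E0; apply: totalM; first exact: total_cst.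
    by have [] := partial_kernel_term (~~ c) p (SB_total (SB_mul_coord1 Su)).
  by rewrite E1; have [] := partial_kernel_term c p (SB_total (SB_partial ord_max Su)).
have [|||||tF pF] := @differentiation_under_integral2 R _ _ mu setT (kernel_term c u)
   (fun p => 2 * (C * (oneDsqr p)^-1)) measurableT.
- by move=> p _; have [] := partial_kernel_term c p du.
- by move=> p i x h _; apply: lipschitz_partial (dI p i) (fun j y => hC p i j y).
- have := integrableZl measurableT (2 * C) (@integrable_oneDsqrV R).
  by congr (_.-integrable _ _); apply/funext => t /=; rewrite -EFinM mulrA.
- by move=> x; exact: decaying_integrable (decaying_kernel_term c x Su).
- move=> x i; case: (ord2P i) => ->.
    have D0 := decayingZ (dtrig c) (decaying_kernel_term (~~ c) x (SB_mul_coord1 Su)).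
    have := decaying_integrable D0; congr (_.-integrable _ _); apply/funext => p /=.
    by have [_ -> _] := partial_kernel_term c p du.
  have := decaying_integrable (decaying_kernel_term c x (SB_partial ord_max Su)).
  congr (_.-integrable _ _); apply/funext => p /=.
  by have [_ _ ->] := partial_kernel_term c p du.
- split=> //.
    apply: etrans (pF ord0) _; apply/funext => x.
    rewrite /fourier -itgZ; last exact: decaying_kernel_term (SB_mul_coord1 Su).
    congr itg; apply/funext => p; by have [_ -> _] := partial_kernel_term c p du.
  apply: etrans (pF ord_max) _; apply/funext => x; congr itg; apply/funext => p.
  by have [_ _ ->] := partial_kernel_term c p du.
Qed.

(** Integration by parts: the derivative in p of [u(p, t)] times the other trigonometric function of
    [p s] has integral zero. *)
Lemma fourier_mul_coord1 b c u x : SB (weight b) u ->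
  x ord0 ord0 * fourier c u x = dtrig c * fourier (~~ c) (partial ord0 u) x.
Proof.
move=> Su; have Sp := SB_partial ord0 Su.
have [C hC] := SB_bounded Su 1.
have E : itg (fun p => partial ord0 u (vec p (x ord0 ord_max)) * trig (~~ c) (p * x ord0 ord0) +
     u (vec p (x ord0 ord_max)) * (x ord0 ord0 * (dtrig (~~ c) * trig c (p * x ord0 ord0)))) = 0.
  apply: (@itg_derive _ (fun p => u (vec p (x ord0 ord_max)) * trig (~~ c) (p * x ord0 ord0)) _ C).
  - apply: decayingD; first exact: (decaying_kernel_term (~~ c) x Sp).
    have := decayingZ (x ord0 ord0 * dtrig (~~ c)) (decaying_kernel_term c x Su).
    by congr decaying; apply/funext => p; rewrite /kernel_term; ring.
  - move=> p; have h1 := is_derive_comp_vec (is_derive_self p) (is_derive_const (x ord0 ord_max) p)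
      (SB_total Su (vec p (x ord0 ord_max))).
    have h2 := @is_derive1_comp R (trig (~~ c)) (fun p => 0 + p * x ord0 ord0) p _ _
      (is_derive_trig _ _) (is_derive_line 0 (x ord0 ord0) p).
    have E : trig (~~ c) \o (fun p => 0 + p * x ord0 ord0) = fun p => trig (~~ c) (p * x ord0 ord0).
      by apply/funext => t; rewrite /= add0r.
    rewrite E in h2; apply: is_derive_eq (is_derive_mul h1 h2) _.
    by rewrite negbK add0r mul0r addr0 mul1r; ring.
  - move=> p; apply: le_trans (hC (vec p (x ord0 ord_max))).
    rewrite expr1 mulrC; apply: ler_pM; rewrite ?addr_ge0//.
      by rewrite /weight !mxE /= ler_peMr ?addr_ge0// fiber_weight_ge1.
    by rewrite normrM ler_piMr// norm_trig.
have D2 : decaying (fun p => u (vec p (x ord0 ord_max)) * (x ord0 ord0 * (dtrig (~~ c) * trig c (p * x ord0 ord0)))).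
  have := decayingZ (x ord0 ord0 * dtrig (~~ c)) (decaying_kernel_term c x Su).
  by congr decaying; apply/funext => p; rewrite /kernel_term; ring.
rewrite itgD// in E; last exact: (decaying_kernel_term (~~ c) x Sp).
have E2 : itg (fun p => u (vec p (x ord0 ord_max)) * (x ord0 ord0 * (dtrig (~~ c) * trig c (p * x ord0 ord0)))) =
    x ord0 ord0 * dtrig (~~ c) * fourier c u x.
  rewrite /fourier -itgZ; last exact: decaying_kernel_term Su.
  by congr itg; apply/funext => p; rewrite /kernel_term; ring.
rewrite E2 -/(fourier (~~ c) (partial ord0 u) x) in E.
have -> : fourier (~~ c) (partial ord0 u) x = - (x ord0 ord0 * dtrig (~~ c) * fourier c u x).
  by apply/eqP; rewrite -addr_eq0; apply/eqP.
by case: c {E E2 D2}; rewrite /dtrig /=; ring.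
Qed.

(** Transforms of functions of the space are stable under differentiation, so only their decay is at
    stake: a power of [s] becomes a derivative of [u], and the fibre weight, which does not depend
    on p, is absorbed by the decay of [u]. *)
Lemma SB_fourier b c u : SB (weight b) u -> SB (weight b) (fourier c u).
Proof.
move=> Su.
pose X (h : 'rV[R]_2 -> R) := exists d v, SB (weight b) v /\ h = fourier d v.
have Z (e : R) d v : SB (weight b) v -> (fun x => e * fourier d v x) = fourier d (fun x => e * v x).
  move=> Sv; apply/funext => x; rewrite /fourier -itgZ; last exact: decaying_kernel_term Sv.
  by congr itg; apply/funext => p; rewrite /kernel_term mulrA.
apply: (@SB_coind _ _ X).
- exact: weight_ge0.
- by move=> _ [d [v [Sv ->]]]; have [] := fourier_partial d Sv.
- move=> _ i [d [v [Sv ->]]]; apply: sum_gen; have [_ E0 E1] := fourier_partial d Sv.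
  case: (ord2P i) => ->; last by exists d, (partial ord_max v); split=> //; exact: SB_partial.
  exists (~~ d), (fun x => dtrig d * mul1 v x); split.
    by apply: SBZ; [exact: weight_ge0|exact: SB_mul_coord1].
  by rewrite E0 Z//; exact: SB_mul_coord1.
(* Two exponents, because the induction on [m] trades powers of [s] for derivatives of [v] while [n]
   stays fixed. *)
- suff H m n d v : SB (weight b) v -> exists C : R, forall x,
      (1 + `|x ord0 ord0|) ^+ m * (fiber_weight b (x ord0 ord_max) ^+ n * `|fourier d v x|) <= C.
    move=> _ [d [v [Sv ->]]] m; have [C hC] := H m m d v Sv; exists C => x.
    by apply: le_trans (hC x); rewrite /weight exprMn mulrA.
  elim: m d v => [|m IH] d v Sv.
    have [C hC] := SB_fiber_bound n Sv.
    exists (C * itg (fun p => (oneDsqr p)^-1)) => x; rewrite expr0 mul1r.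
    set k := fiber_weight _ _ ^+ n.
    have k0 : 0 <= k by rewrite exprn_ge0// fiber_weight_ge0.
    have Dv := decaying_kernel_term d x Sv.
    have -> : k * `|fourier d v x| = `|itg (fun p => k * kernel_term d v p x)|.
      by rewrite itgZ// normrM (ger0_norm k0).
    apply: itg_bound; first exact: decayingZ.
    move=> p; apply: le_trans (hC p (x ord0 ord_max)); rewrite normrM (ger0_norm k0).
    by rewrite ler_wpM2l// normrM ler_piMr// norm_trig.
  have [C hC] := IH d v Sv; have [D hD] := IH (~~ d) _ (SB_partial ord0 Sv).
  exists (C + D) => x; apply: le_trans (lerD (hC x) (hD x)).
  rewrite -!mulrDr exprSr -mulrA ler_wpM2l ?exprn_ge0 ?addr_ge0//.
  rewrite mulrCA ler_wpM2l ?exprn_ge0 ?fiber_weight_ge0// mulrDl mul1r lerD2l.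
  by rewrite -normrM (fourier_mul_coord1 _ _ Sv) normrM norm_dtrig mul1r.
- by apply: sum_gen; exists c, u.
Qed.

End Partial_Fourier.

(** * Homogeneous jets and the Euler reduction *)

Section Hadamard.
Context {R : realType}.
Implicit Types (F G H : 'rV[R]_2 -> R) (x : 'rV[R]_2).

Local Notation mu := (@lebesgue_measure R).
Local Notation one := (fun=> 1 : R).

Definition dilate F (u : R) x : R := F (vec (u * x ord0 ord0) (x ord0 ord_max)).

(** Hadamard's average over dilations. The chain rule produces a factor [u], so a radial derivative
    raises [n] by one. *)
Definition radial_mean n F x : R := \int[mu]_(u in `[0, 1]) (u ^+ n * dilate F u x).

Lemma partial_dilate F u : total F ->
  [/\ total (dilate F u),
      partial ord0 (dilate F u) = (fun x => u * dilate (partial ord0 F) u x) &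
      partial ord_max (dilate F u) = dilate (partial ord_max F) u].
Proof.
move=> dF.
have hs : total (fun x : 'rV[R]_2 => u * x ord0 ord0).
  by apply: totalM; [exact: total_cst|exact: total_coord].
have hp i := partial_comp_vec i hs (@total_coord R ord_max) dF.
split; first exact: (hp ord0).1.
  rewrite (hp ord0).2 partialZ ?partial_coord; last exact: total_coord.
  by apply/funext => x; rewrite /= mulr1 mul0r addr0.
rewrite (hp ord_max).2 partialZ ?partial_coord; last exact: total_coord.
by apply/funext => x; rewrite /= mulr0 mul0r add0r mul1r.
Qed.

Lemma SB1_bound F : SB one F -> exists C : R, forall x, `|F x| <= C.
Proof.
by move=> SF; have [C hC] := SB_bounded SF 0; exists C => x; have := hC x; rewrite expr0 mul1r.
Qed.

Lemma integrable_radial n F x : SB one F ->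
  mu.-integrable `[0, 1] (EFin \o (fun u => u ^+ n * dilate F u x)).
Proof.
move=> SF; apply: continuous_compact_integrable; first exact: segment_compact.
apply: continuous_subspaceT => u; apply: cvgM; first exact: exprn_continuous.
have cF := @continuous_slice1 _ _ (x ord0 ord_max) (SB_continuous SF).
apply: (@continuous_comp _ _ _ (fun u : R => u * x ord0 ord0) (fun t => F (vec t (x ord0 ord_max)))).
  by apply: cvgM; [exact: cvg_id|exact: cvg_cst].
exact: cF.
Qed.

Definition radial_term n F (u : R) x : R := u ^+ n * dilate F u x.

Lemma radial_termP n F u : total F ->
  [/\ total (radial_term n F u),
      partial ord0 (radial_term n F u) = radial_term n.+1 (partial ord0 F) u &
      partial ord_max (radial_term n F u) = radial_term n (partial ord_max F) u].
Proof.
move=> dF; have [d0 d1 d2] := partial_dilate u dF; split.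
- by apply: totalM; [exact: total_cst|exact: d0].
- rewrite (partialZ (u ^+ n) ord0 d0) d1; apply/funext => x.
  by rewrite /radial_term exprSr mulrA.
- by rewrite (partialZ (u ^+ n) ord_max d0) d2.
Qed.

Lemma radial_term_partial n F u i : total F ->
  exists k, partial i (radial_term n F u) = radial_term k (partial i F) u.
Proof.
move=> dF; have [_ e0 e1] := radial_termP n u dF; case: (ord2P i) => ->.
  by exists n.+1.
by exists n.
Qed.

Lemma ex_uniform (P : 'I_2 -> R -> Prop) :
  (forall i (C C' : R), C <= C' -> P i C -> P i C') ->
  (forall i, exists C, P i C) -> exists C, forall i, P i C.
Proof.
move=> mono ex; have [C0 h0] := ex ord0; have [C1 h1] := ex ord_max.
exists (Num.max C0 C1) => i; case: (ord2P i) => ->.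
  by apply: mono h0; rewrite le_max lexx.
by apply: mono h1; rewrite le_max lexx orbT.
Qed.

Lemma SB1_partial2_bound F : SB one F ->
  exists C : R, forall i j x, `|partial j (partial i F) x| <= C.
Proof.
move=> SF; apply: (@ex_uniform (fun i C => forall j x, `|partial j (partial i F) x| <= C)).
  by move=> i C C' CC' h j x; exact: le_trans CC'.
move=> i; apply: (@ex_uniform (fun j C => forall x, `|partial j (partial i F) x| <= C)).
  by move=> j C C' CC' h x; exact: le_trans CC'.
by move=> j; exact: SB1_bound (SB_partial j (SB_partial i SF)).
Qed.

Lemma radial_mean_partial n F : SB one F ->
  [/\ total (radial_mean n F),
      partial ord0 (radial_mean n F) = radial_mean n.+1 (partial ord0 F) &
      partial ord_max (radial_mean n F) = radial_mean n (partial ord_max F)].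
Proof.
move=> SF; have dF := SB_total SF.
have [C hC] := SB1_partial2_bound SF.
have hT u i j x : `[0, 1]%classic u -> `|partial j (partial i (radial_term n F u)) x| <= C.
  rewrite /= in_itv /= => /andP[u0 u1].
  have [k ->] := radial_term_partial n u i dF.
  have [k' ->] := radial_term_partial k u j (SB_total (SB_partial i SF)).
  rewrite /radial_term normrM normrX (ger0_norm u0) -[leRHS]mul1r.
  apply: ler_pM; rewrite ?exprn_ge0 ?exprn_ile1//; exact: hC.
have [|||||tF pF] := @differentiation_under_integral2 R _ _ mu `[0, 1]%classic (radial_term n F)
   (fun=> 2 * C) (measurable_itv _).
- by move=> u _; have [] := radial_termP n u dF.
- move=> u i x h Du; apply: lipschitz_partial; last by move=> j y; exact: hT.
  have [k ->] := radial_term_partial n u i dF.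
  by have [] := radial_termP k u (SB_total (SB_partial i SF)).
- by apply: continuous_compact_integrable; [exact: segment_compact|move=> u; exact: cvg_cst].
- by move=> x; exact: integrable_radial.
- move=> x i; case: (ord2P i) => ->.
    have := integrable_radial n.+1 x (SB_partial ord0 SF).
    by congr (_.-integrable _ _); apply/funext => u /=; have [_ ->] := radial_termP n u dF.
  have := integrable_radial n x (SB_partial ord_max SF).
  by congr (_.-integrable _ _); apply/funext => u /=; have [_ _ ->] := radial_termP n u dF.
- split=> //.
    apply: etrans (pF ord0) _; apply/funext => x; rewrite /radial_mean; congr (Rintegral _ _ _).
    by apply/funext => u; have [_ ->] := radial_termP n u dF.
  apply: etrans (pF ord_max) _; apply/funext => x; rewrite /radial_mean; congr (Rintegral _ _ _).
  by apply/funext => u; have [_ _ ->] := radial_termP n u dF.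
Qed.

(** Only boundedness is claimed: small dilation factors bring values near the axis [s = 0] into the
    mean, which in general destroys decay in s. Decay is recovered later by a Gaussian factor or by
    [SB_divide]. *)
Lemma SB_radial_mean n F : SB one F -> SB one (radial_mean n F).
Proof.
move=> SF.
pose X (h : 'rV[R]_2 -> R) := exists n F, SB one F /\ h = radial_mean n F.
apply: (@SB_coind _ _ X) => //.
- by move=> _ [m [E [SE ->]]]; have [] := radial_mean_partial m SE.
- move=> _ i [m [E [SE ->]]]; apply: sum_gen; have [_ e0 e1] := radial_mean_partial m SE.
  case: (ord2P i) => ->; [exists m.+1, (partial ord0 E)|exists m, (partial ord_max E)];
    by split=> //; exact: SB_partial.
- move=> _ [m [E [SE ->]]] k; have [C hC] := SB1_bound SE.
  exists C => x; rewrite expr1n mul1r.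
  have I1 := integrable_radial m x SE.
  rewrite /radial_mean.
  apply: le_trans; first by apply: le_normr_Rintegral I1; exact: measurable_itv.
  have E1 : \int[mu]_(u in `[0, 1]) C = C.
    rewrite Rintegral_cst//= lebesgue_measure_itv /= lte_fin ltr01 oppr0 adde0 /=.
    by rewrite mulr1.
  rewrite -[leRHS]E1; apply: le_Rintegral => //.
  + exact: (integrable_norm I1).
  + by apply: continuous_compact_integrable; [exact: segment_compact|move=> u; exact: cvg_cst].
  + move=> u; rewrite /= in_itv /= => /andP[u0 u1]; rewrite normrM normrX (ger0_norm u0) -[leRHS]mul1r.
    by apply: ler_pM; rewrite ?exprn_ge0 ?exprn_ile1//; exact: hC.
- by apply: sum_gen; exists n, F.
Qed.

Lemma int_monomial n : \int[mu]_(u in `[0, 1]) u ^+ n = n.+1%:R^-1 :> R.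
Proof.
have dF (t : R) : is_derive t 1 (fun t : R => n.+1%:R^-1 * t ^+ n.+1) (t ^+ n).
  have h1 : is_derive t 1 (fun t : R => t ^+ n.+1) (n.+1%:R * t ^+ n).
    apply: DeriveDef; first exact: exprn_derivable.
    by rewrite exp_derive /GRing.scale /= mulr1.
  apply: is_derive_eq (is_derive_mul (is_derive_const _ t) h1) _.
  by rewrite mul0r add0r mulrA mulVf ?mul1r// pnatr_eq0.
have cF : continuous (fun t : R => n.+1%:R^-1 * t ^+ n.+1).
  by move=> t; apply: differentiable_continuous; apply/derivable1_diffP; case: (dF t).
rewrite /Rintegral (@continuous_FTC2 _ _ (fun t : R => n.+1%:R^-1 * t ^+ n.+1)) ?ltr01//.
- by rewrite -EFinD /= expr1n expr0n /= mulr0 subr0 mulr1.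
- by apply: continuous_subspaceT => t; exact: exprn_continuous.
- split=> [t _||]; first by case: (dF t).
    by apply: cvg_at_right_filter; exact: cF.
  by apply: cvg_at_left_filter; exact: cF.
- by move=> t _; rewrite derive1E; case: (dF t).
Qed.

Lemma radial_mean_origin n F (t : R) :
  radial_mean n F (vec 0 t) = F (vec 0 t) / n.+1%:R.
Proof.
rewrite /radial_mean mulrC -int_monomial -RintegralZr//.
  by congr (Rintegral _ _ _); apply/funext => u; rewrite /dilate !mxE /= mulr0.
apply: continuous_compact_integrable; first exact: segment_compact.
by apply: continuous_subspaceT => u; exact: exprn_continuous.
Qed.

(** The fundamental theorem of calculus along [u -> F(u s, t)]. *)
Lemma radial_mean_derive F x : SB one F ->
  mul1 (radial_mean 0 (partial ord0 F)) x = F x - F (vec 0 (x ord0 ord_max)).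
Proof.
move=> SF.
have dF (u : R) : is_derive u 1 (fun u => F (vec (0 + u * x ord0 ord0) (x ord0 ord_max)))
    (x ord0 ord0 * dilate (partial ord0 F) u x).
  have := is_derive_comp_vec (is_derive_line 0 (x ord0 ord0) u)
    (is_derive_const (x ord0 ord_max) u) (SB_total SF _).
  by move=> h; apply: is_derive_eq h _; rewrite /dilate add0r mul0r addr0.
have cF : continuous (fun u : R => F (vec (0 + u * x ord0 ord0) (x ord0 ord_max))).
  by move=> t; apply: differentiable_continuous; apply/derivable1_diffP; case: (dF t).
have S0 := SB_partial ord0 SF.
rewrite /mul1 /radial_mean -RintegralZl//; last exact: integrable_radial.
rewrite /Rintegral (@continuous_FTC2 _ _ (fun u => F (vec (0 + u * x ord0 ord0) (x ord0 ord_max)))) ?ltr01//.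
- rewrite /= !add0r mul1r mul0r; congr (F _ - _); exact: vecE.
- apply: continuous_subspaceT => u; apply: cvgM; first exact: cvg_cst.
  apply: cvgM; first exact: exprn_continuous.
  have c0 := @continuous_slice1 _ _ (x ord0 ord_max) (SB_continuous S0).
  apply: (@continuous_comp _ _ _ (fun u : R => u * x ord0 ord0) (fun t => partial ord0 F (vec t (x ord0 ord_max)))).
    by apply: cvgM; [exact: cvg_id|exact: cvg_cst].
  exact: c0.
- split=> [t _||]; first by case: (dF t).
    by apply: cvg_at_right_filter; exact: cF.
  by apply: cvg_at_left_filter; exact: cF.
- by move=> t _; rewrite derive1E expr0 mul1r; case: (dF t).
Qed.

End Hadamard.

(** * Homogeneous trigonometric polynomials *)

Section Trigonometric_homogeneous.
Context {R : realType}.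
Implicit Types (h g : R -> R).

(* The restrictions to the unit circle of the homogeneous polynomials. *)
Fixpoint Hom (d : nat) h : Prop :=
  if d is d'.+1 then exists h1 h2, [/\ Hom d' h1, Hom d' h2 &
    h = fun t => cos t * h1 t + sin t * h2 t]
  else exists c : R, h = fun=> c.

Lemma HomD d h g : Hom d h -> Hom d g -> Hom d (fun t => h t + g t).
Proof.
elim: d h g => [|d IH] h g /=.
  by move=> [c ->] [e ->]; exists (c + e).
move=> [h1 [h2 [H1 H2 ->]]] [g1 [g2 [G1 G2 ->]]].
exists (fun t => h1 t + g1 t), (fun t => h2 t + g2 t); split; [exact: IH|exact: IH|].
by apply/funext => t; ring.
Qed.

Lemma HomZ d (c : R) h : Hom d h -> Hom d (fun t => c * h t).
Proof.
elim: d h => [|d IH] h /=; first by move=> [e ->]; exists (c * e).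
move=> [h1 [h2 [H1 H2 ->]]]; exists (fun t => c * h1 t), (fun t => c * h2 t).
by split; [exact: IH|exact: IH|apply/funext => t; ring].
Qed.

Lemma Hom_const0 d : Hom d (fun=> 0).
Proof.
elim: d => [|d IH] /=; first by exists 0.
by exists (fun=> 0), (fun=> 0); split=> //; apply/funext => t; ring.
Qed.

Lemma Hom_cos d h : Hom d h -> Hom d.+1 (fun t => cos t * h t).
Proof.
by move=> Hh; exists h, (fun=> 0); split=> //; [exact: Hom_const0|apply/funext => t; ring].
Qed.

Lemma Hom_sin d h : Hom d h -> Hom d.+1 (fun t => sin t * h t).
Proof.
by move=> Hh; exists (fun=> 0), h; split=> //; [exact: Hom_const0|apply/funext => t; ring].
Qed.

(** Multiplication by [cos^2 + sin^2 = 1]: on the circle, a form counts as one of any higher degree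
    of the same parity. *)
Lemma Hom_addn2 d h : Hom d h -> Hom d.+2 h.
Proof.
move=> Hh; have := HomD (Hom_cos (Hom_cos Hh)) (Hom_sin (Hom_sin Hh)).
congr Hom; apply/funext => t.
by rewrite !mulrA -mulrDl -!expr2 cos2Dsin2 mul1r.
Qed.

Lemma HomM d e h g : Hom d h -> Hom e g -> Hom (d + e) (fun t => h t * g t).
Proof.
move=> Hh Hg; elim: d h Hh => [|d IH] h /=.
  by move=> [c ->]; exact: HomZ.
move=> [h1 [h2 [H1 H2 ->]]].
exists (fun t => h1 t * g t), (fun t => h2 t * g t); split; [exact: IH|exact: IH|].
by apply/funext => t; ring.
Qed.

(** If [h] restricts a form [q] of degree d, then on the circle [x q_x + y q_y = d q] and
    [- y q_x + x q_y = h']. Solved for the gradient, the two displayed expressions are [q_x] and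
    [q_y], of degree [d - 1]. *)
Lemma Hom_derive d h : Hom d h -> exists2 h' : R -> R, Hom d h' &
  (forall t : R, is_derive t 1 h (h' t)) /\
  (if d is d'.+1 then Hom d' (fun t => cos t * (d%:R * h t) - sin t * h' t) /\
                      Hom d' (fun t => sin t * (d%:R * h t) + cos t * h' t)
   else forall t, h' t = 0).
Proof.
elim: d h => [|d IH] h /=.
  move=> [c ->]; exists (fun=> 0); first by exists 0.
  by split=> // t; exact: is_derive_const.
move=> [h1 [h2 [H1 H2 ->]]].
have [k1 K1 [D1 E1]] := IH _ H1; have [k2 K2 [D2 E2]] := IH _ H2.
exists (fun t => cos t * (k1 t + h2 t) + sin t * (k2 t - h1 t)).
  exists (fun t => k1 t + h2 t), (fun t => k2 t + -1 * h1 t); split.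
  - exact: HomD.
  - by apply: HomD => //; exact: HomZ.
  - by apply/funext => t; rewrite mulN1r.
split=> [t|].
  have := is_derive_add (is_derive_mul (is_derive_cos t) (D1 t)) (is_derive_mul (is_derive_sin t) (D2 t)).
  by move=> h0; apply: is_derive_eq h0 _; ring.
have cs t : sin t * sin t = 1 - cos t * cos t :> R.
  by rewrite -!expr2 -(cos2Dsin2 t) addrC addKr.
case: d IH H1 H2 K1 K2 E1 E2 => [|d] IH H1 H2 K1 K2 E1 E2.
  split.
    move: (H1); congr (Hom 0); apply/funext => t; rewrite E1 E2.
    transitivity (h1 t * (cos t * cos t + sin t * sin t)); [by rewrite cs; ring|by ring].
  move: (H2); congr (Hom 0); apply/funext => t; rewrite E1 E2.
  transitivity (h2 t * (cos t * cos t + sin t * sin t)); [by rewrite cs; ring|by ring].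
split.
  have := HomD (HomD (Hom_cos E1.1) (Hom_sin E2.1)) H1.
  congr Hom; apply/funext => t; rewrite -[in RHS]natr1.
  transitivity ((cos t * (cos t * (d.+1%:R * h1 t) - sin t * k1 t) +
    sin t * (cos t * (d.+1%:R * h2 t) - sin t * k2 t)) + h1 t * (cos t * cos t + sin t * sin t)).
    by rewrite cs; ring.
  by ring.
have := HomD (HomD (Hom_cos E1.2) (Hom_sin E2.2)) H2.
congr Hom; apply/funext => t; rewrite -[in RHS]natr1.
transitivity ((cos t * (sin t * (d.+1%:R * h1 t) + cos t * k1 t) +
  sin t * (sin t * (d.+1%:R * h2 t) + cos t * k2 t)) + h2 t * (cos t * cos t + sin t * sin t)).
  by rewrite cs; ring.
by ring.
Qed.

End Trigonometric_homogeneous.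

(** * Radial jets along [s = 0] *)

Section Jets.
Context {R : realType}.
Implicit Types (F G H : 'rV[R]_2 -> R) (x : 'rV[R]_2).

Local Notation one := (fun=> 1 : R).

Definition jet r F (t : R) : R := iter r (partial ord0) F (vec 0 t).

(* For the Fourier transform of [phi] in p this is condition (ii). *)
Definition hom_jets k F := forall r, Hom (k + r) (jet r F).

Lemma SB1_weight b F : SB (weight b) F -> SB one F.
Proof.
apply: (@SB_weaken _ _ _ _ 1 0) => // x; first exact: weight_ge0.
by rewrite expr0 mulr1.
Qed.

Lemma SB_iter0 w F r : SB w F -> SB w (iter r (partial ord0) F).
Proof. by move=> SF; elim: r => //= r; exact: SB_partial. Qed.

(** Weaker than [SB], because multiplication by [s], which enters [gauss_conj], does not preserve
    boundedness. *)
Definition radially_smooth F := forall r, total (iter r (partial ord0) F).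

Lemma SB_radially_smooth w F : SB w F -> radially_smooth F.
Proof. by move=> SF r; apply: SB_total; exact: SB_iter0 SF. Qed.

Lemma iter_partialD r F G : radially_smooth F -> radially_smooth G ->
  iter r (partial ord0) (fun x => F x + G x) =
  fun x => iter r (partial ord0) F x + iter r (partial ord0) G x.
Proof. by move=> SF SG; elim: r => //= r ->; exact: partialD (SF r) (SG r). Qed.

Lemma iter_partialZ r (c : R) F : radially_smooth F ->
  iter r (partial ord0) (fun x => c * F x) = fun x => c * iter r (partial ord0) F x.
Proof. by move=> SF; elim: r => //= r ->; exact: partialZ (SF r). Qed.

Lemma total_mul1 F : total F -> total (mul1 F).
Proof. by move=> dF; apply: totalM => //; exact: total_coord. Qed.

Lemma iter_partial_mul1 r F : radially_smooth F -> iter r (partial ord0) (mul1 F) =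
  fun x => mul1 (iter r (partial ord0) F) x + r%:R * iter r.-1 (partial ord0) F x.
Proof.
move=> SF.
have p1 E : total E -> partial ord0 (mul1 E) = fun x => E x + mul1 (partial ord0 E) x.
  move=> dE; rewrite partialM//; last exact: total_coord.
  by rewrite partial_coord; apply/funext => x; rewrite mul1r.
elim: r => [|r IH] /=; first by apply/funext => x; rewrite mul0r addr0.
rewrite IH (partialD _ (total_mul1 (SF r)) (totalM (total_cst _) (SF r.-1))).
rewrite p1 ?(partialZ _ _ (SF r.-1)); last exact: SF r.
apply/funext => x; case: r {IH} => [|r] /=; rewrite -?natr1; ring.
Qed.

Lemma radially_smoothD F G : radially_smooth F -> radially_smooth G ->
  radially_smooth (fun x => F x + G x).
Proof. by move=> SF SG r; rewrite iter_partialD//; exact: totalD (SF r) (SG r). Qed.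

Lemma radially_smoothZ c F : radially_smooth F -> radially_smooth (fun x => c * F x).
Proof. by move=> SF r; rewrite iter_partialZ//; exact: totalM (total_cst _) (SF r). Qed.

Lemma radially_smooth_mul1 F : radially_smooth F -> radially_smooth (mul1 F).
Proof.
move=> SF r; rewrite iter_partial_mul1//; apply: totalD; first exact: total_mul1 (SF r).
exact: totalM (total_cst _) (SF r.-1).
Qed.

Lemma radially_smooth_partial F : radially_smooth F -> radially_smooth (partial ord0 F).
Proof. by move=> SF r; have := SF r.+1; rewrite iterSr. Qed.

Lemma jetD r F G t : radially_smooth F -> radially_smooth G ->
  jet r (fun x => F x + G x) t = jet r F t + jet r G t.
Proof. by move=> SF SG; rewrite /jet iter_partialD. Qed.

Lemma jetZ r (c : R) F t : radially_smooth F -> jet r (fun x => c * F x) t = c * jet r F t.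
Proof. by move=> SF; rewrite /jet iter_partialZ. Qed.

Lemma jetS r F t : jet r.+1 F t = jet r (partial ord0 F) t.
Proof. by rewrite /jet iterSr. Qed.

Lemma jet_mul1 r F t : radially_smooth F -> jet r (mul1 F) t = r%:R * jet r.-1 F t.
Proof. by move=> SF; rewrite /jet iter_partial_mul1// /mul1 mxE /= mul0r add0r. Qed.

Lemma hom_jetsD k F G : radially_smooth F -> radially_smooth G ->
  hom_jets k F -> hom_jets k G -> hom_jets k (fun x => F x + G x).
Proof.
move=> SF SG hF hG r; have := HomD (hF r) (hG r).
by congr Hom; apply/funext => t; rewrite jetD.
Qed.

Lemma hom_jetsZ k (c : R) F : radially_smooth F -> hom_jets k F -> hom_jets k (fun x => c * F x).
Proof.
by move=> SF hF r; have := HomZ c (hF r); congr Hom; apply/funext => t; rewrite jetZ.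
Qed.

Lemma hom_jets_partial k F : hom_jets k F -> hom_jets k.+1 (partial ord0 F).
Proof. by move=> hF r; have := hF r.+1; rewrite addSnnS; congr Hom; apply/funext => t; rewrite jetS. Qed.

Lemma iter_partial_radial r n F : SB one F ->
  iter r (partial ord0) (radial_mean n F) = radial_mean (n + r) (iter r (partial ord0) F).
Proof.
move=> SF; elim: r => [|r IH]; first by rewrite addn0.
by rewrite !iterS IH; have [_ -> _] := radial_mean_partial (n + r) (SB_iter0 r SF); rewrite addnS.
Qed.

(** After [r] radial derivatives the weight is [u^(n + r)], whose integral over [[0, 1]] is
    [1 / (n + r + 1)]. *)
Lemma jet_radial_mean r n F t : SB one F ->
  jet r (radial_mean n F) t = jet r F t / (n + r).+1%:R.
Proof. by move=> SF; rewrite /jet iter_partial_radial// radial_mean_origin. Qed.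

Definition mul_gauss F x : R := gauss (x ord0 ord0) * F x.

Lemma SB_mul_gauss F : SB one F -> SB (weight false) (mul_gauss F).
Proof.
by move=> SF; apply: (SBM _ _ (SB_gauss ord0) SF) => // x; rewrite addr_ge0.
Qed.

(* The conjugate of [partial ord0] by the multiplication by the Gaussian. *)
Definition gauss_conj F x : R := partial ord0 F x + -2 * mul1 F x.

Lemma partial_mul_gauss F : total F -> partial ord0 (mul_gauss F) = mul_gauss (gauss_conj F).
Proof.
move=> dF; have [dg pg] := partial_comp1 ord0 (@is_derive_gauss R) (@total_coord R ord0).
rewrite partialM// pg partial_coord; apply/funext => x; rewrite /mul_gauss /gauss_conj /mul1 /=; ring.
Qed.

Lemma radially_smooth_gauss_conj F : radially_smooth F -> radially_smooth (gauss_conj F).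
Proof.
move=> SF; apply: radially_smoothD; first exact: radially_smooth_partial.
exact/radially_smoothZ/radially_smooth_mul1.
Qed.

Lemma radially_smooth_iter_gauss_conj F r : radially_smooth F -> radially_smooth (iter r gauss_conj F).
Proof. by move=> SF; elim: r => //= r; exact: radially_smooth_gauss_conj. Qed.

Lemma jet_mul_gauss r F t : radially_smooth F -> jet r (mul_gauss F) t = jet 0 (iter r gauss_conj F) t.
Proof.
move=> SF; rewrite /jet; have -> : iter r (partial ord0) (mul_gauss F) = mul_gauss (iter r gauss_conj F).
  elim: r => //= r ->; apply: partial_mul_gauss.
  exact: (radially_smooth_iter_gauss_conj r SF 0).
by rewrite /mul_gauss mxE /= /gauss mul0r oppr0 expR0 mul1r.
Qed.

Lemma hom_jets_mul1 k F : radially_smooth F -> hom_jets k F -> hom_jets k.+1 (mul1 F).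
Proof.
move=> SF hF [|r].
  have -> : jet 0 (mul1 F) = fun=> 0 by apply/funext => t; rewrite jet_mul1// mul0r.
  exact: Hom_const0.
have -> : jet r.+1 (mul1 F) = fun t => r.+1%:R * jet r F t by apply/funext => t; rewrite jet_mul1.
(* The jet has degree [k + r], two less than what is asked. *)
by apply: HomZ; rewrite addSnnS !addnS; apply: Hom_addn2; exact: hF.
Qed.

Lemma hom_jets_gauss_conj k F r : radially_smooth F -> hom_jets k F ->
  hom_jets (k + r) (iter r gauss_conj F).
Proof.
move=> SF hF; elim: r => [|r IH]; first by rewrite addn0.
have Sr := radially_smooth_iter_gauss_conj r SF.
rewrite addnS; apply: hom_jetsD.
- exact: radially_smooth_partial.
- exact/radially_smoothZ/radially_smooth_mul1.
- exact: hom_jets_partial.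
- by apply: hom_jetsZ; [exact: radially_smooth_mul1|exact: hom_jets_mul1].
Qed.

Lemma hom_jets_mul_gauss k F : radially_smooth F -> hom_jets k F -> hom_jets k (mul_gauss F).
Proof.
move=> SF hF r; have := hom_jets_gauss_conj r SF hF 0; rewrite addn0.
by congr Hom; apply/funext => t; rewrite jet_mul_gauss.
Qed.

(* This stands for [Hom n.-1 h], extended to n = 0. *)
Definition sub_hom n (h : R -> R) := Hom n (fun t => cos t * h t) /\ Hom n (fun t => sin t * h t).

Lemma sub_hom0 n (h : R -> R) : (forall t, h t = 0) -> sub_hom n h.
Proof.
move=> h0; split; have : Hom n (fun=> 0 : R) by exact: Hom_const0.
  by congr Hom; apply/funext => t; rewrite h0 mulr0.
by congr Hom; apply/funext => t; rewrite h0 mulr0.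
Qed.

Lemma sub_homD n h g : sub_hom n h -> sub_hom n g -> sub_hom n (fun t => h t + g t).
Proof.
move=> [h1 h2] [g1 g2]; split; [have := HomD h1 g1|have := HomD h2 g2];
  by congr Hom; apply/funext => t; rewrite mulrDr.
Qed.

Lemma sub_homZ n c h : sub_hom n h -> sub_hom n (fun t => c * h t).
Proof.
move=> [h1 h2]; split; [have := HomZ c h1|have := HomZ c h2];
  by congr Hom; apply/funext => t; rewrite mulrCA.
Qed.

(** The Gaussian is [1 + O(s^2)] and even, so it alters the r-th jet only by multiples of the jets
    of orders [r - 2], [r - 4], and so on, whose degrees are at most [k + r - 1] and of that
    parity. *)
Lemma jet_mul_gauss_sub k F r : radially_smooth F -> hom_jets k.+1 F ->
  sub_hom (k + r) (fun t => jet r (mul_gauss F) t - jet r F t).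
Proof.
move=> SF hF.
(* The [r'] derivatives still to be taken are carried along, since each [gauss_conj] mixes a
   derivative with a multiplication by [s]. *)
suff H r' : sub_hom (k + r + r') (fun t => jet r' (iter r gauss_conj F) t - jet (r + r') F t).
  have := H 0%N; rewrite addn0 => -[H1 H2]; split; [move: H1|move: H2];
    by congr Hom; apply/funext => t; rewrite jet_mul_gauss// addn0.
elim: r r' => [|r IH] r'.
  by apply: sub_hom0 => t; rewrite subrr.
have Sr := radially_smooth_iter_gauss_conj r SF.
have E t : jet r' (iter r.+1 gauss_conj F) t - jet (r.+1 + r') F t =
   (jet r'.+1 (iter r gauss_conj F) t - jet (r + r'.+1) F t) + -2 * (r'%:R * jet r'.-1 (iter r gauss_conj F) t).
  rewrite iterS /gauss_conj jetD; last 2 first.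
  - exact: radially_smooth_partial.
  - exact/radially_smoothZ/radially_smooth_mul1.
  rewrite jetZ; last exact: radially_smooth_mul1.
  by rewrite jet_mul1// jetS addSnnS; ring.
rewrite (_ : (fun t => _) = fun t => (jet r'.+1 (iter r gauss_conj F) t - jet (r + r'.+1) F t) +
   -2 * (r'%:R * jet r'.-1 (iter r gauss_conj F) t)); last by apply/funext.
apply: sub_homD; first by have := IH r'.+1; rewrite !addnS addSn.
apply: sub_homZ; case: r' {E} => [|r'].
  by apply: sub_hom0 => t; rewrite mul0r.
apply: sub_homZ; rewrite addnS /=.
have := hom_jets_gauss_conj r SF hF r'; have -> : (k.+1 + r + r' = k + r.+1 + r')%N by lia.
by move=> h; split; [exact: Hom_cos|exact: Hom_sin].
Qed.

End Jets.

(* Keeps the unifier from comparing the underlying limits and integrals. *)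
Opaque partial.

(** * Mixed derivatives, equivariance and the reduction of the degree *)

Section Reduction.
Context {R : realType}.
Implicit Types (F G H : 'rV[R]_2 -> R) (x : 'rV[R]_2).

Local Notation one := (fun=> 1 : R).

Definition origin F x : R := F (vec 0 (x ord0 ord_max)).

Lemma partial_origin F i : total F -> total (origin F) /\
  partial i (origin F) = fun x => (i == ord_max)%:R * origin (partial ord_max F) x.
Proof.
move=> dF; have [d p] := partial_comp_vec i (total_cst (0 : R)) (@total_coord R ord_max) dF.
split=> //; rewrite p partial_cst partial_coord; apply/funext => x.
by rewrite mul0r add0r.
Qed.

Lemma SB_origin F : SB one F -> SB one (origin F).
Proof.
move=> SF; have := @SB_affine R one one F 0 0 0 0 0 1 1 0.
have h1 (x : 'rV[R]_2) : 0 <= one x by exact: ler01.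
have h2 (x : 'rV[R]_2) : one x <= 1 * 1 ^+ 0 by rewrite expr0 mulr1.
move=> /(_ h1 h1 (fun x => h2 x) SF).
by congr SB; apply/funext => x; rewrite /origin !mul0r !add0r mul1r.
Qed.

Lemma continuous_eq0 (g : R -> R) : continuous g -> (forall s, s != 0 -> g s = 0) -> g 0 = 0.
Proof.
move=> cg g0; have h1 : g \o (fun n : nat => (1 + n%:R)^-1) @ \oo --> g 0.
  by apply: (cvg_comp (fun n : nat => (1 + n%:R)^-1) g); [exact: cvg_inv_nat|exact: cg].
have h2 : g \o (fun n : nat => (1 + n%:R)^-1) @ \oo --> (0 : R).
  apply: cvg_near_cst; apply: nearW => n /=; rewrite g0//.
exact: cvg_unique h1 h2.
Qed.

Lemma continuous_eq_origin (A B : 'rV[R]_2 -> R) t : continuous A -> continuous B ->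
  mul1 A = mul1 B -> A (vec 0 t) = B (vec 0 t).
Proof.
move=> cA cB AB; apply/eqP; rewrite -subr_eq0; apply/eqP.
apply: (@continuous_eq0 (fun s => A (vec s t) - B (vec s t))).
  by move=> s; apply: cvgB; [exact: (@continuous_slice1 _ A t cA)|exact: (@continuous_slice1 _ B t cB)].
move=> s s0; have := congr1 (fun f => f (vec s t)) AB; rewrite /mul1 !mxE /=.
by move=> /(mulfI s0) ->; rewrite subrr.
Qed.

(* Both mixed derivatives are computed from the Taylor formula with integral
   remainder [F(s, t) = F(0, t) + s * radial_mean 0 (partial ord0 F) (s, t)]. *)
Lemma partial_comm_origin F t : SB one F ->
  partial ord_max (partial ord0 F) (vec 0 t) = partial ord0 (partial ord_max F) (vec 0 t).
Proof.
move=> SF; have dF := SB_total SF.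
have S0 := SB_partial ord0 SF; have S1 := SB_partial ord_max SF.
have E : mul1 (radial_mean 0 (partial ord0 F)) = fun x => F x + -1 * origin F x.
  by apply/funext => x; rewrite radial_mean_derive// mulN1r.
have [du _ pu] := radial_mean_partial 0 S0.
have [d_o po] := partial_origin ord_max dF.
have E1 : mul1 (radial_mean 0 (partial ord_max (partial ord0 F))) =
          mul1 (radial_mean 0 (partial ord0 (partial ord_max F))).
  transitivity (partial ord_max (mul1 (radial_mean 0 (partial ord0 F)))).
    rewrite partialM//; last exact: total_coord.
    by rewrite partial_coord pu; apply/funext => x; rewrite mul0r add0r.
  have e1 := partialD ord_max dF (totalM (total_cst (-1)) d_o).
  have e2 := partialZ (-1) ord_max d_o.
  apply: etrans (congr1 (partial ord_max) E) (etrans e1 _); apply/funext => x.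
  rewrite e2 po (radial_mean_derive x S1) mulN1r mul1r.
  by [].
have cA := SB_continuous (SB_radial_mean 0 (SB_partial ord_max S0)).
have cB := SB_continuous (SB_radial_mean 0 (SB_partial ord0 S1)).
have hA := radial_mean_origin 0 (partial ord_max (partial ord0 F)) t.
have hB := radial_mean_origin 0 (partial ord0 (partial ord_max F)) t.
rewrite divr1 in hA; rewrite divr1 in hB.
exact: etrans (esym hA) (etrans (continuous_eq_origin t cA cB E1) hB).
Qed.

(** A translation in s moves any point to the axis, where the previous lemma applies. *)
Lemma partial_comm F : SB one F ->
  partial ord_max (partial ord0 F) = partial ord0 (partial ord_max F).
Proof.
move=> SF; apply/funext => y; rewrite -(vecE y).
set a := coord1 y; set t := coord2 y.
pose tr G x : R := G (vec (a + x ord0 ord0) (x ord0 ord_max)).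
have ptr i G : total G -> partial i (tr G) = tr (partial i G).
  move=> dG; have dl : total (fun x : 'rV[R]_2 => a + x ord0 ord0).
    by apply: totalD; [exact: total_cst|exact: total_coord].
  have [_ ->] := partial_comp_vec i dl (@total_coord R ord_max) dG.
  rewrite (partialD _ (total_cst a) (@total_coord R ord0)) partial_cst !partial_coord.
  by apply/funext => x; rewrite /tr; case: (ord2P i) => -> /=; rewrite add0r ?mul1r ?mul0r ?addr0 ?add0r.
have Str : SB one (tr F).
  have := @SB_affine R one one F a 1 0 0 0 1 1 0.
  have h1 (x : 'rV[R]_2) : 0 <= one x by exact: ler01.
  have h2 (x : 'rV[R]_2) : one x <= 1 * 1 ^+ 0 by rewrite expr0 mulr1.
  move=> /(_ h1 h1 (fun x => h2 x) SF).
  by congr SB; apply/funext => x; rewrite /tr !mul0r addr0 !add0r !mul1r.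
have d := SB_total SF; have d0 := SB_total (SB_partial ord0 SF); have d1 := SB_total (SB_partial ord_max SF).
have trE G : tr G (vec 0 t) = G (vec a t) by rewrite /tr !mxE /= addr0.
have E0 := etrans (congr1 (partial ord_max) (ptr ord0 F d)) (ptr ord_max _ d0).
have E1 := etrans (congr1 (partial ord0) (ptr ord_max F d)) (ptr ord0 _ d1).
rewrite -(trE (partial ord_max (partial ord0 F))) -(trE (partial ord0 (partial ord_max F))).
have X := partial_comm_origin t Str.
have Y0 := congr1 (fun f => f (vec 0 t)) E0.
have Y1 := congr1 (fun f => f (vec 0 t)) E1.
cbv beta in Y0, Y1.
by rewrite Y0 Y1 in X.
Qed.

Lemma iter_partial_comm r F : SB one F ->
  partial ord_max (iter r (partial ord0) F) = iter r (partial ord0) (partial ord_max F).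
Proof.
move=> SF; elim: r => //= r <-; apply: partial_comm; exact: SB_iter0.
Qed.

Lemma is_derive_jet r F (t : R) : SB one F -> is_derive t 1 (jet r F) (jet r (partial ord_max F) t).
Proof.
move=> SF; have := is_derive_comp_vec (is_derive_const 0 t) (is_derive_self t)
  (SB_total (SB_iter0 r SF) (vec 0 t)).
by move=> h; apply: is_derive_eq h _; rewrite mul0r add0r mul1r iter_partial_comm.
Qed.

Lemma is_derive_unique (f : R -> R) (t a b : R) : is_derive t 1 f a -> is_derive t 1 f b -> a = b.
Proof. by move=> [_ <-] [_ <-]. Qed.

Lemma hom_jets_angular k F : SB one F -> hom_jets k F -> hom_jets k (partial ord_max F).
Proof.
move=> SF hF r; have [h' Hh' [dh' _]] := Hom_derive (hF r).
move: Hh'; congr Hom; apply/funext => t.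
exact: is_derive_unique (dh' t) (is_derive_jet r t SF).
Qed.

(* With [b = true], [t'] is [t + pi] modulo 2 pi; with [b = false] this is
   2 pi-periodicity. *)
Definition equivariant m G := forall (b : bool) (s t t' : R),
  cos t' = (-1) ^+ b * cos t -> sin t' = (-1) ^+ b * sin t ->
  G (vec ((-1) ^+ b * s) t') = (-1) ^+ (b * m) * G (vec s t).

Lemma equivariant_angular m G : total G -> equivariant m G -> equivariant m (partial ord_max G).
Proof.
move=> dG eG b s t t' ct st.
have dv (a y : R) : is_derive (0 : R) 1 (fun d => G (vec a (y + d * 1))) (partial ord_max G (vec a y)).
  have := is_derive_comp_vec (is_derive_const a 0) (is_derive_line y 1 0) (dG _).
  by move=> h; apply: is_derive_eq h _; rewrite mul0r add0r mul1r mul0r addr0.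
have h1 := dv ((-1) ^+ b * s) t'.
have h2 := is_derive_mul (is_derive_const ((-1) ^+ (b * m) : R) 0) (dv s t).
(* The relation between [t] and [t'] persists for [t + d] and [t' + d], so equivariance can be
   differentiated at [d = 0]. *)
rewrite (_ : (fun d => _) = fun d => G (vec ((-1) ^+ b * s) (t' + d * 1))) in h2.
  by have := is_derive_unique h1 h2; rewrite mul0r add0r.
apply/funext => d; rewrite (eG b s (t + d * 1))//.
- by rewrite !cosD ct st; ring.
- by rewrite !sinD ct st; ring.
Qed.

Lemma equivariant_radial m n G : SB one G -> equivariant m G -> equivariant m (radial_mean n G).
Proof.
move=> SG eG b s t t' ct st; rewrite /radial_mean -RintegralZl//; last exact: integrable_radial.
congr (Rintegral _ _ _); apply/funext => u.
by rewrite /dilate !mxE /= mulrCA (eG b (u * s) t)// mulrCA.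
Qed.

Lemma equivariant_gauss m G : equivariant m G -> equivariant m (mul_gauss G).
Proof.
move=> eG b s t t' ct st; rewrite /mul_gauss !mxE /= (eG b s t)// mulrCA.
by rewrite /gauss mulrACA -expr2 sqrr_sign mul1r.
Qed.

Definition mul_trig c F x : R := trig c (x ord0 ord_max) * F x.

Lemma SB_mul_trig w c F : (forall x, 0 <= w x) -> SB w F -> SB w (mul_trig c F).
Proof. by move=> w0 SF; apply: SB_mul1 => //; exact: SB_trig. Qed.

Lemma jet_mul_trig r c F t : radially_smooth F -> jet r (mul_trig c F) t = trig c t * jet r F t.
Proof.
move=> SF; rewrite /jet; have -> : iter r (partial ord0) (mul_trig c F) = mul_trig c (iter r (partial ord0) F).
  elim: r => //= r ->; rewrite /mul_trig.
  have [dc pc] := @partial_trig R c ord0 ord_max.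
  by rewrite (partialM _ dc (SF r)) pc; apply/funext => x /=; ring.
by rewrite /mul_trig mxE.
Qed.

Definition cylinder m G := [/\ SB (weight false) G, equivariant m G & hom_jets m G].

(** The sign picked up by each trigonometric factor lowers the equivariance from [m + 1] to [m]. *)
Lemma cylinder_combination m (c : bool) (e : R) G H :
  SB (weight false) G -> SB (weight false) H ->
  equivariant m.+1 G -> equivariant m.+1 H ->
  let K x := mul_trig c G x + e * mul_trig (~~ c) H x in
  (forall r, Hom (m + r) (jet r K)) -> cylinder m K.
Proof.
move=> SG SH eG eH K hK.
have w0 := @weight_ge0 R false.
split=> //; first by apply: SBD => //; [exact: SB_mul_trig|apply: SBZ => //; exact: SB_mul_trig].
move=> b s t t' ct st.
have tr k : trig k t' = (-1) ^+ b * trig k t by case: k.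
rewrite /K /mul_trig !mxE /= (eG b s t)// (eH b s t)// !tr.
have -> : ((-1) ^+ (b * m.+1) : R) = (-1) ^+ b * (-1) ^+ (b * m) by rewrite mulnS exprD.
have sb : (-1) ^+ b * (-1) ^+ b = 1 :> R by rewrite -expr2 sqrr_sign.
transitivity ((-1) ^+ b * (-1) ^+ b * ((-1) ^+ (b * m) * (trig c t * G (vec s t) + e * (trig (~~ c) t * H (vec s t))))).
  by ring.
by rewrite sb mul1r.
Qed.

(* [F^(r)(0, t)] being homogeneous of degree [d = m + r + 1] in (cos t, sin t), its
   partial derivatives, which are homogeneous of degree [d - 1], are
   [cos t * F^(r) - sin t * d/dt F^(r) / d] and [sin t * F^(r) + cos t * d/dt F^(r) / d]
   up to the factor d.  Averaging over dilations with the weight [u^m] divides the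
   r-th jet of [d/dt F] by d for all r at once; the Gaussian restores the decay. *)
Lemma cylinder_reduction m G : cylinder m.+1 G -> exists G1 G2,
  [/\ cylinder m G1, cylinder m G2 &
      forall x, G x = cos (x ord0 ord_max) * G1 x + sin (x ord0 ord_max) * G2 x].
Proof.
move=> [SG eG hG]; have S1 := SB1_weight SG.
pose D := partial ord_max G.
have SD : SB one D by exact: SB_partial.
pose U := radial_mean m D.
have SU : SB one U by exact: SB_radial_mean.
pose H := mul_gauss U.
have SH : SB (weight false) H by exact: SB_mul_gauss.
have eH : equivariant m.+1 H.
  apply: equivariant_gauss; apply: equivariant_radial => //.
  by apply: equivariant_angular => //; exact: SB_total SG.
have rG := SB_radially_smooth SG; have rH := SB_radially_smooth SH; have rU := SB_radially_smooth SU.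
have hU : hom_jets m.+1 U.
  move=> r; have := HomZ ((m + r).+1%:R^-1) (hom_jets_angular S1 hG r).
  by congr Hom; apply/funext => t; rewrite jet_radial_mean// mulrC.
have rT c F : SB (weight false) F -> radially_smooth (mul_trig c F).
  by move=> SF; apply: (@SB_radially_smooth _ (weight false)); apply: SB_mul_trig => //; exact: weight_ge0.
have jK c (e : R) r t : jet r (fun x => mul_trig c G x + e * mul_trig (~~ c) H x) t =
    trig c t * jet r G t + e * (trig (~~ c) t * jet r H t).
  rewrite jetD ?jetZ ?jet_mul_trig//; try exact: rT.
  by apply: radially_smoothZ; exact: rT.
(* With [U] in place of [H] these are the Euler expressions divided by [m + r + 1]. The Gaussian
   changes the jet by terms of degree [m + r - 1], and the factor sin or cos supplies the missing
   degree. *)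
have key r : Hom (m + r) (fun t => cos t * jet r G t + -1 * (sin t * jet r H t)) /\
             Hom (m + r) (fun t => sin t * jet r G t + 1 * (cos t * jet r H t)).
  have := hG r; rewrite addSn => hGr; have [h' _ [dh' [E1 E2]]] := Hom_derive hGr.
  have [B1 B2] := jet_mul_gauss_sub r rU hU.
  have n0 : ((m + r).+1%:R : R) != 0 by rewrite pnatr_eq0.
  have jU t : jet r U t = h' t / (m + r).+1%:R.
    by rewrite jet_radial_mean// -(is_derive_unique (dh' t) (is_derive_jet r t S1)).
  split.
    have := HomD (HomZ ((m + r).+1%:R^-1) E1) (HomZ (-1) B2).
    congr Hom; apply/funext => t; rewrite jU; field.
    by rewrite -natrD addrC natr1.
  have := HomD (HomZ ((m + r).+1%:R^-1) E2) B1.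
  congr Hom; apply/funext => t; rewrite jU; field.
  by rewrite -natrD addrC natr1.
exists (fun x => mul_trig true G x + -1 * mul_trig false H x),
       (fun x => mul_trig false G x + 1 * mul_trig true H x); split.
- apply: (@cylinder_combination m true (-1)) => //.
  by move=> r; have := (key r).1; congr Hom; apply/funext => t; rewrite jK.
- apply: (@cylinder_combination m false 1) => //.
  by move=> r; have := (key r).2; congr Hom; apply/funext => t; rewrite jK.
- move=> x; rewrite /mul_trig /trig.
  transitivity ((cos (x ord0 ord_max) ^+ 2 + sin (x ord0 ord_max) ^+ 2) * G x); last by ring.
  by rewrite cos2Dsin2 mul1r.
Qed.

End Reduction.

(** * From the cylinder to the plane *)

Section Expansion.
Context {R : realType}.
Implicit Types (F G H : 'rV[R]_2 -> R) (x : 'rV[R]_2).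

Local Notation one := (fun=> 1 : R).

Lemma iter_mul1E n H x : iter n mul1 H x = x ord0 ord0 ^+ n * H x.
Proof. by elim: n => [|n IH] /=; rewrite ?expr0 ?mul1r// /mul1 IH exprS mulrA. Qed.

(** For [|s| >= 1] division by [s^n] only helps, and for [|s| <= 1] the boundedness of [H] suffices.
    Radial derivatives stay in the class since [s^(k+1) d_s h = s d_s (s^k h) - k s^k h]. *)
Lemma SB_divide n H : SB one H -> SB (weight false) (iter n mul1 H) -> SB (weight false) H.
Proof.
move=> SH SnH.
pose X (h : 'rV[R]_2 -> R) := SB one h /\ exists n, SB (weight false) (iter n mul1 h).
apply: (@SB_coind _ _ X).
- exact: weight_ge0.
- by move=> h [Sh _]; exact: SB_total Sh.
- move=> h i [Sh [k Sk]]; apply: sum_gen; split; first exact: SB_partial.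
  have dh := SB_total Sh; have dk := SB_total Sk.
  case: (ord2P i) => ->; last first.
    exists k; have -> : iter k mul1 (partial ord_max h) = partial ord_max (iter k mul1 h).
      elim: k {Sk dk} => //= k ->.
      have dk : total (iter k mul1 h) by elim: k => //= k; exact: total_mul1.
      rewrite (partialM _ (@total_coord R ord0) dk) partial_coord.
      by apply/funext => x; rewrite mul0r add0r.
    exact: SB_partial.
  exists k.+1; have -> : iter k.+1 mul1 (partial ord0 h) =
      fun x => mul1 (partial ord0 (iter k mul1 h)) x + - k%:R * iter k mul1 h x.
    apply/funext => x; rewrite [mul1 (partial _ _) x]/mul1.
    elim: k {Sk dk} => [|k IH] /=; first by rewrite /mul1 oppr0 mul0r addr0.
    rewrite -[LHS]/(x ord0 ord0 * iter k.+1 mul1 (partial ord0 h) x) IH.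
    have dk : total (iter k mul1 h) by elim: k {IH} => //= k; exact: total_mul1.
    rewrite (partialM _ (@total_coord R ord0) dk) partial_coord.
    by rewrite /mul1 -natr1 /=; ring.
  apply: SBD; first exact: weight_ge0.
    exact/SB_mul_coord1/SB_partial.
  by apply: SBZ => //; exact: weight_ge0.
- move=> h [Sh [k Sk]] m.
  have [C hC] := SB_bounded Sk m; have [D hD] := SB1_bound Sh.
  have C0 : 0 <= C by apply: le_trans (hC 0); rewrite mulr_ge0 ?exprn_ge0 ?weight_ge0.
  have D0 : 0 <= D by apply: le_trans (hD 0).
  exists (C + 2 ^+ m * D) => x; have [x1|x1] := leP `|x ord0 ord0| 1.
    apply: (@le_trans _ _ (2 ^+ m * D)); last by rewrite lerDr.
    apply: ler_pM; rewrite ?exprn_ge0 ?weight_ge0//.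
    rewrite lerXn2r ?nnegrE ?weight_ge0// /weight /fiber_weight mulr1.
    by rewrite -[2]/(1 + 1) lerD2l.
  apply: (@le_trans _ _ C); last by rewrite lerDl mulr_ge0// exprn_ge0.
  apply: le_trans (hC x); rewrite ler_wpM2l ?exprn_ge0 ?weight_ge0//.
  by rewrite iter_mul1E normrM ler_peMl// normrX exprn_ege1// ltW.
- by apply: sum_gen; split=> //; exists n.
Qed.

(** The axis values are subtracted with a Gaussian factor so that the difference still decays in
    s. *)
Definition hadamard_error G x : R := G x + -1 * mul_gauss (origin G) x.

(* [G = gauss(s) G(0, t) + s * hadamard_quotient G]. *)
Definition hadamard_quotient G := radial_mean 0 (partial ord0 (hadamard_error G)).

Lemma SB_hadamard_error G : SB (weight false) G -> SB (weight false) (hadamard_error G).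
Proof.
move=> SG; have Sg := SB_mul_gauss (SB_origin (SB1_weight SG)); have w0 := @weight_ge0 R false.
exact: SBD w0 SG (SBZ (-1) w0 Sg).
Qed.

Lemma hadamard_errorE G : SB (weight false) G -> mul1 (hadamard_quotient G) = hadamard_error G.
Proof.
move=> SG; apply/funext => x.
rewrite radial_mean_derive; last exact: SB1_weight (SB_hadamard_error SG).
rewrite [X in _ - X](_ : _ = 0) ?subr0// /hadamard_error /mul_gauss /origin !mxE /=.
by rewrite /gauss mul0r oppr0 expR0 mul1r mulN1r subrr.
Qed.

Lemma SB_hadamard G : SB (weight false) G -> SB (weight false) (hadamard_quotient G).
Proof.
move=> SG; have SE := SB_hadamard_error SG; apply: (@SB_divide 1).
  by apply: SB_radial_mean; apply: SB_partial; exact: SB1_weight SE.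
by rewrite /= hadamard_errorE.
Qed.

Lemma hadamardE G x : SB (weight false) G ->
  G x = gauss (x ord0 ord0) * G (vec 0 (x ord0 ord_max)) + x ord0 ord0 * hadamard_quotient G x.
Proof.
move=> SG; have := congr1 (fun f => f x) (hadamard_errorE SG); rewrite /mul1 => ->.
by rewrite /hadamard_error /mul_gauss /origin; ring.
Qed.

(** The r-th jet of the quotient is the jet of order [r + 1] of [hadamard_error G] divided by
    [r + 1], so the degree gains one relative to the order. *)
Lemma hom_jets_hadamard k G : SB (weight false) G -> hom_jets k G ->
  hom_jets k.+1 (hadamard_quotient G).
Proof.
move=> SG hG; have S1 := SB1_weight SG; have So := SB_origin S1.
have rg := SB_radially_smooth (SB_mul_gauss So); have rG := SB_radially_smooth SG.
have ho : hom_jets k (origin G).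
  move=> [|r]; first by have := hG 0; congr Hom; apply/funext => t; rewrite /jet /= /origin mxE.
  have : Hom (k + r.+1) (fun=> 0 : R) by exact: Hom_const0.
  congr Hom; apply/funext => t; rewrite /jet iterSr.
  rewrite (partial_origin ord0 (SB_total S1)).2 /=.
  suff -> : iter r (partial ord0) (fun x => 0 * origin (partial ord_max G) x) = fun=> 0 by [].
  elim: r => [|r /= ->]; first by apply/funext => x; rewrite /= mul0r.
  by rewrite partial_cst.
have hE : hom_jets k (hadamard_error G).
  apply: hom_jetsD => //; first exact: radially_smoothZ.
  apply: hom_jetsZ => //; apply: hom_jets_mul_gauss => //.
  exact: SB_radially_smooth So.
move=> r; have := HomZ ((0 + r).+1%:R^-1) (hE r.+1); rewrite addSnnS.
congr Hom; apply/funext => t; rewrite jet_radial_mean -?jetS 1?mulrC//.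
by apply: SB_partial; exact: SB1_weight (SB_hadamard_error SG).
Qed.

Definition polar (s t : R) : 'rV[R]_2 := vec (- (s * sin t)) (s * cos t).

Lemma gauss_polar (s t : R) : gauss (- (s * sin t)) * gauss (s * cos t) = gauss s.
Proof.
rewrite /gauss -expRD; congr expR.
transitivity (- (s * s) * (cos t ^+ 2 + sin t ^+ 2)); first by ring.
by rewrite cos2Dsin2 mulr1.
Qed.

(** Each factor [s cos t] or [s sin t] is, up to sign, a coordinate of [polar s t], and the Gaussian
    of [s] is the product of those of the two coordinates. *)
Lemma Hom_gauss d (h : R -> R) : Hom d h -> exists2 Q, SB (weight true) Q &
  forall s t, s ^+ d * gauss s * h t = Q (polar s t).
Proof.
have w0 := @weight_ge0 R true.
have c0 := @coord1_weight R true.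
have c1 (x : 'rV[R]_2) : `|x ord0 ord_max| <= weight true x.
  rewrite -[leLHS]mul1r; apply: ler_pM => //; first by rewrite lerDl.
  by rewrite /fiber_weight lerDr.
elim: d h => [|d IH] h /=.
  move=> [c ->]; exists (fun x => c * (gauss (x ord0 ord0) * gauss (x ord0 ord_max))).
    apply: SBZ => //; have := SBM _ _ (@SB_gauss R ord0) (@SB_gauss R ord_max).
    by apply=> x; rewrite addr_ge0.
  by move=> s t; rewrite !mxE /= gauss_polar expr0 mul1r mulrC.
move=> [h1 [h2 [/IH[Q1 S1 E1] /IH[Q2 S2 E2] ->]]].
exists (fun x => x ord0 ord_max * Q1 x + -1 * (x ord0 ord0 * Q2 x)).
  apply: SBD => //; first exact: SB_coord.
  by apply: SBZ => //; exact: SB_coord.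
by move=> s t; rewrite -E1 -E2 !mxE /= exprS; ring.
Qed.

(** Hadamard division is iterated K times. After K steps the quotient has axis values of degree K,
    so the next term [s^K gauss(s) H(0, t)] lives on the plane by [Hom_gauss]. *)
Lemma polar_expansion G K : SB (weight false) G -> hom_jets 0 G -> exists P H,
  [/\ SB (weight true) P, SB (weight false) H &
      forall s t, G (vec s t) = P (polar s t) + s ^+ K * H (vec s t)].
Proof.
move=> SG hG.
suff [P [H [SP SH hH E]]] : exists P H, [/\ SB (weight true) P, SB (weight false) H, hom_jets K H &
    forall s t, G (vec s t) = P (polar s t) + s ^+ K * H (vec s t)].
  by exists P, H.
elim: K => [|K [P [H [SP SH hH E]]]].
  exists (fun=> 0 * 0), G; split=> // [|s t]; last by rewrite expr0 mul1r mulr0 add0r.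
  have [Q SQ _] := @Hom_gauss 0 (fun=> 0) (Hom_const0 0).
  have := SBZ 0 (@weight_ge0 R true) SQ; congr SB; apply/funext => x; ring.
have [Q SQ EQ] := Hom_gauss (hH 0); rewrite addn0 in EQ.
exists (fun x => P x + Q x), (hadamard_quotient H); split.
- by apply: SBD => //; exact: weight_ge0.
- exact: SB_hadamard.
- exact: hom_jets_hadamard.
move=> s t; rewrite E (hadamardE _ SH) -EQ /jet /= !mxE /= exprS; ring.
Qed.

End Expansion.

(** * Descent through polar coordinates *)

Section Polar_coordinates.
Context {R : realType}.
Implicit Types (b : 'rV[R]_2 -> R) (y : 'rV[R]_2).

Lemma unit_circle (x y : R) : x ^+ 2 + y ^+ 2 = 1 -> exists t, cos t = x /\ sin t = y.
Proof.
move=> xy; have x1 : -1 <= x <= 1.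
  by rewrite -ler_norml -(@expr_le1 _ 2)// -normrX ger0_norm ?sqr_ge0// -xy lerDl sqr_ge0.
have s2 : 1 - x ^+ 2 = y ^+ 2 by rewrite -xy addrC addKr.
have [y0|y0] := leP 0 y.
  by exists (acos x); rewrite acosK// sin_acos// s2 sqrtr_sqr ger0_norm.
by exists (- acos x); rewrite cosN sinN acosK// sin_acos// s2 sqrtr_sqr ltr0_norm// opprK.
Qed.

Lemma polar_surj y : exists s t, 0 <= s /\ y = polar s t.
Proof.
pose s : R := Num.sqrt (y ord0 ord0 ^+ 2 + y ord0 ord_max ^+ 2).
have q0 : 0 <= y ord0 ord0 ^+ 2 + y ord0 ord_max ^+ 2 by rewrite addr_ge0 ?sqr_ge0.
have s2 : s ^+ 2 = y ord0 ord0 ^+ 2 + y ord0 ord_max ^+ 2 by rewrite sqr_sqrtr.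
have [s0|s0] := eqVneq s 0.
  exists 0, 0; split=> //; rewrite /polar !mul0r oppr0.
  move: s2; rewrite s0 expr0n /= => /esym/eqP; rewrite paddr_eq0 ?sqr_ge0// !sqrf_eq0.
  move=> /andP[/eqP y0 /eqP y1]; rewrite -(vecE y) /coord1 /coord2 y0 y1.
  by [].
have u1 : (y ord0 ord_max / s) ^+ 2 + (- y ord0 ord0 / s) ^+ 2 = 1.
  by rewrite mulNr sqrrN !expr_div_n -mulrDl addrC -s2 divff// sqrf_eq0.
have [t [ct st]] := unit_circle u1.
exists s, t; split; first exact: sqrtr_ge0.
by rewrite /polar ct st mulNr mulrN opprK !(mulrC s) !divfK// vecE.
Qed.

Lemma polar_norm s t i : `|(polar s t : 'rV[R]_2) ord0 i| <= `|s|.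
Proof.
rewrite mxE; case: ifP => _; rewrite ?normrN normrM ler_piMr//.
- exact: (norm_trig false).
- exact: (norm_trig true).
Qed.

Lemma polar0 t : polar 0 t = 0 :> 'rV[R]_2.
Proof. by apply/rowP => i; rewrite !mxE !mul0r oppr0 if_same. Qed.

(* A function in [polar_class J] is of order J at the origin, so that each of its
   partial derivatives costs one power of s and there is no need to control the
   derivatives of H there. *)
Definition polar_class J b := exists2 H, SB (weight false) H &
  forall s t, b (polar s t) = s ^+ J * H (vec s t).

Lemma polar_class_bounded J b : polar_class J b -> bounded_by (weight true) b.
Proof.
(* The planar weight is at most [(1 + |s|)^2]; the [J] additional powers absorb [s^J]. *)
move=> [H SH E] m; have [C hC] := SB_bounded SH (2 * m + J)%N.
exists C => y; have [s [t [s0 ->]]] := polar_surj y.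
apply: le_trans (hC (vec s t)); rewrite E normrM exprD.
have ws : weight false (vec s t) = 1 + `|s| by rewrite /weight /fiber_weight mulr1 mxE.
rewrite mulrA ler_wpM2r// ws; apply: ler_pM.
- by rewrite exprn_ge0 ?weight_ge0.
- by [].
- rewrite exprM lerXn2r ?nnegrE ?weight_ge0 ?exprn_ge0 ?addr_ge0// expr2 /weight /fiber_weight.
  by apply: ler_pM; rewrite ?addr_ge0// lerD2l polar_norm.
- by rewrite normrX lerXn2r ?nnegrE ?addr_ge0// lerDr.
Qed.

Section Chart.
Context (t0 : R).

(** [chart_u] and [chart_v] are the components of [y] along omega at the angle [t0] and along its
    derivative in t. Where [chart_u] is nonzero, the arctangent of their quotient is an angle
    counted from [t0], with a radius that may be negative. *)
Definition chart_u y : R := - (y ord0 ord0 * sin t0) + y ord0 ord_max * cos t0.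
Definition chart_v y : R := - (y ord0 ord0 * cos t0 + y ord0 ord_max * sin t0).
Definition chart_angle y : R := atan (chart_v y / chart_u y).
Definition chart_radius y : R := chart_u y / cos (chart_angle y).

Lemma chart_polar y : chart_u y != 0 -> polar (chart_radius y) (t0 + chart_angle y) = y.
Proof.
move=> u0; have c0 : cos (chart_angle y) != 0.
  by rewrite cos_atan invr_eq0 sqrtr_eq0 -ltNge ltr_pwDl// sqr_ge0.
have rc : chart_radius y * cos (chart_angle y) = chart_u y by rewrite divfK.
have rs : chart_radius y * sin (chart_angle y) = chart_v y.
  rewrite /chart_radius mulrAC -mulrA -/(tan (chart_angle y)) /chart_angle atanK.
  by rewrite mulrC divfK.
have cs : cos t0 ^+ 2 + sin t0 ^+ 2 = 1 :> R := cos2Dsin2 t0.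
rewrite /polar sinD cosD -[RHS]vecE /coord1 /coord2; congr vec.
  transitivity (- (sin t0 * (chart_radius y * cos (chart_angle y)) + cos t0 * (chart_radius y * sin (chart_angle y)))).
    by ring.
  rewrite rc rs /chart_u /chart_v.
  transitivity (y ord0 ord0 * (cos t0 ^+ 2 + sin t0 ^+ 2)); [by ring|by rewrite cs mulr1].
transitivity (cos t0 * (chart_radius y * cos (chart_angle y)) - sin t0 * (chart_radius y * sin (chart_angle y))).
  by ring.
rewrite rc rs /chart_u /chart_v.
transitivity (y ord0 ord_max * (cos t0 ^+ 2 + sin t0 ^+ 2)); [by ring|by rewrite cs mulr1].
Qed.

Lemma total_chart_u : total chart_u.
Proof.
apply: totalD; [apply: totalN|]; apply: totalM; by [exact: total_coord|exact: total_cst].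
Qed.

Lemma total_chart_v : total chart_v.
Proof.
by apply: totalN; apply: totalD; apply: totalM; [exact: total_coord|exact: total_cst|exact: total_coord|exact: total_cst].
Qed.

Lemma differentiable_real_comp (k : R -> R) (f : 'rV[R]_2 -> R) y :
  derivable k (f y) 1 -> differentiable f y -> differentiable (fun z => k (f z)) y.
Proof.
move=> dk df; apply: (@differentiable_comp _ _ _ _ f k) => //.
exact: (derivable1_diffP k (f y)).1.
Qed.

Lemma differentiable_chart y : chart_u y != 0 ->
  differentiable chart_angle y /\ differentiable chart_radius y.
Proof.
move=> u0; have da : differentiable chart_angle y.
  apply: (@differentiable_real_comp atan); first exact: derivable_atan.
  apply: (@differentiableM _ _ chart_v (fun z => (chart_u z)^-1)); first exact: total_chart_v.
  exact: (differentiableV (total_chart_u y) u0).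
split=> //; apply: (@differentiableM _ _ chart_u (fun z => (cos (chart_angle z))^-1)).
  exact: total_chart_u.
apply: (@differentiableV _ _ (fun z => cos (chart_angle z))).
  by apply: differentiable_real_comp => //; exact: derivable_cos.
by rewrite cos_atan invr_eq0 sqrtr_eq0 -ltNge ltr_pwDl// sqr_ge0.
Qed.

End Chart.

Lemma polar_class_differentiable J b y : polar_class J b -> y != 0 -> differentiable b y.
Proof.
move=> [H SH E] y0; have [s [t [s0 ys]]] := polar_surj y.
have sp : 0 < s.
  by rewrite lt_def s0 andbT; apply: contra_neq y0 => s00; rewrite ys s00 polar0.
have uy : chart_u t y = s.
  rewrite ys /chart_u !mxE /=.
  transitivity (s * (cos t ^+ 2 + sin t ^+ 2)); [by ring|by rewrite cos2Dsin2 mulr1].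
have uy0 : chart_u t y != 0 by rewrite uy gt_eqF.
have [da dr] := differentiable_chart uy0.
(* On the sup-norm ball of radius [s / 2] around [y], [chart_u] differs by less than [s] from its
   value [s] at [y], so it stays positive. *)
apply: (@differentiable_local _ b
  (fun z => chart_radius t z ^+ J * H (vec (chart_radius t z) (t + chart_angle t z))) y (s / 2)).
- by rewrite divr_gt0.
- move=> h hs; have u0 : chart_u t (h + y) != 0.
    have -> : chart_u t (h + y) = chart_u t h + s by rewrite -uy /chart_u !mxE; ring.
    have hu : `|chart_u t h| < s.
      apply: (@le_lt_trans _ _ (2 * `|h|)); last by rewrite mulrC -ltr_pdivlMr.
      rewrite mulr_natl mulr2n; apply: le_trans (ler_normD _ _) _.
      rewrite normrN !normrM; apply: lerD.
        by apply: le_trans (le_coord_norm h ord0); rewrite ler_piMr// (norm_trig false).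
      by apply: le_trans (le_coord_norm h ord_max); rewrite ler_piMr// (norm_trig true).
    by rewrite gt_eqF//; move: hu; rewrite ltr_norml => /andP[]; lra.
  by rewrite -{1}(chart_polar u0) E.
- apply: differentiableM.
    apply: (@differentiable_real_comp (fun r => r ^+ J)) => //; exact: exprn_derivable.
  have dta : differentiable (fun z => t + chart_angle t z) y.
    by apply: differentiableD => //; exact: differentiable_cst.
  exact: (diff_comp_vec dr dta (SB_total SH _)).1.
Qed.

(** Order at least two gives [|b(h)| <= C s^2 <= 2 C |h|^2], the factor 2 coming from the sup
    norm. *)
Lemma polar_class_origin J b : polar_class J.+2 b ->
  differentiable b 0 /\ forall i, partial i b 0 = 0.
Proof.
move=> [H SH E]; have [C hC] := SB_bounded SH J.
have b0 : b 0 = 0 by rewrite -(polar0 0) E expr0n mul0r.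
apply: (@differentiable_quadratic _ b 0 (fun=> 0) (2 * C)) => h.
rewrite addr0 b0 !mulr0 addr0 !subr0; have [s [t [s0 hs]]] := polar_surj h.
have sh : s ^+ 2 <= 2 * `|h| ^+ 2.
  have -> : s ^+ 2 = `|h ord0 ord0| ^+ 2 + `|h ord0 ord_max| ^+ 2.
    rewrite !real_normK ?num_real// hs !mxE /=.
    transitivity (s ^+ 2 * (cos t ^+ 2 + sin t ^+ 2)); [by rewrite cos2Dsin2 mulr1|by ring].
  by rewrite mulr_natl mulr2n lerD// lerXn2r ?nnegrE// le_coord_norm.
have hJ : s ^+ J * `|H (vec s t)| <= C.
  apply: le_trans (hC (vec s t)); rewrite ler_wpM2r// lerXn2r ?nnegrE ?weight_ge0//.
  by rewrite (le_trans (ler_norm _))// (le_trans _ (coord1_weight false (vec s t)))// mxE.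
rewrite {1}hs E normrM normrX (ger0_norm s0).
have -> : s ^+ J.+2 * `|H (vec s t)| = s ^+ 2 * (s ^+ J * `|H (vec s t)|).
  by rewrite -addn2 exprD; ring.
rewrite (mulrAC 2 C).
have C0 : 0 <= C by apply: le_trans hJ; rewrite mulr_ge0// exprn_ge0.
by apply: ler_pM => //; rewrite ?sqr_ge0 ?mulr_ge0 ?exprn_ge0.
Qed.

Lemma is_derive_exprn n (t : R) : is_derive t 1 (fun t => t ^+ n) (n%:R * t ^+ n.-1).
Proof.
apply: DeriveDef; first exact: exprn_derivable.
by rewrite exp_derive /GRing.scale /= mulr1.
Qed.

(** The radial derivative and the angular one divided by [s] are obtained from the partial
    derivatives by an orthogonal matrix. Inverting it costs one power of [s]; at [s = 0] the partial
    derivatives are zero by [polar_class_origin]. *)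
Lemma polar_class_partial J b : polar_class J.+2 b ->
  total b /\ forall i, polar_class J.+1 (partial i b).
Proof.
move=> Pb; have [d0 p0] := polar_class_origin Pb.
have db : total b.
  move=> y; have [->//|y0] := eqVneq y 0; exact: (polar_class_differentiable Pb y0).
split=> //; have [H SH E] := Pb.
have Ds s t : - sin t * partial ord0 b (polar s t) + cos t * partial ord_max b (polar s t) =
    J.+2%:R * s ^+ J.+1 * H (vec s t) + s ^+ J.+2 * partial ord0 H (vec s t).
  have u1 : is_derive s 1 (fun s => - (s * sin t)) (- sin t).
    apply: is_derive_eq (is_derive_opp (is_derive_mul (is_derive_self s) (is_derive_const (sin t) s))) _.
    by rewrite mul1r mulr0 addr0.
  have u2 : is_derive s 1 (fun s => s * cos t) (cos t).
    apply: is_derive_eq (is_derive_mul (is_derive_self s) (is_derive_const (cos t) s)) _.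
    by rewrite mul1r mulr0 addr0.
  have h1 := is_derive_comp_vec u1 u2 (db _).
  have h2 := is_derive_mul (is_derive_exprn J.+2 s)
    (is_derive_comp_vec (is_derive_self s) (is_derive_const t s) (SB_total SH _)).
  rewrite (_ : (fun _ => _) = fun s => b (polar s t)) in h2; last by apply/funext => s'; rewrite E.
  by have := is_derive_unique h1 h2; rewrite mul1r mul0r addr0.
have Dt s t : - (s * cos t) * partial ord0 b (polar s t) + - (s * sin t) * partial ord_max b (polar s t) =
    s ^+ J.+2 * partial ord_max H (vec s t).
  have u1 : is_derive t 1 (fun t => - (s * sin t)) (- (s * cos t)).
    apply: is_derive_eq (is_derive_opp (is_derive_mul (is_derive_const s t) (is_derive_sin t))) _.
    by rewrite mul0r add0r.
  have u2 : is_derive t 1 (fun t => s * cos t) (- (s * sin t)).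
    apply: is_derive_eq (is_derive_mul (is_derive_const s t) (is_derive_cos t)) _.
    by rewrite mul0r add0r mulrN.
  have h1 := is_derive_comp_vec u1 u2 (db _).
  have h2 := is_derive_mul (is_derive_const (s ^+ J.+2) t)
    (is_derive_comp_vec (is_derive_const s t) (is_derive_self t) (SB_total SH _)).
  rewrite (_ : (fun _ => _) = fun t => b (polar s t)) in h2; last by apply/funext => t'; rewrite E.
  by have := is_derive_unique h1 h2; rewrite !mul0r !add0r mul1r.
have w0 := @weight_ge0 R false.
(* [s^(J+1) A] is the radial derivative of [s^(J+2) H]. *)
pose A x := J.+2%:R * H x + mul1 (partial ord0 H) x.
have SA : SB (weight false) A.
  by apply: SBD => //; [exact: SBZ|exact/SB_mul_coord1/SB_partial].
have SK c d (e f : R) : SB (weight false) (fun x => e * mul_trig c A x + f * mul_trig d (partial ord_max H) x).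
  exact: (SBD w0 (SBZ e w0 (SB_mul_trig c w0 SA)) (SBZ f w0 (SB_mul_trig d w0 (SB_partial ord_max SH)))).
move=> i; case: (ord2P i) => ->.
  exists (fun x => -1 * mul_trig false A x + -1 * mul_trig true (partial ord_max H) x) => // s t.
  have [->|s0] := eqVneq s 0; first by rewrite polar0 p0 expr0n /= mul0r.
  apply: (mulfI s0); rewrite /mul_trig /A /mul1 !mxE /=.
  transitivity (- sin t * (s * (- sin t * partial ord0 b (polar s t) + cos t * partial ord_max b (polar s t))) -
      cos t * (- (s * cos t) * partial ord0 b (polar s t) + - (s * sin t) * partial ord_max b (polar s t))).
    transitivity (s * partial ord0 b (polar s t) * (cos t ^+ 2 + sin t ^+ 2)); last by ring.
    by rewrite cos2Dsin2 mulr1.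
  by rewrite Ds Dt !exprS; ring.
exists (fun x => 1 * mul_trig true A x + -1 * mul_trig false (partial ord_max H) x) => // s t.
have [->|s0] := eqVneq s 0; first by rewrite polar0 p0 expr0n /= mul0r.
apply: (mulfI s0); rewrite /mul_trig /A /mul1 !mxE /=.
transitivity (cos t * (s * (- sin t * partial ord0 b (polar s t) + cos t * partial ord_max b (polar s t))) -
    sin t * (- (s * cos t) * partial ord0 b (polar s t) + - (s * sin t) * partial ord_max b (polar s t))).
  transitivity (s * partial ord_max b (polar s t) * (cos t ^+ 2 + sin t ^+ 2)); last by ring.
  by rewrite cos2Dsin2 mulr1.
by rewrite Ds Dt !exprS; ring.
Qed.

Lemma polar_class_iter J b P (s : seq 'I_2) : polar_class (size s + J).+1 b -> SB (weight true) P ->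
  polar_class J.+1 (iter_partial s b) /\
  iter_partial s (fun y => P y + b y) = fun y => iter_partial s P y + iter_partial s b y.
Proof.
move=> Pb SP; elim: s J Pb => [|i s IH] J Pb //.
have [Ps Es] := IH J.+1 (eq_ind _ (fun n => polar_class n.+1 b) Pb _ (addSnnS (size s) J)).
have [ds dp] := polar_class_partial Ps.
split; first exact: dp.
rewrite /= Es; exact: (partialD i (SB_total (SB_iter s SP)) ds).
Qed.

Lemma cylinder0_polar (G : 'rV[R]_2 -> R) : cylinder 0 G -> exists2 b : 'rV[R]_2 -> R, SB (weight true) b &
  forall s t, G (vec s t) = b (polar s t).
Proof.
move=> [SG eG hG].
(* For nonzero [s], polar coordinates are unique up to [(s, t) -> (- s, t + pi)] and periods, under
   which [G] is invariant; at [s = 0] the jet of order 0 is constant. *)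
have wd s s' t t' : polar s t = polar s' t' -> G (vec s t) = G (vec s' t').
  move=> e; have e0 := congr1 (fun y : 'rV[R]_2 => y ord0 ord0) e.
  have e1 := congr1 (fun y : 'rV[R]_2 => y ord0 ord_max) e.
  rewrite !mxE /= in e0 e1; move: e0 => /oppr_inj e0.
  have s2 : s ^+ 2 = s' ^+ 2.
    transitivity ((s * cos t) ^+ 2 + (s * sin t) ^+ 2).
      by rewrite !exprMn -mulrDr cos2Dsin2 mulr1.
    by rewrite e0 e1 !exprMn -mulrDr cos2Dsin2 mulr1.
  have [s0|s0] := eqVneq s 0.
    move: s2; rewrite s0 expr0n /= => /esym/eqP; rewrite sqrf_eq0 => /eqP ->.
    have := hG 0; rewrite /= => -[c hc].
    by rewrite -[LHS]/(jet 0 G t) -[RHS]/(jet 0 G t') hc.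
  have [B sB] : exists B : bool, s' = (-1) ^+ B * s.
    move/eqP: s2; rewrite eqf_sqr => /orP[] /eqP ->; [exists false|exists true].
      by rewrite expr0 mul1r.
    by rewrite expr1 mulN1r opprK.
  have sg : (-1) ^+ B * (-1) ^+ B = 1 :> R by rewrite -expr2 sqrr_sign.
  have := eG B s t t'; rewrite muln0 expr0 mul1r sB => ->//.
  - apply: (mulfI s0); rewrite mulrCA e1 sB !mulrA.
    by rewrite sg mul1r.
  - apply: (mulfI s0); rewrite mulrCA e0 sB !mulrA.
    by rewrite sg mul1r.
have [q hq] : {q : 'rV[R]_2 -> R * R & forall y, y = polar (q y).1 (q y).2}.
  apply: (@choice _ _ (fun y (z : R * R) => y = polar z.1 z.2)) => y.
  by have [s [t [_ e]]] := polar_surj y; exists (s, t).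
pose b y := G (vec (q y).1 (q y).2).
have bE s t : G (vec s t) = b (polar s t) by apply: wd; rewrite -hq.
(* The function [b] is fixed, but it is decomposed anew for each list of derivatives: after [size s]
   of them the remainder must still be of order two to be differentiable at the origin. *)
have main s : total (iter_partial s b) /\ bounded_by (weight true) (iter_partial s b).
  have [P [H [SP SH E]]] := polar_expansion (size s + 1).+1 SG hG.
  pose c y := b y - P y.
  have Pc : polar_class (size s + 1).+1 c.
    by exists H => // r t; rewrite /c -bE E addrC addKr.
  have [Pi Ei] := polar_class_iter Pc SP.
  have bPc : b = fun y => P y + c y by apply/funext => y; rewrite /c addrCA subrr addr0.
  rewrite bPc Ei; split.
    apply: totalD; first exact: SB_total (SB_iter s SP).
    exact: (polar_class_partial Pi).1.
  apply: bounded_byD; first exact: weight_ge0.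
    exact: SB_bounded (SB_iter s SP).
  exact: polar_class_bounded Pi.
by exists b => //; split=> [s y|s]; [exact: (main s).1|exact: (main s).2].
Qed.

End Polar_coordinates.

(** * Inversion and the range of the ray transform with monomial weights *)

Section Inversion.
Context {R : realType}.
Implicit Types (u G H : 'rV[R]_2 -> R) (x : 'rV[R]_2).

Local Notation one := (fun=> 1 : R).
Local Notation mu := (@lebesgue_measure R).

Lemma fourierZ b c (e : R) u x : SB (weight b) u ->
  fourier c (fun y => e * u y) x = e * fourier c u x.
Proof.
move=> Su; rewrite /fourier -itgZ; last exact: decaying_kernel_term Su.
by congr itg; apply/funext => p; rewrite /kernel_term mulrA.
Qed.

Definition gauss1 x : R := mul_gauss (fun=> 1) x.

Lemma SB_gauss1 : SB (weight false) gauss1.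
Proof. exact: SB_mul_gauss (@SB_cst R 1). Qed.

Definition gauss_hat (s : R) := fourier true gauss1 (vec s 0).

Lemma itg_gauss : itg (@gauss R) = Num.sqrt pi.
Proof.
rewrite /itg /Rintegral -[RHS]/(fine (Num.sqrt pi)%:E) -integralT_gauss; congr fine.
Qed.

(** Since the derivative of the Gaussian is [- 2 p] times it, its transform [g] solves
    [g' = - (s / 2) g]. Hence [g(s) exp (s^2 / 4)] is constant, equal to the Gaussian integral. *)
Lemma gauss_hatE s : gauss_hat s = Num.sqrt pi * gauss (s / 2).
Proof.
have Sg := SB_gauss1.
have [dF F0 _] := fourier_partial true Sg.
have E1 : partial ord0 gauss1 = fun x => -2 * mul1 gauss1 x.
  have [dg pg] := partial_comp1 ord0 (@is_derive_gauss R) (@total_coord R ord0).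
  have -> : gauss1 = fun x => gauss (x ord0 ord0).
    by apply/funext => x; rewrite /gauss1 /mul_gauss mulr1.
  rewrite pg partial_coord; apply/funext => x; rewrite /mul1 /=; ring.
have E2 (t : R) : t * gauss_hat t = 2 * fourier false (mul1 gauss1) (vec t 0).
  have := fourier_mul_coord1 true (vec t 0) Sg; rewrite mxE /= => ->.
  rewrite E1 (fourierZ _ _ _ (SB_mul_coord1 Sg)) /dtrig /=; ring.
have D (t : R) : is_derive t 1 gauss_hat (- (t / 2) * gauss_hat t).
  have h := is_derive_comp_vec (is_derive_self t) (is_derive_const 0 t) (dF _).
  apply: is_derive_eq h _; rewrite mul1r mul0r addr0 F0 /dtrig /=.
  transitivity (- 2^-1 * (t * gauss_hat t)); last by field.
  by rewrite E2; field.
pose k t := gauss_hat t * expR (t * t / 4).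
have De (t : R) : is_derive t 1 (fun t : R => expR (t * t / 4)) (t / 2 * expR (t * t / 4)).
  have d1 : is_derive t 1 (fun t : R => t * t / 4) (t / 2).
    have h := is_derive_mul (is_derive_mul (is_derive_self t) (is_derive_self t)) (is_derive_const (4^-1) t).
    by apply: is_derive_eq h _; field.
  by have := @is_derive1_comp R expR (fun t : R => t * t / 4) t _ _ (is_derive_expR _) d1; rewrite mulrC.
have Dk (t : R) : is_derive t 1 k 0.
  by have h := is_derive_mul (D t) (De t); apply: is_derive_eq h _; ring.
have k0 : k s = k 0 by apply: is_derive_0_is_cst.
have k00 : k 0 = Num.sqrt pi.
  rewrite /k !mul0r expR0 mulr1 /gauss_hat /fourier -itg_gauss; congr itg.
  apply/funext => p; rewrite /kernel_term !mxE /= mulr0 /trig cos0 mulr1.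
  by rewrite /gauss1 /mul_gauss mxE /= mulr1.
have <- := etrans k0 k00.
transitivity (gauss_hat s * (expR (s * s / 4) * expR (- (s / 2 * (s / 2))))); last by rewrite mulrA.
by rewrite -expRD (_ : _ + _ = 0) ?expR0 ?mulr1//; field.
Qed.

Lemma decaying_gauss_hat : decaying gauss_hat.
Proof. exact: SB_decaying 0 (SB_fourier true SB_gauss1). Qed.

Lemma decaying_gauss : decaying (@gauss R).
Proof.
have := SB_decaying 0 SB_gauss1; congr decaying; apply/funext => p.
by rewrite /gauss1 /mul_gauss mxE mulr1.
Qed.

(** The source of the [2 pi] in the inversion formula: the factor [sqrt pi] times the integral
    [2 sqrt pi] of the dilated Gaussian. *)
Lemma itg_gauss_hat : itg gauss_hat = 2 * pi.
Proof.
have -> : gauss_hat = fun s => Num.sqrt pi * gauss (0 + 2^-1 * s).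
  by apply/funext => s; rewrite gauss_hatE add0r (mulrC s).
have h2 : (2^-1 : R) != 0 by rewrite invr_eq0.
rewrite itgZ; last exact: decaying_affine decaying_gauss.
have := itg_affine 0 h2 decaying_gauss; rewrite itg_gauss ger0_norm ?invr_ge0// => E.
have h : itg (fun t => gauss (0 + 2^-1 * t)) = 2 * (2^-1 * itg (fun t : R => gauss (0 + 2^-1 * t))).
  by field.
rewrite {}h -E; by rewrite mulrCA -expr2 sqr_sqrtr// pi_ge0.
Qed.

(** In [G = G(0, t) gauss + p H], the cosine transform of the second term is the derivative in s of
    the sine transform of [H], so its integral vanishes and only the Gaussian remains. *)
Lemma fourier_inversion G t : SB (weight false) G ->
  itg (fun s => fourier true G (vec s t)) = 2 * pi * G (vec 0 t).
Proof.
move=> SG; set H := hadamard_quotient G.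
have SH : SB (weight false) H := SB_hadamard SG.
have SmH := SB_mul_coord1 SH.
have E s : fourier true G (vec s t) = G (vec 0 t) * gauss_hat s + fourier true (mul1 H) (vec s t).
  rewrite /gauss_hat /fourier -itgZ; last exact: decaying_kernel_term SB_gauss1.
  rewrite -itgD; [|exact/decayingZ/(decaying_kernel_term _ _ SB_gauss1)|exact: decaying_kernel_term SmH].
  congr itg; apply/funext => p; rewrite /kernel_term (hadamardE _ SG) -/H /mul1 /gauss1 /mul_gauss !mxE /=.
  by ring.
rewrite (funext E) itgD; [|exact/decayingZ/decaying_gauss_hat|exact: SB_decaying (SB_fourier true SmH)].
rewrite itgZ ?itg_gauss_hat; last exact: decaying_gauss_hat.
rewrite mulrC; suff -> : itg (fun s => fourier true (mul1 H) (vec s t)) = 0 by rewrite addr0.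
have SF := SB_fourier false SH; have [dF F0 _] := fourier_partial false SH.
have [C hC] := SB_bounded SF 1.
apply: (@itg_derive _ (fun s => fourier false H (vec s t)) _ C).
- exact: SB_decaying (SB_fourier true SmH).
- move=> s; have h := is_derive_comp_vec (is_derive_self s) (is_derive_const t s) (dF _).
  by apply: is_derive_eq h _; rewrite mul1r mul0r addr0 F0 /dtrig /= mul1r.
- move=> s; have := hC (vec s t); rewrite expr1 mulrC; apply: le_trans.
  by rewrite ler_wpM2l// /weight /fiber_weight mulr1 mxE.
Qed.

Lemma fourier_sin_odd G t : SB (weight false) G -> itg (fun s => fourier false G (vec s t)) = 0.
Proof.
move=> SG; have D := SB_decaying t (SB_fourier false SG).
have E : (fun s => fourier false G (vec (- s) t)) = fun s => - fourier false G (vec s t).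
  apply/funext => s; rewrite /fourier -itgN; last exact: decaying_kernel_term SG.
  congr itg; apply/funext => p; rewrite /kernel_term !mxE /= mulrN /trig sinN mulrN.
  by [].
have := itg_opp D; rewrite E itgN// => h; lra.
Qed.

End Inversion.

(** * Plane integrals under linear maps *)

Section Plane.
Context {R : realType}.
Implicit Types (u : 'rV[R]_2 -> R).

Local Notation one := (fun=> 1 : R).

Definition plane_itg u : R := itg (fun x => itg (fun y => u (vec x y))).

Definition linear_map (a b c d : R) (x : 'rV[R]_2) : 'rV[R]_2 :=
  vec (a * x ord0 ord0 + b * x ord0 ord_max) (c * x ord0 ord0 + d * x ord0 ord_max).

Lemma SB_linear a b c d u : a * d - b * c != 0 -> SB (weight true) u ->
  SB (weight true) (fun x => u (linear_map a b c d x)).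
Proof.
move=> D0 Su; pose D := a * d - b * c.
pose K := `|a / D| + `|b / D| + `|c / D| + `|d / D|.
(* By the inverse matrix, each of the two factors of the weight at [x] is at most [1 + K] times the
   weight at the image, hence the squares. *)
have := @SB_affine R (weight true) (weight true) u 0 a b 0 c d ((1 + K) ^+ 2) 2.
have w0 := @weight_ge0 R true.
move=> /(_ w0 w0) H.
have -> : (fun x => u (linear_map a b c d x)) =
    fun x => u (vec (0 + (a * x ord0 ord0 + b * x ord0 ord_max)) (0 + (c * x ord0 ord0 + d * x ord0 ord_max))).
  by apply/funext => x; rewrite !add0r.
apply: H => // x; rewrite !add0r -/(linear_map a b c d x) -exprMn.
set y := linear_map a b c d x.
have e0 : x ord0 ord0 = d / D * y ord0 ord0 - b / D * y ord0 ord_max.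
  by rewrite !mxE /= /D; field.
have e1 : x ord0 ord_max = a / D * y ord0 ord_max - c / D * y ord0 ord0.
  by rewrite !mxE /= /D; field.
have K0 : 0 <= K by rewrite /K !addr_ge0.
have bd (e f p q : R) : `|e| + `|f| <= K -> 1 + `|e * p - f * q| <= (1 + K) * ((1 + `|p|) * (1 + `|q|)).
  move=> efK; apply: (@le_trans _ _ (1 + (`|e| * `|p| + `|f| * `|q|))).
    by rewrite lerD2l; apply: le_trans (ler_normB _ _) _; rewrite !normrM.
  have := normr_ge0 e; have := normr_ge0 f; have := normr_ge0 p; have := normr_ge0 q.
  move: efK K0; move: `|e| `|f| `|p| `|q| => E F P Q efK K0 Q0 P0 F0 E0.
  have h1 : E * P <= K * P by rewrite ler_wpM2r//; lra.
  have h2 : F * Q <= K * Q by rewrite ler_wpM2r//; lra.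
  have h3 : 0 <= P * Q by rewrite mulr_ge0.
  have h4 : 0 <= K * (P * Q) by rewrite mulr_ge0.
  lra.
rewrite expr2 /weight /fiber_weight; apply: ler_pM; rewrite ?addr_ge0//.
  rewrite {1}e0; apply: bd; rewrite /K.
  by have := normr_ge0 (a / D); have := normr_ge0 (c / D); lra.
rewrite {1}e1 (mulrC (1 + `|y ord0 ord0|)); apply: bd; rewrite /K.
by have := normr_ge0 (b / D); have := normr_ge0 (d / D); lra.
Qed.

Lemma SB_plane_bound u : SB (weight true) u -> plane_bound u.
Proof.
move=> Su; have [C hC] := SB_bounded Su 2; exists C => x y.
rewrite -invfM ler_pdivlMr; last first.
  by rewrite mulr_gt0// (lt_le_trans ltr01)// oneDsqr_ge1.
apply: le_trans (hC (vec x y)); rewrite mulrC ler_wpM2r// /weight /fiber_weight !mxE /= exprMn.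
have h (t : R) : oneDsqr t <= (1 + `|t|) ^+ 2.
  by have := oneDsqr_weight false t 0; rewrite /weight /fiber_weight mulr1 mxE.
by apply: ler_pM => //; rewrite (le_trans ler01)// oneDsqr_ge1.
Qed.

Lemma plane_itg_swap u : SB (weight true) u ->
  plane_itg u = plane_itg (fun x => u (vec (x ord0 ord_max) (x ord0 ord0))).
Proof.
move=> Su; rewrite /plane_itg (itg_swap (SB_continuous Su) (SB_plane_bound Su)).
by congr itg; apply/funext => x; congr itg; apply/funext => y; rewrite !mxE.
Qed.

Lemma SB_slice2 u x : SB (weight true) u -> decaying (fun y => u (vec x y)).
Proof. by move=> Su; exact: decaying_slice2 (SB_continuous Su) (SB_plane_bound Su). Qed.

Definition swap u (x : 'rV[R]_2) : R := u (vec (x ord0 ord_max) (x ord0 ord0)).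

Lemma SB_swap u : SB (weight true) u -> SB (weight true) (swap u).
Proof.
move=> Su; have D0 : (0 : R) * 0 - 1 * 1 != 0 by rewrite mul0r sub0r mulr1 oppr_eq0 oner_eq0.
have := SB_linear D0 Su; congr SB; apply/funext => x.
by rewrite /swap /linear_map !mul0r !mul1r add0r addr0.
Qed.

(** Integration over parallel lines is a cosine transform at frequency 0, so the decay comes from
    [SB_fourier]. *)
Lemma decaying_itg u : SB (weight true) u -> decaying (fun x => itg (fun y => u (vec x y))).
Proof.
move=> Su; have := SB_slice2 0 (SB_fourier true (SB_swap Su)).
congr decaying; apply/funext => x; congr itg; apply/funext => y.
by rewrite /kernel_term /swap !mxE /= mulr0 /trig cos0 mulr1.
Qed.

(* Fubini reduces the change of variables to affine substitutions on lines. *)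
Lemma plane_itg_linear a b c d u : a * d - b * c != 0 -> b != 0 -> SB (weight true) u ->
  plane_itg u = `|a * d - b * c| * plane_itg (fun x => u (linear_map a b c d x)).
Proof.
move=> D0 b0 Su; set D := a * d - b * c.
have nz : 0 * (d / b) - 1 * (- D / b) != 0.
  by rewrite mul0r sub0r mul1r oppr_eq0 mulNr oppr_eq0 mulf_neq0// invr_eq0.
(* [v(x, z) = u(z, (d z - D x) / b)], where [z = a x + b y] replaces [y]: each substitution then
   concerns a single variable. *)
pose v (x : 'rV[R]_2) := u (linear_map 0 1 (- D / b) (d / b) x).
have Sv : SB (weight true) v by exact: SB_linear.
have e1 x : itg (fun y => u (linear_map a b c d (vec x y))) = `|b|^-1 * itg (fun y => v (vec x y)).
  rewrite (itg_affine (a * x) b0 (SB_slice2 x Sv)) mulKf ?normr_eq0//.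
  congr itg; apply/funext => y; congr u; rewrite /linear_map !mxE /=.
  by congr vec; [ring|rewrite /D; field].
have -> : plane_itg (fun x => u (linear_map a b c d x)) = `|b|^-1 * plane_itg v.
  rewrite /plane_itg -itgZ; last exact: decaying_itg.
  by congr itg; apply/funext => x; exact: e1.
have Db0 : - D / b != 0 by rewrite mulf_neq0 ?invr_eq0// oppr_eq0.
have e2 y : itg (fun z => u (vec y z)) = `|- D / b| * itg (fun x => v (vec x y)).
  rewrite (itg_affine (d / b * y) Db0 (SB_slice2 y Su)); congr (_ * itg _); apply/funext => x.
  by congr u; rewrite /linear_map !mxE /=; congr vec; ring.
rewrite (plane_itg_swap Sv) {1}/plane_itg (funext e2) itgZ; last first.
  have := decaying_itg (SB_swap Sv); congr decaying; apply/funext => y; congr itg.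
  by apply/funext => x; rewrite /swap !mxE.
have -> : plane_itg (fun x => v (vec (x ord0 ord_max) (x ord0 ord0))) = itg (fun y => itg (fun x => v (vec x y))).
  by congr itg; apply/funext => y; congr itg; apply/funext => x; rewrite !mxE.
by rewrite normrM normrN normfV mulrA.
Qed.

Lemma plane_itg_rotation t u : SB (weight true) u ->
  plane_itg (fun x => u (linear_map (- sin t) (cos t) (cos t) (sin t) x)) = plane_itg u.
Proof.
move=> Su; have cs : cos t ^+ 2 + sin t ^+ 2 = 1 :> R := cos2Dsin2 t.
have D : - sin t * sin t - cos t * cos t = -1 :> R by rewrite -cs; ring.
have D0 : - sin t * sin t - cos t * cos t != 0 :> R by rewrite D oppr_eq0 oner_eq0.
(* [plane_itg_linear] divides by the entry [cos t]. If it vanishes, the matrix is diagonal with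
   entries of absolute value 1. *)
have [c0|c0] := eqVneq (cos t) 0; last first.
  by rewrite (plane_itg_linear D0 c0 Su) D normrN1 mul1r.
have s0 : sin t != 0.
  by apply: contra_eq_neq cs => s0; rewrite c0 s0 expr0n /= addr0 eq_sym oner_eq0.
have s1 : `|sin t| * `|sin t| = 1 by rewrite -normrM -expr2 -cs c0 expr0n /= add0r ger0_norm// sqr_ge0.
have sN0 : - sin t != 0 by rewrite oppr_eq0.
rewrite /plane_itg; have e x y : u (linear_map (- sin t) (cos t) (cos t) (sin t) (vec x y)) =
    u (vec (0 + - sin t * x) (0 + sin t * y)).
  by rewrite /linear_map !mxE /= c0 !mul0r addr0 !add0r.
have -> : (fun x => itg (fun y => u (linear_map (- sin t) (cos t) (cos t) (sin t) (vec x y)))) =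
    fun x => itg (fun y => u (vec (0 + - sin t * x) (0 + sin t * y))).
  by apply/funext => x; congr itg; apply/funext => y.
rewrite (itg_affine 0 sN0 (decaying_itg Su)) -itgZ; last first.
  exact: decaying_affine sN0 (decaying_itg Su).
congr itg; apply/funext => x.
rewrite (itg_affine 0 s0 (SB_slice2 (0 + - sin t * x) Su)) mulrA normrN s1 mul1r.
by [].
Qed.

End Plane.

(** * The projection-slice theorem and the range with monomial weights *)

Section Slice.
Context {R : realType}.
Implicit Types (u bc bs G : 'rV[R]_2 -> R).

Local Notation one := (fun=> 1 : R).
Local Notation wt := (@weight R true).

Lemma SB_plane_cylinder u : SB wt u -> SB (weight false) u.
Proof.
apply: (@SB_weaken _ _ _ _ 1 1) => x; rewrite ?weight_ge0// expr1 mul1r /weight.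
by rewrite ler_wpM2l ?addr_ge0// fiber_weight_ge1.
Qed.

(** [ift_cos - i ift_sin] is the transform of [bc - i bs] in the first variable against
    [exp (i p x_1)]. *)
Definition ift_cos bc bs x : R := fourier true bc x + fourier false bs x.
Definition ift_sin bc bs x : R := fourier true bs x + -1 * fourier false bc x.

(* The real part of the inverse Fourier transform of [bc - i bs], up to a constant
   factor, as two successive one-dimensional transforms. *)
Definition ift bc bs x : R :=
  swap (fourier true (swap (ift_cos bc bs))) x + swap (fourier false (swap (ift_sin bc bs))) x.

Lemma SB_ift_cos bc bs : SB wt bc -> SB wt bs -> SB wt (ift_cos bc bs).
Proof.
by move=> Sc Ss; exact: SBD (@weight_ge0 R true) (SB_fourier true Sc) (SB_fourier false Ss).
Qed.

Lemma SB_ift_sin bc bs : SB wt bc -> SB wt bs -> SB wt (ift_sin bc bs).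
Proof.
move=> Sc Ss; have w0 := @weight_ge0 R true.
exact: SBD w0 (SB_fourier true Ss) (SBZ (-1) w0 (SB_fourier false Sc)).
Qed.

Lemma SB_ift bc bs : SB wt bc -> SB wt bs -> SB wt (ift bc bs).
Proof.
move=> Sc Ss; have S1 := SB_ift_cos Sc Ss; have S2 := SB_ift_sin Sc Ss.
apply: (SBD (@weight_ge0 R true)).
  exact: SB_swap (SB_fourier true (SB_swap S1)).
exact: SB_swap (SB_fourier false (SB_swap S2)).
Qed.

Definition dot2 (x y : 'rV[R]_2) : R := x ord0 ord0 * y ord0 ord0 + x ord0 ord_max * y ord0 ord_max.

Lemma SB_plane_wave c u x : SB wt u -> SB wt (fun y => trig c (dot2 x y) * u y).
Proof.
move=> Su; apply: SB_mul1 => //; first exact: weight_ge0.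
have := @SB_affine R one one (fun z => trig c (z ord0 ord0)) 0 (x ord0 ord0) (x ord0 ord_max) 0 0 0 1 0.
have h1 (z : 'rV[R]_2) : 0 <= one z by exact: ler01.
have h2 (z : 'rV[R]_2) : one z <= 1 * 1 ^+ 0 by rewrite expr0 mulr1.
move=> /(_ h1 h1 (fun z => h2 z) (SB_trig c ord0)).
by congr SB; apply/funext => y; rewrite mxE /= add0r.
Qed.

Definition wave_packet bc bs x y : R := trig true (dot2 x y) * bc y + trig false (dot2 x y) * bs y.

Lemma SB_wave_packet bc bs x : SB wt bc -> SB wt bs -> SB wt (wave_packet bc bs x).
Proof.
move=> Sc Ss.
exact: SBD (@weight_ge0 R true) (SB_plane_wave true x Sc) (SB_plane_wave false x Ss).
Qed.

(** The addition formulas merge the two successive transforms into one plane integral, a form in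
    which the effect of [rotate] is visible. *)
Lemma iftE bc bs x : SB wt bc -> SB wt bs -> ift bc bs x = plane_itg (wave_packet bc bs x).
Proof.
move=> Sc Ss; have S1 := SB_ift_cos Sc Ss; have S2 := SB_ift_sin Sc Ss.
have Sw := SB_wave_packet x Sc Ss.
rewrite (plane_itg_swap Sw) /ift {1 3}/swap /fourier -itgD; last 2 first.
- exact: decaying_kernel_term (SB_swap S1).
- exact: decaying_kernel_term (SB_swap S2).
rewrite /plane_itg; congr itg; apply/funext => q.
have Dc c u : SB wt u -> decaying (fun p => kernel_term c u p (vec (x ord0 ord0) q)).
  by move=> Su; exact: decaying_kernel_term Su.
rewrite /kernel_term /swap !mxE /= /ift_cos /ift_sin /fourier.
set c1 := cos _; set s1 := sin _.
set A := itg _; set B := itg _; set C := itg _; set D := itg _.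
have -> : (A + B) * c1 + (C + -1 * D) * s1 = (c1 * A + - s1 * D) + (c1 * B + s1 * C) by ring.
rewrite /A /B /C /D -!itgZ; try exact: Dc.
rewrite -!itgD; try (by do ?apply: decayingD; apply: decayingZ; exact: Dc).
congr itg; apply/funext => p.
rewrite /kernel_term /wave_packet /dot2 !mxE /= /trig cosD sinD /c1 /s1 /trig.
by rewrite [p * x ord0 ord0]mulrC [q * x ord0 ord_max]mulrC; ring.
Qed.

(* The coordinates of x are those in the frame (omega, zeta); the determinant is -1. *)
Definition rotate t (x : 'rV[R]_2) := linear_map (- sin t) (cos t) (cos t) (sin t) x.

Lemma SB_rotate t u : SB wt u -> SB wt (fun x => u (rotate t x)).
Proof.
move=> Su; apply: SB_linear => //.
have -> : - sin t * sin t - cos t * cos t = -1 :> R by rewrite -(cos2Dsin2 t); ring.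
by rewrite oppr_eq0 oner_eq0.
Qed.

Lemma dot2_rotate t x y : dot2 (rotate t x) (rotate t y) = dot2 x y.
Proof.
rewrite /dot2 /rotate /linear_map !mxE /=.
transitivity ((x ord0 ord0 * y ord0 ord0 + x ord0 ord_max * y ord0 ord_max) * (cos t ^+ 2 + sin t ^+ 2)).
  by ring.
by rewrite cos2Dsin2 mulr1.
Qed.

Lemma ift_rotate t bc bs x : SB wt bc -> SB wt bs ->
  ift bc bs (rotate t x) = ift (fun y => bc (rotate t y)) (fun y => bs (rotate t y)) x.
Proof.
move=> Sc Ss; rewrite (iftE (rotate t x) Sc Ss) (iftE x (SB_rotate t Sc) (SB_rotate t Ss)).
rewrite -(plane_itg_rotation t (SB_wave_packet (rotate t x) Sc Ss)); congr plane_itg.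
by apply/funext => y; rewrite /wave_packet -/(rotate t y) dot2_rotate.
Qed.

(* The projection-slice theorem for the lines p = const. *)
Lemma itg_ift bc bs p : SB wt bc -> SB wt bs ->
  itg (fun s => ift bc bs (vec p s)) = 2 * pi * ift_cos bc bs (vec p 0).
Proof.
move=> Sc Ss; have S1 := SB_swap (SB_ift_cos Sc Ss); have S2 := SB_swap (SB_ift_sin Sc Ss).
have -> : (fun s => ift bc bs (vec p s)) = fun s =>
    fourier true (swap (ift_cos bc bs)) (vec s p) + fourier false (swap (ift_sin bc bs)) (vec s p).
  by apply/funext => s; rewrite /ift {1 3}/swap !mxE.
rewrite itgD; [|exact: SB_decaying (SB_fourier true S1)|exact: SB_decaying (SB_fourier false S2)].
rewrite (fourier_inversion p (SB_plane_cylinder S1)) (fourier_sin_odd p (SB_plane_cylinder S2)) addr0.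
by rewrite /swap !mxE.
Qed.

Lemma rotate_polar t s : rotate t (vec s 0) = polar s t.
Proof. by rewrite /rotate /linear_map /polar !mxE /= !mulr0 !addr0 mulNr ![_ * s]mulrC. Qed.

(** Each radial derivative brings out a factor p, so the r-th jet is, up to sign, the r-th moment if
    a cosine is left, and zero if a sine is left. *)
Lemma hom_jets_fourier k c u : SB (weight false) u ->
  (forall j, Hom (k + j) (fun t => itg (fun p => p ^+ j * u (vec p t)))) ->
  hom_jets k (fourier c u).
Proof.
move=> Su hu r; elim: r k c u Su hu => [|r IH] k c u Su hu.
  case: c.
    have := hu 0; congr Hom; apply/funext => t; congr itg; apply/funext => p.
    by rewrite expr0 mul1r /kernel_term !mxE /= mulr0 /trig cos0 mulr1.
  have : Hom (k + 0) (fun=> 0 : R) by exact: Hom_const0.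
  congr Hom; apply/funext => t; rewrite /jet /= /fourier -[LHS]itg0; congr itg; apply/funext => p.
  by rewrite /kernel_term !mxE /= mulr0 /trig sin0 mulr0.
have Sm := SB_mul_coord1 Su; have [_ F0 _] := fourier_partial c Su.
have := IH k.+1 (~~ c) (mul1 u) Sm.
have hm j : Hom (k.+1 + j) (fun t => itg (fun p => p ^+ j * mul1 u (vec p t))).
  have := hu j.+1; rewrite addnS addSn; congr Hom; apply/funext => t; congr itg; apply/funext => p.
  by rewrite /mul1 mxE /= exprSr mulrA.
move=> /(_ hm) /(HomZ (dtrig c)); rewrite addSnnS; congr Hom; apply/funext => t.
by rewrite jetS F0 jetZ//; exact: SB_radially_smooth (SB_fourier _ Sm).
Qed.

Lemma equivariant_fourier m c u : SB (weight false) u -> equivariant m u -> equivariant m (fourier c u).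
Proof.
move=> Su eu b s t t' ct st.
have s0 : ((-1) ^+ b : R) != 0 by rewrite signr_eq0.
rewrite /fourier -itgZ; last exact: decaying_kernel_term Su.
rewrite (itg_affine 0 s0 (decaying_kernel_term c (vec ((-1) ^+ b * s) t') Su)) normr_sign mul1r.
congr itg; apply/funext => p; rewrite /kernel_term !mxE add0r (eu b p t t' ct st).
have -> : (-1) ^+ b * p * ((-1) ^+ b * s) = p * s by rewrite mulrACA -expr2 sqrr_sign mul1r.
by rewrite mulrA.
Qed.

Definition monomial m j (t : R) : R := cos t ^+ j * sin t ^+ (m - j).

Lemma cylinder_decomposition m G : cylinder m G -> exists2 b : nat -> 'rV[R]_2 -> R,
  forall j, SB wt (b j) &
  forall s t, G (vec s t) = \sum_(j < m.+1) monomial m j t * b j (polar s t).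
Proof.
elim: m G => [|m IH] G cG.
  have [b Sb E] := cylinder0_polar cG; exists (fun=> b) => // s t.
  by rewrite big_ord1 E /monomial !expr0 !mul1r.
have [G1 [G2 [c1 c2 E]]] := cylinder_reduction cG.
have [b1 S1 E1] := IH _ c1; have [b2 S2 E2] := IH _ c2.
have [z Sz z0] : exists2 z : 'rV[R]_2 -> R, SB wt z & forall x, z x = 0.
  exists (fun x => 0 * b1 0 x) => [|x]; last by rewrite mul0r.
  exact: SBZ (@weight_ge0 R true) (S1 0).
(* Multiplication by [cos t] shifts the index of a monomial and multiplication by [sin t] keeps it;
   [z] fills the coefficient missing at either end. *)
exists (fun j x => (if j is j'.+1 then b1 j' x else z x) + (if (j <= m)%N then b2 j x else z x)).
  move=> j; apply: SBD; first exact: weight_ge0.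
    by case: j.
  by case: (j <= m)%N.
move=> s t; rewrite E !mxE /= E1 E2.
under [RHS]eq_bigr do rewrite mulrDr; rewrite big_split /=; congr (_ + _).
  rewrite [RHS]big_ord_recl /= z0 mulr0 add0r big_distrr /=; apply: eq_bigr => j _.
  by rewrite /bump /= /monomial add1n subSS exprS !mulrA.
rewrite [RHS]big_ord_recr /= ltnn z0 mulr0 addr0 big_distrr /=; apply: eq_bigr => j _.
rewrite -ltnS ltn_ord /monomial subSn -1?ltnS ?ltn_ord// exprS; ring.
Qed.

Lemma SB_shift p G : SB (weight false) G ->
  SB (weight false) (fun x => G (vec (p + x ord0 ord0) (x ord0 ord_max))).
Proof.
move=> SG; have w0 := @weight_ge0 R false.
have := @SB_affine R (weight false) (weight false) G p 1 0 0 0 1 (1 + `|p|) 1 w0 w0.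
have hw (x : 'rV[R]_2) : weight false x <= (1 + `|p|) *
    weight false (vec (p + (1 * x ord0 ord0 + 0 * x ord0 ord_max)) (0 + (0 * x ord0 ord0 + 1 * x ord0 ord_max))) ^+ 1.
  rewrite expr1 /weight /fiber_weight !mulr1 mxE /= mul1r mul0r addr0.
  have := ler_normB (p + x ord0 ord0) p; rewrite [p + _]addrC addrK => h.
  have := normr_ge0 p; have := normr_ge0 (x ord0 ord0 + p).
  move: h; move: `|x ord0 ord0| `|x ord0 ord0 + p| `|p| => X Y P h Y0 P0.
  have := mulr_ge0 P0 Y0; lra.
move=> /(_ hw SG); congr SB; apply/funext => x.
by rewrite !mul1r !mul0r addr0 !add0r.
Qed.

(** Inversion on the axis for the translate of [G] by p; the cosine of [s (q - p)] splits into the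
    two products. *)
Lemma fourier_reconstruction G p t : SB (weight false) G ->
  fourier true (fourier true G) (vec p t) + fourier false (fourier false G) (vec p t) =
  2 * pi * G (vec p t).
Proof.
move=> SG; have Ss := SB_shift p SG.
have := fourier_inversion t Ss; rewrite !mxE /= addr0 => <-.
have Sc := SB_fourier true SG; have Sn := SB_fourier false SG.
rewrite /fourier -itgD; [|exact: decaying_kernel_term Sc|exact: decaying_kernel_term Sn].
congr itg; apply/funext => s.
have n0 : (1 : R) != 0 by exact: oner_neq0.
rewrite (itg_affine (- p) n0 (decaying_kernel_term true (vec s t) Ss)) normr1 mul1r.
have KE c u a b q : kernel_term c u q (vec a b) = u (vec q b) * trig c (q * a).
  by rewrite /kernel_term !mxE.
rewrite (KE true _ p t) (KE false _ p t) ![_ * trig _ (s * p)]mulrC /fourier.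
rewrite -!itgZ; [|exact: decaying_kernel_term SG|exact: decaying_kernel_term SG].
rewrite -itgD; [|exact/decayingZ/(decaying_kernel_term _ _ SG)|exact/decayingZ/(decaying_kernel_term _ _ SG)].
congr itg; apply/funext => q; rewrite !KE mul1r !mxE /= addrA subrr add0r.
rewrite /trig mulrDl cosD mulNr cosN sinN [s * p]mulrC; ring.
Qed.

Theorem radon_range m G : SB (weight false) G -> equivariant m G ->
  (forall r, Hom (m + r) (fun t => itg (fun p => p ^+ r * G (vec p t)))) ->
  exists2 a : nat -> 'rV[R]_2 -> R, forall j, SB wt (a j) &
  forall p t, G (vec p t) =
    \sum_(j < m.+1) monomial m j t * itg (fun s => a j (rotate t (vec p s))).
Proof.
move=> SG eG hG.
have cyl c : cylinder m (fourier c G).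
  split; [exact: SB_fourier|exact: equivariant_fourier|exact: hom_jets_fourier].
have [bc Sc Ec] := cylinder_decomposition (cyl true).
have [bs Ss Es] := cylinder_decomposition (cyl false).
pose k : R := (2 * pi)^-1.
have pi0 : 2 * pi != 0 :> R by rewrite mulf_neq0// gt_eqF// pi_gt0.
(* One factor [k] cancels the [2 pi] of the projection-slice formula, the other that of the
   reconstruction. *)
exists (fun j x => k ^+ 2 * ift (bc j) (bs j) x).
  by move=> j; apply: SBZ; [exact: weight_ge0|exact: SB_ift].
move=> p t.
pose rc j y := bc j (rotate t y); pose rs j y := bs j (rotate t y).
have Src j : SB wt (rc j) by exact: SB_rotate.
have Srs j : SB wt (rs j) by exact: SB_rotate.
have E j : itg (fun s => k ^+ 2 * ift (bc j) (bs j) (rotate t (vec p s))) =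
    k * (fourier true (rc j) (vec p 0) + fourier false (rs j) (vec p 0)).
  under eq_fun do rewrite ift_rotate//.
  rewrite itgZ; last exact: SB_slice2 (SB_ift (Src j) (Srs j)).
  rewrite (itg_ift p (Src j) (Srs j)) -/(ift_cos (rc j) (rs j) (vec p 0)) mulrA; congr (_ * _).
  by rewrite /k expr2 -mulrA mulVf// mulr1.
under eq_bigr do rewrite E mulrCA mulrDr.
rewrite -big_distrr big_split /=.
suff H c (b : nat -> 'rV[R]_2 -> R) : (forall j, SB wt (b j)) ->
    (forall s t, fourier c G (vec s t) = \sum_(j < m.+1) monomial m j t * b j (polar s t)) ->
    \sum_(j < m.+1) monomial m j t * fourier c (fun y => b j (rotate t y)) (vec p 0) =
    fourier c (fourier c G) (vec p t).
  by rewrite (H true bc)// (H false bs)// fourier_reconstruction// /k mulKf.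
move=> Sb Eb; rewrite [RHS]/fourier.
have Dk j : decaying (fun q => monomial m j t * kernel_term c (fun y => b j (rotate t y)) q (vec p 0)).
  by apply: decayingZ; exact: decaying_kernel_term (SB_rotate t (Sb j)).
have -> : (fun q => kernel_term c (fourier c G) q (vec p t)) =
    fun q => \sum_(j < m.+1) monomial m j t * kernel_term c (fun y => b j (rotate t y)) q (vec p 0).
  apply/funext => q; rewrite /kernel_term !mxE /= Eb big_distrl /=; apply: eq_bigr => j _.
  by rewrite rotate_polar mulrA.
have : forall n, decaying (fun q => \sum_(j < n) monomial m j t * kernel_term c (fun y => b j (rotate t y)) q (vec p 0)) /\
    itg (fun q => \sum_(j < n) monomial m j t * kernel_term c (fun y => b j (rotate t y)) q (vec p 0)) =
    \sum_(j < n) monomial m j t * fourier c (fun y => b j (rotate t y)) (vec p 0).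
  elim=> [|n [Dn IH]].
    split; last by under eq_fun do rewrite big_ord0; rewrite big_ord0 itg0.
    by under eq_fun do rewrite big_ord0; have := decayingZ 0 (Dk 0); under eq_fun do rewrite mul0r.
  have e : (fun q => \sum_(j < n.+1) monomial m j t * kernel_term c (fun y => b j (rotate t y)) q (vec p 0)) =
    fun q => \sum_(j < n) monomial m j t * kernel_term c (fun y => b j (rotate t y)) q (vec p 0) +
      monomial m n t * kernel_term c (fun y => b n (rotate t y)) q (vec p 0).
    by apply/funext => q; rewrite big_ord_recr.
  rewrite e; split; first exact: decayingD.
  rewrite itgD// IH big_ord_recr /=; congr (_ + _); rewrite itgZ//.
  exact: decaying_kernel_term (SB_rotate t (Sb n)).
by move=> /(_ m.+1) [_ ->].
Qed.

End Slice.

(** * Necessity of the moment conditions *)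

Section Moments.
Context {R : realType}.
Implicit Types (u : 'rV[R]_2 -> R) (h : R -> R).

Local Notation wt := (@weight R true).

Lemma Hom_equivariant d h (b : bool) (t t' : R) : Hom d h ->
  cos t' = (-1) ^+ b * cos t -> sin t' = (-1) ^+ b * sin t ->
  h t' = (-1) ^+ (b * d) * h t.
Proof.
move=> + ct st; elim: d h => [|d IH] h /=.
  by move=> [c ->]; rewrite muln0 expr0 mul1r.
move=> [h1 [h2 [/IH E1 /IH E2 ->]]].
by rewrite E1 E2 ct st mulnS exprD; ring.
Qed.

Lemma Hom_one_cos : Hom 1 (@cos R).
Proof.
have : Hom 1 (fun t : R => cos t * 1) by apply: Hom_cos; exists 1.
by congr Hom; apply/funext => t; rewrite mulr1.
Qed.

Lemma Hom_one_sin : Hom 1 (@sin R).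
Proof.
have : Hom 1 (fun t : R => sin t * 1) by apply: Hom_sin; exists 1.
by congr Hom; apply/funext => t; rewrite mulr1.
Qed.

Lemma Hom_prod (n : nat) (h : 'I_n -> R -> R) : (forall i, Hom 1 (h i)) ->
  Hom n (fun t => \prod_(i < n) h i t).
Proof.
elim: n h => [|n IH] h H.
  by exists 1; apply/funext => t; rewrite big_ord0.
have := HomM (H ord0) (IH _ (fun i => H (lift ord0 i))).
by congr Hom; apply/funext => t; rewrite big_ord_recl.
Qed.

Lemma Hom_sum (I : finType) d (h : I -> R -> R) : (forall i, Hom d (h i)) ->
  Hom d (fun t => \sum_i h i t).
Proof.
move=> H; elim: (index_enum I) => [|i s IH].
  by under eq_fun do rewrite big_nil; exact: Hom_const0.
by under eq_fun do rewrite big_cons; exact: HomD.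
Qed.

Lemma coord_weight j (x : 'rV[R]_2) : `|x ord0 j| <= wt x.
Proof.
have [->|->] := ord2P j; first exact: coord1_weight.
rewrite -[leLHS]mul1r; apply: ler_pM => //; first by rewrite lerDl.
by rewrite /fiber_weight lerDr.
Qed.

Lemma SB_mul_coord j u : SB wt u -> SB wt (fun x => x ord0 j * u x).
Proof. by apply: SB_coord => x; exact: coord_weight. Qed.

Lemma plane_itgD u v : SB wt u -> SB wt v ->
  plane_itg (fun x => u x + v x) = plane_itg u + plane_itg v.
Proof.
move=> Su Sv; rewrite /plane_itg -itgD; [|exact: decaying_itg|exact: decaying_itg].
by congr itg; apply/funext => x; rewrite itgD//; exact: SB_slice2.
Qed.

Lemma plane_itgZ (c : R) u : SB wt u -> plane_itg (fun x => c * u x) = c * plane_itg u.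
Proof.
move=> Su; rewrite /plane_itg -itgZ; last exact: decaying_itg.
by congr itg; apply/funext => x; rewrite itgZ//; exact: SB_slice2.
Qed.

(** The inner product of [y] with omega, constant and equal to p on the line with coordinates
    [(p, t)]. *)
Definition normal_coord (t : R) (y : 'rV[R]_2) : R :=
  cos t * y ord0 ord_max + - sin t * y ord0 ord0.

Lemma SB_mul_normal t u : SB wt u -> SB wt (fun y => normal_coord t y * u y).
Proof.
move=> Su; have w0 := @weight_ge0 R true.
have := SBD w0 (SBZ (cos t) w0 (SB_mul_coord ord_max Su)) (SBZ (- sin t) w0 (SB_mul_coord ord0 Su)).
by congr SB; apply/funext => y; rewrite /normal_coord mulrDl !mulrA.
Qed.

Lemma SB_mul_normalX r t u : SB wt u -> SB wt (fun y => normal_coord t y ^+ r * u y).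
Proof.
elim: r u => [|r IH] u Su.
  by have := Su; congr SB; apply/funext => y; rewrite expr0 mul1r.
have := IH _ (SB_mul_normal t Su).
by congr SB; apply/funext => y; rewrite exprSr mulrA.
Qed.

(** One factor of the power is expanded as [cos t y_2 - sin t y_1], and its coordinate is absorbed
    into [u]. *)
Lemma Hom_plane_moment r u : SB wt u ->
  Hom r (fun t => plane_itg (fun y => normal_coord t y ^+ r * u y)).
Proof.
elim: r u => [|r IH] u Su.
  exists (plane_itg u); apply/funext => t; congr plane_itg; apply/funext => y.
  by rewrite expr0 mul1r.
have S j := SB_mul_coord j Su.
have := HomD (Hom_cos (IH _ (S ord_max))) (Hom_sin (HomZ (-1) (IH _ (S ord0)))).
congr Hom; apply/funext => t.
have Sn j := SB_mul_normalX r t (S j); have w0 := @weight_ge0 R true.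
rewrite mulrA mulrN1 -(plane_itgZ _ (Sn ord_max)) -(plane_itgZ _ (Sn ord0)).
rewrite -(plane_itgD (SBZ _ w0 (Sn ord_max)) (SBZ _ w0 (Sn ord0))).
congr plane_itg; apply/funext => y; rewrite /normal_coord exprS; ring.
Qed.

Lemma normal_coord_rotate t x : normal_coord t (rotate t x) = x ord0 ord0.
Proof.
rewrite /normal_coord /rotate /linear_map !mxE /=.
transitivity (x ord0 ord0 * (cos t ^+ 2 + sin t ^+ 2)); first by ring.
by rewrite cos2Dsin2 mulr1.
Qed.

Lemma decaying_ray t u : SB wt u -> decaying (fun p => itg (fun s => u (rotate t (vec p s)))).
Proof. by move=> Su; exact: decaying_itg (SB_rotate t Su). Qed.

Lemma ray_moment r t u : SB wt u ->
  decaying (fun p => p ^+ r * itg (fun s => u (rotate t (vec p s)))) /\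
  itg (fun p => p ^+ r * itg (fun s => u (rotate t (vec p s)))) =
  plane_itg (fun y => normal_coord t y ^+ r * u y).
Proof.
move=> Su; have Sr := SB_mul_normalX r t Su.
have E : (fun p => p ^+ r * itg (fun s => u (rotate t (vec p s)))) =
    fun p => itg (fun s => normal_coord t (rotate t (vec p s)) ^+ r * u (rotate t (vec p s))).
  apply/funext => p; rewrite -itgZ; last exact: SB_slice2 (SB_rotate t Su).
  by congr itg; apply/funext => s; rewrite normal_coord_rotate mxE.
rewrite E; split; first exact: decaying_ray Sr.
by rewrite -(plane_itg_rotation t Sr).
Qed.

Lemma decaying_sum (I : finType) (f : I -> R -> R) : (forall i, decaying (f i)) ->
  decaying (fun t => \sum_i f i t) /\ itg (fun t => \sum_i f i t) = \sum_i itg (f i).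
Proof.
move=> H; elim: (index_enum I) => [|i s [IH1 IH2]].
  under eq_fun do rewrite big_nil; rewrite big_nil itg0; split=> //; split.
    by move=> t; exact: cvg_cst.
  by exists 0 => t; rewrite normr0 mul0r.
under eq_fun do rewrite big_cons; rewrite big_cons itgD//; split; last by rewrite IH2.
exact: decayingD.
Qed.

Section Ray_sum.
Context (I : finType) (m : nat) (c : I -> R -> R) (u : I -> 'rV[R]_2 -> R).
Context (Hc : forall i, Hom m (c i)) (Su : forall i, SB wt (u i)).

(** The common shape of the real and imaginary parts of the mixed ray transform: [c i] stands for a
    product of components of zeta and its rotation, [u i] for a component of the tensor field. *)
Definition ray_sum (p t : R) : R := itg (fun s => \sum_i c i t * u i (rotate t (vec p s))).

Lemma ray_sumE p t : ray_sum p t = \sum_i c i t * itg (fun s => u i (rotate t (vec p s))).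
Proof.
have D i := SB_slice2 p (SB_rotate t (Su i)).
rewrite /ray_sum (decaying_sum (fun i => decayingZ (c i t) (D i))).2.
by apply: eq_bigr => i _; rewrite itgZ.
Qed.

Lemma ray_sum_odd p (t t' : R) : cos t' = - cos t -> sin t' = - sin t ->
  ray_sum (- p) t' = (-1) ^+ m * ray_sum p t.
Proof.
move=> ct st; rewrite !ray_sumE big_distrr; apply: eq_bigr => i _ /=.
rewrite (@Hom_equivariant m (c i) true t t' (Hc i)); try by rewrite expr1 mulN1r.
rewrite mul1n -mulrA; congr (_ * (_ * _)).
rewrite -itg_opp; last exact: SB_slice2 (SB_rotate t' (Su i)).
congr itg; apply/funext => s; congr (u i _).
rewrite /rotate /linear_map !mxE /= ct st; congr vec; ring.
Qed.

Lemma ray_sum_moment r : Hom (m + r) (fun t => itg (fun p => p ^+ r * ray_sum p t)).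
Proof.
have : Hom (m + r) (fun t => \sum_i c i t * plane_itg (fun y => normal_coord t y ^+ r * u i y)).
  by apply: Hom_sum => i; apply: HomM => //; exact: Hom_plane_moment.
congr Hom; apply/funext => t.
have D i := decayingZ (c i t) (ray_moment r t (Su i)).1.
have E : (fun p => p ^+ r * ray_sum p t) =
    fun p => \sum_i c i t * (p ^+ r * itg (fun s => u i (rotate t (vec p s)))).
  apply/funext => p; rewrite ray_sumE big_distrr; apply: eq_bigr => i _ /=.
  by rewrite mulrCA.
rewrite E (decaying_sum D).2; apply: eq_bigr => i _.
by rewrite (itgZ _ (ray_moment r t (Su i)).1) (ray_moment r t (Su i)).2.
Qed.

End Ray_sum.
End Moments.

(** * Complex notation and homogeneous polynomials *)

Section Cylinder_coordinates.
Context {R : realType}.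

Lemma expr_oneD_le m (a : R) : 0 <= a -> (1 + a) ^+ m <= 2 ^+ m * (1 + a ^+ m).
Proof.
move=> a0; have [a1|a1] := leP a 1.
  apply: (@le_trans _ _ (2 ^+ m)); last by rewrite ler_peMr ?exprn_ge0// lerDl exprn_ge0.
  by apply: lerXn2r; rewrite ?nnegrE ?addr_ge0//; lra.
apply: (@le_trans _ _ (2 ^+ m * a ^+ m)); last by rewrite ler_wpM2l ?exprn_ge0// lerDr.
by rewrite -exprMn; apply: lerXn2r; rewrite ?nnegrE ?mulr_ge0 ?addr_ge0//; lra.
Qed.

(** The weight [(1 + |x_1|)^m (1 + |x_2|)^m] is bounded through [expr_oneD_le] by the four monomials
    with exponents 0 or m. *)
Lemma schwartz_SB (f : 'rV[R]_2 -> R) : schwartz_R2_real f <-> SB (weight true) f.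
Proof.
split=> [[sf bf]|[sf bf]]; split=> //.
  move=> s m; have [c1 h1] := bf 0%N 0%N s; have [c2 h2] := bf m 0%N s.
  have [c3 h3] := bf 0%N m s; have [c4 h4] := bf m m s.
  exists (2 ^+ m * 2 ^+ m * (c1 + c2 + c3 + c4)) => x.
  have := h1 x; have := h2 x; have := h3 x; have := h4 x.
  rewrite !normrM !normrX /coord1 /coord2 !expr0 !mul1r mulr1.
  rewrite /weight /fiber_weight exprMn.
  have := expr_oneD_le m (normr_ge0 (x ord0 ord0)).
  have := expr_oneD_le m (normr_ge0 (x ord0 ord_max)).
  set X := `|x ord0 ord0|; set Y := `|x ord0 ord_max|; set F := `|iter_partial s f x|.
  have F0 : 0 <= F by exact: normr_ge0.
  have X0 : 0 <= (1 + X) ^+ m by rewrite exprn_ge0// addr_ge0// normr_ge0.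
  have Y0 : 0 <= (1 + Y) ^+ m by rewrite exprn_ge0// addr_ge0// normr_ge0.
  move=> hY hX H4 H3 H2 H1.
  apply: le_trans (_ : 2 ^+ m * (1 + X ^+ m) * (2 ^+ m * (1 + Y ^+ m)) * F <= _).
    by apply: ler_wpM2r => //; exact: ler_pM.
  have -> : 2 ^+ m * (1 + X ^+ m) * (2 ^+ m * (1 + Y ^+ m)) * F =
    2 ^+ m * 2 ^+ m * (F + X ^+ m * F + Y ^+ m * F + X ^+ m * Y ^+ m * F) by ring.
  by rewrite ler_wpM2l ?mulr_ge0 ?exprn_ge0// !lerD.
move=> a b s; have [C hC] := bf s (a + b)%N; exists C => x; apply: le_trans (hC x).
rewrite !normrM !normrX exprD ler_wpM2r// ler_pM ?exprn_ge0//.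
  by apply: lerXn2r; rewrite ?nnegrE ?weight_ge0//; exact: coord_weight.
by apply: lerXn2r; rewrite ?nnegrE ?weight_ge0//; exact: coord_weight.
Qed.

Lemma schwartz_cylinder (phi : 'rV[R]_2 * 'rV[R]_2 -> R) :
  schwartz_TS1_real phi -> SB (weight false) (phi \o TS1_param).
Proof.
move=> [sf bf]; split=> // s m; have [c1 h1] := bf 0%N s; have [c2 h2] := bf m s.
exists (2 ^+ m * (c1 + c2)) => x; have := h1 x; have := h2 x.
rewrite !normrM !normrX /coord1 !expr0 !mul1r /weight /fiber_weight mulr1.
have := expr_oneD_le m (normr_ge0 (x ord0 ord0)).
set X := `|x ord0 ord0|; set F := `|iter_partial _ _ _|.
have F0 : 0 <= F by exact: normr_ge0.
move=> hX H2 H1; apply: le_trans (ler_wpM2r F0 hX) _.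
by rewrite -mulrA mulrDl mul1r ler_wpM2l ?exprn_ge0// lerD.
Qed.

Lemma TS1_paramE p t : TS1_param (vec p t) =
  (vec (- (p * sin t)) (p * cos t), vec (cos t) (sin t)) :> 'rV[R]_2 * 'rV[R]_2.
Proof.
rewrite /TS1_param /vec_of_complex /coord1 /coord2 !mxE /=.
congr (vec _ _, _); ring.
Qed.

Lemma rotateE p s t : (TS1_param (vec p t)).1 + s *: (TS1_param (vec p t)).2 =
  rotate t (vec p s) :> 'rV[R]_2.
Proof.
rewrite TS1_paramE /rotate /linear_map; apply/rowP => i; rewrite !mxE /=.
by case: (i == ord0); ring.
Qed.

Lemma TS1P (u : 'rV[R]_2 * 'rV[R]_2) : TS1 u <-> exists p t, u = TS1_param (vec p t).
Proof.
split.
  case: u => x xi; rewrite /TS1 /dotp /= !big_ord2 => -[n1 n0].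
  have [|t [ct st]] := @unit_circle R (xi ord0 ord0) (xi ord0 ord_max).
    by rewrite !expr2.
  (* The inner product of [x] with omega. *)
  exists (x ord0 ord_max * cos t - x ord0 ord0 * sin t), t.
  rewrite TS1_paramE ct st; congr (_, _); last by rewrite -[LHS]vecE.
  rewrite -[LHS]vecE; congr vec.
    transitivity (x ord0 ord0 * (xi ord0 ord0 * xi ord0 ord0 + xi ord0 ord_max * xi ord0 ord_max)
       - xi ord0 ord0 * (x ord0 ord0 * xi ord0 ord0 + x ord0 ord_max * xi ord0 ord_max)).
      by rewrite n1 n0 mulr1 mulr0 subr0.
    by ring.
  transitivity (x ord0 ord_max * (xi ord0 ord0 * xi ord0 ord0 + xi ord0 ord_max * xi ord0 ord_max)
       - xi ord0 ord_max * (x ord0 ord0 * xi ord0 ord0 + x ord0 ord_max * xi ord0 ord_max)).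
    by rewrite n1 n0 mulr1 mulr0 subr0.
  by ring.
move=> [p [t ->]]; rewrite TS1_paramE /TS1 /dotp /= !big_ord2 !mxE /= -!expr2 cos2Dsin2.
by split=> //; ring.
Qed.

Definition expi (t : R) : R[i] := cos t +i* sin t.

Lemma norm1P (z : R[i]) : `|z| = 1 <-> exists t, z = expi t.
Proof.
split.
  rewrite normc_def => /(congr1 (@complex.Re R)) /= E.
  have [|t [ct st]] := @unit_circle R (complex.Re z) (complex.Im z).
    rewrite -[LHS]sqr_sqrtr ?E ?expr1n//.
    by rewrite addr_ge0// sqr_ge0.
  by exists t; rewrite /expi ct st; case: z {E ct st}.
by move=> [t ->]; rewrite normc_def /= cos2Dsin2 sqrtr1.
Qed.

Lemma TS1_param_expi (p t : R) : TS1_param (vec p t) =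
  (vec_of_complex ('i%C * p%:C * expi t), vec_of_complex (expi t)).
Proof. by rewrite /TS1_param /coord1 /coord2 !mxE. Qed.

(** Omega changes sign together with zeta, so the base point [i p zeta] is kept by changing the sign
    of p. *)
Lemma TS1_param_opp (p t t' : R) : cos t' = - cos t -> sin t' = - sin t ->
  TS1_param (vec (- p) t') =
  (vec_of_complex ('i%C * p%:C * expi t), vec_of_complex (- expi t)).
Proof.
move=> ct st; have := TS1_param_expi p t; rewrite !TS1_paramE => -[<-].
rewrite ct st; congr (_, _); congr vec; ring.
Qed.

End Cylinder_coordinates.

Section Homogeneous_polynomials.
Context {R : realType}.

Definition cHom d (F : R -> R[i]) : Prop :=
  Hom d (fun t => complex.Re (F t)) /\ Hom d (fun t => complex.Im (F t)).

Lemma cHomM d e F G : cHom d F -> cHom e G -> cHom (d + e) (fun t => F t * G t).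
Proof.
move=> [F1 F2] [G1 G2]; split.
  have := HomD (HomM F1 G1) (HomZ (-1) (HomM F2 G2)).
  by congr Hom; apply/funext => t; case: (F t) (G t) => a b [c d'] /=; ring.
have := HomD (HomM F1 G2) (HomM F2 G1).
by congr Hom; apply/funext => t; case: (F t) (G t) => a b [c d'] /=; ring.
Qed.

Lemma cHomX d n F : cHom d F -> cHom (d * n) (fun t => F t ^+ n).
Proof.
move=> HF; elim: n => [|n IH].
  by rewrite muln0; split; [exists 1|exists 0]; apply/funext => t; rewrite expr0.
by rewrite mulnS; under eq_fun do rewrite exprS; exact: cHomM.
Qed.

Lemma cHom_expi : cHom 1 (@expi R).
Proof. by split; [exact: Hom_one_cos|exact: Hom_one_sin]. Qed.

Lemma cHom_conj_expi : cHom 1 (fun t : R => (expi t)^*%C).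
Proof.
split; first exact: Hom_one_cos.
by have := HomZ (-1) (@Hom_one_sin R); congr Hom; apply/funext => t; rewrite mulN1r.
Qed.

Lemma cHom_eval_zeta d (P : mpoly 2 R[i]) : homogeneous d P ->
  cHom d (fun t => eval_zeta P (expi t)).
Proof.
rewrite /homogeneous => /dhomogP hP; under eq_fun do rewrite /eval_zeta mevalE.
move: hP; elim: (msupp P) => [|m s IH] hm.
  by split; under eq_fun do rewrite big_nil; exact: Hom_const0.
have [I1 I2] := IH (fun k hk => hm k (@mem_behead _ (m :: s) k hk)).
have l1 : lift ord0 ord0 = ord_max :> 'I_2 by exact: val_inj.
have dm : d = (1 * m ord0 + 1 * m ord_max)%N.
  transitivity (mdeg m); first exact: esym (hm m (mem_head _ _)).
  by rewrite mdegE big_ord_recl big_ord1 l1 !mul1n.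
have : cHom (0 + d) (fun t => mcoeff m P * (expi t ^+ m ord0 * (expi t)^*%C ^+ m ord_max)).
  apply: cHomM; first by split; eexists.
  by rewrite dm; apply: cHomM; apply: cHomX; [exact: cHom_expi|exact: cHom_conj_expi].
move=> [H1 H2]; split.
  have := HomD H1 I1; congr Hom; apply/funext => t; rewrite big_cons big_ord_recl big_ord1 l1 /=.
  by case: (_ * _) => a b; case: (bigop _ _ _).
have := HomD H2 I2; congr Hom; apply/funext => t; rewrite big_cons big_ord_recl big_ord1 l1 /=.
by case: (_ * _) => a b; case: (bigop _ _ _).
Qed.

Lemma Hom_eval_zeta d (h : R -> R) : Hom d h -> exists P : mpoly 2 R[i],
  homogeneous d P /\ forall t, eval_zeta P (expi t) = (h t)%:C.
Proof.
elim: d h => [|d IH] h /=.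
  move=> [c ->]; exists (c%:C *: 1); split; first by apply: dhomogZ; exact: dhomog1.
  by move=> t; rewrite /eval_zeta mevalZ meval1 mulr1.
move=> [h1 [h2 [/IH[P1 [H1 E1]] /IH[P2 [H2 E2]] ->]]].
pose X i : mpoly 2 R[i] := mpolyX _ (mnm1 i).
have HX i : X i \is ishomog1 1 (@mdeg 2) by rewrite dhomogX; apply/eqP; exact: mdeg1.
(* [cos t = (zeta + conj zeta) / 2] and [sin t = (zeta - conj zeta) / (2 i)], with [1 / (2 i)]
   written as [2^-1 * - i]. *)
exists (2^-1 *: (X ord0 + X ord_max) * P1 + ((2 : R)^-1%:C * - 'i%C) *: (X ord0 - X ord_max) * P2); split.
  have hM (Q S : mpoly 2 R[i]) : Q \is ishomog1 1 (@mdeg 2) -> homogeneous d S -> homogeneous d.+1 (Q * S).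
    exact: dhomogM.
  apply: dhomogD; apply: hM => //; apply: dhomogZ; first exact: dhomogD.
  by apply: dhomogD; rewrite ?dhomogN.
move=> t; have := E1 t; have := E2 t; rewrite /eval_zeta => e2 e1.
rewrite mevalD !mevalM !mevalZ mevalD mevalB !mevalXU e1 e2 /=.
have -> : expi t + (expi t)^*%C = 2%:R * (cos t)%:C by exact: addcJ.
have -> : expi t - (expi t)^*%C = 2%:R * ('i%C * (sin t)%:C).
  by apply/eqP; rewrite eq_complex /expi mulr_natl mulr2n /=; apply/andP; split; apply/eqP; ring.
have n2 : (2 : R[i]) != 0 by rewrite pnatr_eq0.
have -> : (2 : R)^-1%:C = 2^-1 :> R[i] by rewrite fmorphV rmorph_nat.
rewrite rmorphD !rmorphM.
have i2 : 'i%C * 'i%C = -1 :> R[i] by rewrite -expr2; exact: sqr_i.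
transitivity ((2^-1 * 2) * (cos t)%:C * (h1 t)%:C +
    (2^-1 * 2) * - ('i%C * 'i%C) * (sin t)%:C * (h2 t)%:C : R[i]); first by ring.
by rewrite mulVf// i2 opprK !mul1r.
Qed.

Lemma cHom_polynomial d (F : R -> R[i]) : cHom d F -> exists P : mpoly 2 R[i],
  homogeneous d P /\ forall t, eval_zeta P (expi t) = F t.
Proof.
move=> [/Hom_eval_zeta[P [HP EP]] /Hom_eval_zeta[Q [HQ EQ]]].
exists (P + 'i%C *: Q); split; first by apply: dhomogD => //; exact: dhomogZ.
move=> t; have := EP t; have := EQ t; rewrite /eval_zeta => eQ eP.
rewrite mevalD mevalZ eP eQ.
by rewrite -complexE.
Qed.

End Homogeneous_polynomials.

(** * Symmetric tensors *)

Section Symmetric_tensors.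
Context {R : realType} {n : nat}.
Implicit Types (v : 'I_n -> 'rV[R]_2) (I : {ffun 'I_n -> 'I_2}).

(** Components of the symmetrised tensor product of the vectors [v a]. *)
Definition sym_tensor v I : R :=
  (n`!%:R)^-1 * \sum_(s : 'S_n) \prod_(a < n) v (s a) ord0 (I a).

Lemma sym_tensor_perm v I (s : 'S_n) : sym_tensor v [ffun a => I (s a)] = sym_tensor v I.
Proof.
rewrite /sym_tensor; congr (_ * _).
rewrite [RHS](reindex_inj (mulgI s^-1%g)) /=; apply: eq_bigr => p _.
rewrite [LHS](reindex_inj (@perm_inj _ s^-1%g)) /=; apply: eq_bigr => a _.
by rewrite ffunE permKV permM.
Qed.

(** Contraction with a power of one vector is blind to the symmetrisation: all [n!] permutations
    contribute the same product. *)
Lemma sym_tensor_contract v (x : 'rV[R]_2) :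
  \sum_I sym_tensor v I * \prod_(a < n) x ord0 (I a) = \prod_(a < n) dotp (v a) x.
Proof.
have E (s : 'S_n) : \sum_(I : {ffun 'I_n -> 'I_2})
    (\prod_(a < n) v (s a) ord0 (I a)) * \prod_(a < n) x ord0 (I a) = \prod_(a < n) dotp (v a) x.
  rewrite [RHS](reindex_inj (@perm_inj _ s)) /dotp bigA_distr_bigA /=.
  by apply: eq_bigr => I _; rewrite big_split.
under eq_bigr do rewrite -mulrA big_distrl /=.
rewrite -big_distrr exchange_big /=; under eq_bigr do rewrite E.
by rewrite sumr_const card_Sn -[X in _ * (X *+ _)]mul1r -mulrnAl mulrA mulVf ?mul1r.
Qed.

End Symmetric_tensors.

(** * The mixed ray transform in components *)

Section Assembly.
Context {R : realType} (k l : nat).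
Implicit Types (I : {ffun 'I_k -> 'I_2}) (J : {ffun 'I_l -> 'I_2}).
Implicit Types (phi : 'rV[R]_2 * 'rV[R]_2 -> R[i]) (f : tensor_field R k l).

Local Notation wt := (@weight R true).
Local Notation index := ({ffun 'I_k -> 'I_2} * {ffun 'I_l -> 'I_2})%type.

Definition direction (t : R) : 'rV[R]_2 := vec (cos t) (sin t).

Definition direction_power (K : index) (t : R) : R :=
  (\prod_(a < k) direction t ord0 (K.1 a)) * (\prod_(b < l) perp (direction t) ord0 (K.2 b)).

Lemma Hom_direction_power (K : index) : Hom (k + l) (direction_power K).
Proof.
apply: HomM; apply: Hom_prod => a.
  have [->|->] := ord2P (K.1 a).
    by have := @Hom_one_cos R; congr Hom; apply/funext => t; rewrite mxE.
  by have := @Hom_one_sin R; congr Hom; apply/funext => t; rewrite mxE.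
have [->|->] := ord2P (K.2 a).
  have := HomZ (-1) (@Hom_one_sin R); congr Hom; apply/funext => t.
  by rewrite /perp /coord2 !mxE /= mulN1r.
by have := @Hom_one_cos R; congr Hom; apply/funext => t; rewrite /perp /coord1 !mxE.
Qed.

(* Pairing [axis b] with zeta, or [perp_axis b] with its rotation, gives cos t if b
   and sin t otherwise. *)
Definition axis (b : bool) : 'rV[R]_2 := if b then vec 1 0 else vec 0 1.
Definition perp_axis (b : bool) : 'rV[R]_2 := if b then vec 0 1 else vec (-1) 0.

(** Among the [k + l] slots in order, the first [j] produce cosines and the others sines. Slot
    [k + b] meets the rotated direction, hence [perp_axis] and the test [k + b < j]. *)
Definition monomial_tensor (j : nat) (K : index) : R :=
  sym_tensor (fun a : 'I_k => axis (a < j)%N) K.1 *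
  sym_tensor (fun b : 'I_l => perp_axis (k + b < j)%N) K.2.

Lemma monomial_prod m j (t : R) : (j <= m)%N ->
  monomial m j t = \prod_(a < m) (if (a < j)%N then cos t else sin t).
Proof.
move=> /subnKC; move: (m - j)%N => d <-; rewrite big_split_ord /= /monomial addKn; congr (_ * _).
  by under eq_bigr do rewrite ltn_ord; rewrite prodr_const card_ord.
by under eq_bigr do rewrite ltnNge leq_addr /=; rewrite prodr_const card_ord.
Qed.

Lemma monomial_tensor_contract j t : (j <= k + l)%N ->
  \sum_(K : index) monomial_tensor j K * direction_power K t = monomial (k + l) j t.
Proof.
move=> jm; rewrite monomial_prod// big_split_ord /=.
have -> : \prod_(a < k) (if (a < j)%N then cos t else sin t) =
    \prod_(a < k) dotp (axis (a < j)%N) (direction t).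
  apply: eq_bigr => a _; rewrite /dotp big_ord2 /axis /direction.
  by case: (_ < _)%N; rewrite !mxE /= ?mul1r ?mul0r ?addr0 ?add0r.
have -> : \prod_(b < l) (if (k + b < j)%N then cos t else sin t) =
    \prod_(b < l) dotp (perp_axis (k + b < j)%N) (perp (direction t)).
  apply: eq_bigr => b _; rewrite /dotp big_ord2 /perp_axis /direction /perp /coord1 /coord2.
  by case: (_ < _)%N; rewrite !mxE /= ?mul1r ?mul0r ?addr0 ?add0r ?mulrNN ?mul1r.
rewrite -!sym_tensor_contract big_distrl /= -(pair_bigA _ (fun I J =>
  monomial_tensor j (I, J) * direction_power (I, J) t)) /=.
apply: eq_bigr => I _; rewrite big_distrr; apply: eq_bigr => J _ /=.
by rewrite /monomial_tensor /direction_power /= mulrACA.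
Qed.

Definition part (b : bool) (z : R[i]) : R := if b then complex.Im z else complex.Re z.

Lemma part_inj z z' : (forall b, part b z = part b z') -> z = z'.
Proof. by case: z z' => a b [c d] E; rewrite (E false : a = c) (E true : b = d). Qed.

Lemma partZr b z (c : R) : part b (z * c%:C) = part b z * c.
Proof. by case: z b => x y [] /=; ring. Qed.

Lemma partZl b z (c : R) : part b (c%:C * z) = c * part b z.
Proof. by rewrite mulrC partZr mulrC. Qed.

Lemma part_sum (T : finType) b (F : T -> R[i]) : part b (\sum_i F i) = \sum_i part b (F i).
Proof.
by apply: (big_morph (part b)) => [[x y] [z w]|]; case: b.
Qed.

Lemma part_cintegral b (g : R -> R[i]) : part b (cintegral g) = itg (fun t => part b (g t)).
Proof. by case: b. Qed.

Lemma part_mixed_ray_transform b f p t :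
  part b (mixed_ray_transform f (TS1_param (vec p t))) =
  ray_sum direction_power (fun (K : index) x => part b (f K.1 K.2 x)) p t.
Proof.
rewrite /mixed_ray_transform part_cintegral; congr itg; apply/funext => s.
rewrite rotateE TS1_paramE -/(direction t) part_sum /=.
rewrite -(pair_bigA _ (fun I J => direction_power (I, J) t * part b (f I J (rotate t (vec p s))))) /=.
apply: eq_bigr => I _; rewrite part_sum; apply: eq_bigr => J _.
by rewrite !partZr /direction_power /= mulrC mulrA mulrC mulrA.
Qed.

Lemma SB0 : SB wt (fun=> 0).
Proof.
have E s : iter_partial s (fun _ : 'rV[R]_2 => 0 : R) = fun=> 0.
  by elim: s => //= i s ->; exact: partial_cst.
split=> [s x|s m]; rewrite E; first exact: total_cst.
by exists 0 => x; rewrite normr0 mulr0.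
Qed.

Lemma SB_sum (T : finType) (u : T -> 'rV[R]_2 -> R) : (forall i, SB wt (u i)) ->
  SB wt (fun x => \sum_i u i x).
Proof.
move=> Su; elim: (index_enum T) => [|i s IH].
  by under eq_fun do rewrite big_nil; exact: SB0.
by under eq_fun do rewrite big_cons; apply: SBD => //; exact: weight_ge0.
Qed.

Lemma schwartz_tensor_part b f I J : schwartz_tensor f -> SB wt (fun x => part b (f I J x)).
Proof. by move=> [_ /(_ I J) [S1 S2]]; apply/schwartz_SB; case: b. Qed.

Lemma range_symmetry phi p (t t' : R) f : schwartz_tensor f ->
  (forall u, TS1 u -> mixed_ray_transform f u = phi u) ->
  cos t' = - cos t -> sin t' = - sin t ->
  phi (TS1_param (vec (- p) t')) = (-1) ^+ (k + l) * phi (TS1_param (vec p t)).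
Proof.
move=> Sf E ct st; rewrite -!E; try by apply/TS1P; eexists; eexists.
apply: part_inj => b.
have -> : (-1) ^+ (k + l) = ((-1) ^+ (k + l))%:C :> R[i] by rewrite rmorphXn rmorphN1.
rewrite partZl !part_mixed_ray_transform.
have Su (K : index) := schwartz_tensor_part b K.1 K.2 Sf.
exact: (ray_sum_odd Hom_direction_power Su p ct st).
Qed.

Lemma range_moment phi f r : schwartz_tensor f ->
  (forall u, TS1 u -> mixed_ray_transform f u = phi u) ->
  cHom (k + l + r) (fun t => cintegral (fun p => (p ^+ r)%:C * phi (TS1_param (vec p t)))).
Proof.
move=> Sf E.
have H b : Hom (k + l + r) (fun t => part b (cintegral (fun p => (p ^+ r)%:C * phi (TS1_param (vec p t))))).
  have := @ray_sum_moment R _ (k + l) direction_power (fun K x => part b (f K.1 K.2 x))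
    Hom_direction_power (fun K => schwartz_tensor_part b K.1 K.2 Sf) r.
  congr Hom; apply/funext => t; rewrite part_cintegral; congr itg; apply/funext => p.
  by rewrite partZl -part_mixed_ray_transform E//; apply/TS1P; eexists; eexists.
by split; [exact: H false|exact: H true].
Qed.

Lemma range_of_conditions phi : schwartz_TS1 phi ->
  (forall p (t t' : R), cos t' = - cos t -> sin t' = - sin t ->
    phi (TS1_param (vec (- p) t')) = (-1) ^+ (k + l) * phi (TS1_param (vec p t))) ->
  (forall r, cHom (k + l + r) (fun t => cintegral (fun p => (p ^+ r)%:C * phi (TS1_param (vec p t))))) ->
  exists f : tensor_field R k l, schwartz_tensor f /\
    forall u, TS1 u -> mixed_ray_transform f u = phi u.
Proof.
move=> [S1 S2] odd mom.
pose G b x := part b (phi (TS1_param x)).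
have SG b : SB (weight false) (G b) by case: b; [exact: schwartz_cylinder S2|exact: schwartz_cylinder S1].
have eG b : equivariant (k + l) (G b).
  (* The case [b = true] is condition (i); for [b = false], [TS1_param] depends on the angle only
     through its cosine and sine. *)
  move=> [] s t t'; rewrite ?expr1 ?expr0 ?mulN1r ?mul1r ?mul1n ?mul0n => ct st.
    rewrite /G (odd s t t' ct st).
    have -> : (-1) ^+ (k + l) = ((-1) ^+ (k + l))%:C :> R[i] by rewrite rmorphXn rmorphN1.
    by rewrite partZl.
  by rewrite /G !TS1_paramE ct st.
have hG b r : Hom (k + l + r) (fun t => itg (fun p => p ^+ r * G b (vec p t))).
  have [H1 H2] := mom r; have : Hom (k + l + r)
      (fun t => part b (cintegral (fun p => (p ^+ r)%:C * phi (TS1_param (vec p t))))) by case: b.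
  congr Hom; apply/funext => t; rewrite part_cintegral; congr itg; apply/funext => p.
  by rewrite partZl.
have [/= a Sa Ea] : exists2 a : bool -> nat -> 'rV[R]_2 -> R, forall b j, SB wt (a b j) &
    forall b p t, G b (vec p t) =
      \sum_(j < (k + l).+1) monomial (k + l) j t * itg (fun s => a b j (rotate t (vec p s))).
  have [a1 A1 E1] := radon_range (SG false) (eG false) (hG false).
  have [a2 A2 E2] := radon_range (SG true) (eG true) (hG true).
  by exists (fun b => if b then a2 else a1); case.
pose comp b (K : index) x : R := \sum_(j < (k + l).+1) monomial_tensor j K * a b j x.
pose f : tensor_field R k l := fun I J x => comp false (I, J) x +i* comp true (I, J) x.
have Sc b K : SB wt (comp b K) by apply: SB_sum => j; apply: SBZ => //; exact: weight_ge0.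
have pf b I J x : part b (f I J x) = comp b (I, J) x by case: b.
exists f; split.
  split; last by move=> I J; split; apply/schwartz_SB; exact: Sc.
  move=> s t I J; apply/funext => x; apply: part_inj => b; rewrite !pf.
  by apply: eq_bigr => j _; rewrite /monomial_tensor /= !sym_tensor_perm.
move=> u /TS1P[p [t ->]]; apply: part_inj => b.
rewrite part_mixed_ray_transform -/(G b (vec p t)) Ea /ray_sum.
have Dj (j : 'I_(k + l).+1) : decaying (fun s => a b j (rotate t (vec p s))).
  exact: SB_slice2 (SB_rotate t (Sa b j)).
under [RHS]eq_bigr do rewrite -itgZ//.
rewrite -(decaying_sum (fun j : 'I_(k + l).+1 => decayingZ (monomial (k + l) j t) (Dj j))).2.
congr itg; apply/funext => s.
under eq_bigr do rewrite pf /comp big_distrr /=.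
rewrite exchange_big /=; apply: eq_bigr => j _.
rewrite -(monomial_tensor_contract t (ltn_ord j)) big_distrl /=; apply: eq_bigr => K _.
by case: K => I J /=; rewrite mulrA [_ * monomial_tensor _ _]mulrC.
Qed.

End Assembly.

Theorem theorem2p5 (R : realType) (phi : 'rV[R]_2 * 'rV[R]_2 -> R[i])
    (hphi : schwartz_TS1 phi) (k l : nat) :
  (exists f : tensor_field R k l, schwartz_tensor f /\
     forall u : 'rV[R]_2 * 'rV[R]_2, TS1 u -> mixed_ray_transform f u = phi u)
  <->
  (forall (p : R) (zeta : R[i]), `|zeta| = 1 ->
     phi (vec_of_complex ('i%C * p%:C * zeta), vec_of_complex (- zeta)) =
     (-1) ^+ (k + l) *
       phi (vec_of_complex ('i%C * p%:C * zeta), vec_of_complex zeta)) /\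
  (forall r : nat, exists P : mpoly 2 R[i],
     homogeneous (k + l + r) P /\
     forall zeta : R[i], `|zeta| = 1 ->
       cintegral (fun p : R =>
         (p ^+ r)%:C *
           phi (vec_of_complex ('i%C * p%:C * zeta), vec_of_complex zeta)) =
       eval_zeta P zeta).
Proof.
have opposite (t : R) : cos (t + pi) = - cos t /\ sin (t + pi) = - sin t.
  by rewrite cosDpi sinDpi.
split=> [[f [Sf E]]|[odd mom]].
  split=> [p _ /norm1P[t ->]|r].
    have [ct st] := opposite t.
    by rewrite -TS1_param_expi -(TS1_param_opp p ct st) (range_symmetry p Sf E ct st).
  have [P [HP EP]] := cHom_polynomial (range_moment r Sf E).
  exists P; split=> // _ /norm1P[t ->]; rewrite EP; congr cintegral.
  by apply/funext => p; rewrite TS1_param_expi.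
apply: range_of_conditions => // [p t t' ct st|r].
  by rewrite (TS1_param_opp p ct st) odd ?TS1_param_expi//; apply/norm1P; exists t.
have [P [HP EP]] := mom r; have := cHom_eval_zeta HP; congr cHom; apply/funext => t.
rewrite -EP; last by apply/norm1P; exists t.
by congr cintegral; apply/funext => p; rewrite TS1_param_expi.
Qed.
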